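(* Let $(\mathscr{S},d)$ be a complete metric space, let $f\colon \mathscr{S}\to(-\infty,+\infty]$ be proper and lower semicontinuous, and let $u_0\in D(f)$. Suppose that $f$ is $(p_0,\lambda)$-convex for some $\lambda<0$ and $p_0\in[2,+\infty)$. Suppose that there exists an exponent $p\in(1,p_0]$ such that $$\#\mathrm{CMS}_p([0,a);u_0)=1\quad\text{for any } a\in(0,+\infty],$$ and let $u$ be the unique element of $\mathrm{CMS}_p([0,+\infty);u_0)$. Then for any $p'\in(1,p_0]$, setting $$S^\ast:=\sup\{a\in(0,+\infty]: \#\mathrm{CMS}_{p'}([0,a);u_0)\ge1\}\in[0,+\infty],$$ we have $S^\ast=S^\ast_{p\to p'}$ in the case (i) that $S^\ast_{p\to p'}<+\infty$, $T^\ast_u=+\infty$ and $\lim_{t\uparrow T^\ast_u}u(t)$ does not exist, and $S^\ast=+\infty$ in all other cases (ii); and the map $\Lambda\colon\mathrm{CMS}_p([0,+\infty);u_0)\to\mathrm{CMS}_{p'}([0,S^\ast);u_0)$ defined by $\Lambda(u):=u\circ\tilde{\bm{t}}_{p\to p'}$ in case (i) and $\Lambda(u):=u\circ\bm{t}_{p\to p'}$ in case (ii) is a bijection.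
   Context: $D(f):=\{v\in\mathscr{S}: f(v)<+\infty\}$; proper means $D(f)\neq\emptyset$. $\mathscr{L}$ is Lebesgue measure. The local slope is $|\partial^- f|(v):=\limsup_{w\to v}\frac{(f(v)-f(w))^+}{d(v,w)}$ if $v\in D(f)$ and $+\infty$ otherwise, where $r^+=\max\{r,0\}$. For $a\in(0,+\infty]$, $AC_{loc}([0,a);\mathscr{S})$ is the set of curves $u\colon[0,a)\to\mathscr{S}$ for which there is $m\in L^1_{loc}([0,a))$ (integrable on compact subsets of $[0,a)$) with $d(u(s),u(t))\le\int_s^t m(r)\,dr$ for all $s\le t$ in $[0,a)$; for such $u$ the metric derivative $|u'|(t):=\lim_{s\to t}\frac{d(u(t),u(s))}{|t-s|}$ exists for $\mathscr{L}$-a.e. $t$. Let $p\in(1,+\infty)$ with conjugate exponent $q$ ($1/p+1/q=1$). A curve $u\in AC_{loc}([0,a);\mathscr{S})$ is a $p$-curve of maximal slope for $f$ starting from $u_0\in D(f)$ if $u(0)=u_0$, $f\circ u$ is non-increasing, and $(f\circ u)'(t)\le-\frac1p|u'|^p(t)-\frac1q|\partial^- f|^q(u(t))$ for $\mathscr{L}$-a.e. $t\in[0,a)$. $\mathrm{CMS}_p([0,a);u_0)$ denotes the set of all such curves defined on $[0,a)$. $f$ is $(p,\lambda)$-convex ($p\in(1,+\infty)$, $\lambda\in\mathbb{R}$) if there is $\psi\colon[0,1]\to[0,1]$ with $\lim_{t\downarrow0}\psi(t)=0$ and $\psi(t)<1$ for some $t\in(0,1)$, such that for any $v_0,v_1\in\mathscr{S}$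 there is a curve (continuous map) $\gamma\colon[0,1]\to\mathscr{S}$ from $v_0$ to $v_1$ with $d(\gamma_t,\gamma_0)\le t\,d(\gamma_1,\gamma_0)$ and $f(\gamma_t)\le(1-t)f(\gamma_0)+tf(\gamma_1)-\lambda t(1-\psi(t))d^p(\gamma_0,\gamma_1)$ for every $t\in[0,1]$. For $u\in\mathrm{CMS}_p([0,a);u_0)$, $T^\ast_u:=\sup\{t\in[0,a): |\partial^- f|(u(t))>0\}\in[0,+\infty]$ (with $\sup\emptyset=0$). For exponents $p,p'$ with conjugates $q,q'$ put $\alpha:=1-\frac pq\cdot\frac{q'}{p'}$, $S^\ast_{p\to p'}:=\int_0^{T^\ast_u}|u'|^\alpha(r)\,dr\in[0,+\infty]$, and let $\tilde{\bm{t}}_{p\to p'}\colon[0,S^\ast_{p\to p'})\to[0,T^\ast_u)$ be the inverse of the strictly increasing map $t\mapsto\int_0^t|u'|^\alpha(r)\,dr$ from $[0,T^\ast_u)$ onto $[0,S^\ast_{p\to p'})$. For $u\in\mathrm{CMS}_p([0,+\infty);u_0)$, $\bm{t}_{p\to p'}\colon[0,+\infty)\to[0,T^\ast_u]$ equals $\tilde{\bm{t}}_{p\to p'}$ on $[0,S^\ast_{p\to p'})$ and equals $T^\ast_u$ on $[S^\ast_{p\to p'},+\infty)$. When the value $+\infty$ is attained, $u(+\infty):=\lim_{t\to+\infty}u(t)$. *)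

(* Defs.v *)
From HB Require Import structures.
From mathcomp Require Export all_boot all_order all_algebra.
From mathcomp Require Export all_classical all_reals all_analysis.
Export numFieldNormedType.Exports.

Set Implicit Arguments.
Unset Strict Implicit.
Unset Printing Implicit Defensive.
Import Order.TTheory GRing.Theory Num.Theory.
Local Open Scope classical_set_scope.
Local Open Scope ring_scope.

(* The point carried by [Complete] is only ever used as a junk value. *)
#[short(type="completeMetricType")]
HB.structure Definition CompleteMetric (R : numDomainType) :=
  {T of Complete T & Metric R T}.

Definition conj_exponent {R : realType} (p : R) : R :=
  fine (hoelder_conjugate p%:E).

(* The interval [0, a[ for an extended real endpoint a.  Coerced to a type, it
   is the domain of the curves below, so that two curves on [0, a[ are equal as
   soon as they agree on [0, a[. *)
Definition ray {R : realType} (a : \bar R) : set R :=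
  [set t | 0 <= t /\ (t%:E < a)%E].

(* Nonnegative base; unlike [powR], 0 to a negative power is +oo. *)
Definition epowR {R : realType} (x r : R) : \bar R :=
  if (x == 0) && (r < 0) then +oo%E else (x `^ r)%:E.

Section slope.
Context {R : realType} {S : completeMetricType R}.
Implicit Types (f : S -> \bar R) (v w : S).
Local Open Scope ereal_scope.

Definition dom f : set S := [set v | f v < +oo].

(* [maxe 0] only acts at isolated points, where the limsup in [\bar R] over the
   trivial filter is -oo while the limsup of nonnegative quantities is 0. *)
Definition local_slope f v : \bar R :=
  if v \in dom f then
    maxe 0 (limf_esup (fun w => maxe (f v - f w) 0 * ((mdist v w)^-1)%:E) v^')
  else +oo.

Definition plambda_convex f (p lambda : R) : Prop :=
  exists psi : R -> R,
    [/\ forall t : R, t \in `[0%R, 1%R] -> psi t \in `[0%R, 1%R],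
        psi t @[t --> 0^'+] --> 0%R,
        exists2 t : R, t \in `]0%R, 1%R[ & (psi t < 1)%R &
        forall v0 v1 : S, exists gamma : R -> S,
          [/\ {within `[0%R, 1%R], continuous gamma},
              gamma 0%R = v0, gamma 1%R = v1 &
              forall t : R, t \in `[0%R, 1%R] ->
                (mdist (gamma t) (gamma 0) <=
                   t * mdist (gamma 1) (gamma 0))%R /\
                f (gamma t) <=
                  (1 - t)%:E * f (gamma 0%R) + t%:E * f (gamma 1%R)
                  - (lambda * t * (1 - psi t) *
                       mdist (gamma 0) (gamma 1) `^ p)%:E]].

End slope.

(* Here curves are functions on R of which only the values on [0, a[ matter. *)
Section curves.
Context {R : realType} {S : completeMetricType R}.
Implicit Types (f : S -> \bar R) (a : \bar R) (u : R -> S).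
Local Notation mu := (@lebesgue_measure R).

Definition L1loc a (m : R -> R) : Prop :=
  forall K : set R, compact K -> K `<=` ray a ->
    mu.-integrable K (EFin \o m).

Definition ACloc a u : Prop :=
  exists2 m : R -> R, L1loc a m &
    forall s t, ray a s -> ray a t -> s <= t ->
      ((mdist (u s) (u t))%:E <= \int[mu]_(r in `[s, t]) (m r)%:E)%E.

Definition metric_derivative u (t : R) : R :=
  lim (mdist (u t) (u s) / `|t - s| @[s --> t^']).

Definition max_slope_curve f (p : R) a (u0 : S) u : Prop :=
  let q := conj_exponent p in
  let fu := fine \o f \o u in
  [/\ ACloc a u, u 0 = u0,
      forall s t, ray a s -> ray a t -> s <= t -> (f (u t) <= f (u s))%E &
      {ae mu, forall t, ray a t ->
        derivable fu t 1 /\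
        ((derive1 fu t)%:E <= - (p^-1 * metric_derivative u t `^ p)%:E
           - (q^-1)%:E * poweR (local_slope f (u t)) q)%E}].

End curves.

Section reparametrization.
Context {R : realType} {S : completeMetricType R}.
Implicit Types (f : S -> \bar R) (a : \bar R) (p : R) (u : S).
Local Notation mu := (@lebesgue_measure R).
Local Open Scope ereal_scope.

Definition CMS f p a u0 : set (ray a -> S) :=
  [set u | 0 < a /\ max_slope_curve f p a u0 (valL u)].

#[global] Arguments CMS f p a u0 _ : clear implicits.

Definition existence_time f p u0 : \bar R :=
  ereal_sup (0 |` [set a | 0 < a /\ (`I_1 #<= CMS f p a u0)%card]).

Definition stop_time f a (u : ray a -> S) : \bar R :=
  ereal_sup (0 |` [set t%:E | t in
    [set t | ray a t /\ 0 < local_slope f (valL u t)]]).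

Definition alpha p p' : R :=
  (1 - p / conj_exponent p * (conj_exponent p' / p'))%R.

Definition new_time p p' a (u : ray a -> S) (t : R) : \bar R :=
  \int[mu]_(r in `[0%R, t]) epowR (metric_derivative (valL u) r) (alpha p p').

Definition new_stop_time f p p' a (u : ray a -> S) : \bar R :=
  \int[mu]_(r in ray (stop_time f u))
    epowR (metric_derivative (valL u) r) (alpha p p').

Definition t_tilde f p p' a (u : ray a -> S) (s : R) : R :=
  'pinv_(fun=> 0%R) (ray (stop_time f u)) (new_time p p' u) s%:E.

Definition t_ext f p p' (u : ray +oo -> S) (s : R) : \bar R :=
  if s%:E < new_stop_time f p p' u then (t_tilde f p p' u s)%:E
  else stop_time f u.

Definition eval_ext (u : ray +oo -> S) (t : \bar R) : S :=
  match t with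
  | r%:E => valL u r
  | +oo => lim (valL u r @[r --> +oo%R])
  | -oo => point
  end.

Definition case_i f p p' (u : ray +oo -> S) : Prop :=
  [/\ new_stop_time f p p' u < +oo, stop_time f u = +oo &
      ~ cvg (valL u t @[t --> +oo%R])].

(* Used with b equal to the new stopping time in case (i), and to +oo in
   case (ii). *)
Definition Lambda f p p' b (u : ray +oo -> S) : ray b -> S :=
  fun s => if `[< case_i f p p' u >] then valL u (t_tilde f p p' u (val s))
           else eval_ext u (t_ext f p p' u (val s)).

End reparametrization.

(* Main.v *)
(* Along a p-curve of maximal slope Young's inequality is almost everywhere an
   equality, so that the slope at u(t) is |u'|^(p-1) and (f o u)' = -|u'|^p: the
   exponent only tunes the speed at which a line of steepest descent is run.
   Since lambda < 0, convexity turns the limsup defining the slope into a supremum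
   of nonlocal difference quotients, so the slope is lower semicontinuous; it also
   bounds the drop of f from a point of zero slope by -lambda d^p0, which, p being
   at most p0, is too little for a curve to leave that point.
   Before the stopping time the speed is thus positive, the clock
   sigma(t) = int_0^t |u'|^alpha is absolutely continuous with positive
   derivative, and u o sigma^-1 is a p'-curve, whose clock for the opposite
   change of exponent is sigma^-1.  Consequently uniqueness of p-curves on all
   intervals gives uniqueness of p'-curves.  If the new clock stops at a finite
   time and u has a limit there, the slope vanishes at the limit (the energy is
   bounded below along u) and staying at the limit prolongs the p'-curve; without
   a limit, a longer p'-curve would provide one by continuity. *)
From HB Require Import structures.
Require Import Defs.
From mathcomp Require Import measurable_realfun ring lra.
Import Order.TTheory GRing.Theory Num.Theory.
Local Open Scope classical_set_scope.
Local Open Scope ring_scope.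

Set Implicit Arguments.
Unset Strict Implicit.
Unset Printing Implicit Defensive.

(** [metric_derivative] is a [lim]: it has a value everywhere, is meaningful only almost everywhere,
    and is not known to be measurable. Each curve is therefore paired with a genuine measurable
    speed [g] ([has_speed], then [steepest]), and the integrals in the definitions are identified
    with those of [g] only in the last part. The energy along a curve is only known to be monotone,
    so its drop is compared with the integral of its derivative through Fatou's lemma; the resulting
    inequality is enough both for curves at a point of zero slope and for limits at infinity. The
    clock must be locally integrable even when [alpha p p' < 0], where small speeds are dangerous;
    lower semicontinuity of the slope keeps them away from 0 on compact intervals. The clock being
    only absolutely continuous, variables are changed through the image measure under its inverse.
    Uniqueness can be transferred because the inverse clock is the integral of a power of the new
    speed: reparametrized curves that coincide have the same clock, hence come from the same
    curve. *)

Section density.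
Context {R : realType}.
Local Notation mu := (@lebesgue_measure R).
Local Open Scope ereal_scope.

(** Half-open intervals are stable under intersection and generate the Borel sets, and the intervals
    []-n, n]] have finite measure, so the uniqueness theorem for measures applies. *)
Lemma measure_density_unique (k : R -> R)
    (nu : {measure set (measurableTypeR R) -> \bar R}) :
  (forall x, (0 <= k x)%R) -> mu.-integrable setT (EFin \o k) ->
  (forall x y : R, (x <= y)%R -> nu `]x, y]%classic = \int[mu]_(r in `]x, y]) (k r)%:E) ->
  forall A, measurable A -> nu A = \int[mu]_(r in A) (k r)%:E.
Proof.
move=> k0 ik nuE A mA.
have mk := measurable_int _ ik.
pose rho := fun A : set (measurableTypeR R) => \int[mu]_(r in A) (k r)%:E.
have rho0 : rho set0 = 0 by rewrite /rho integral_set0.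
have rho_ge0 B : 0 <= rho B by apply: integral_ge0 => x _; rewrite lee_fin.
have rhoS : semi_sigma_additive rho.
  by apply: semi_sigma_additive_nng_induced => // x; rewrite lee_fin.
pose rm := isMeasure.Build _ _ _ rho rho0 rho_ge0 rhoS.
pose rhoM : {measure set (measurableTypeR R) -> \bar R} := HB.pack rho rm.
apply: (@measure_unique _ R (measurableTypeR R) (@ocitv R)
  (fun n => `](- n%:R)%R, n%:R]%classic) erefl (@ocitvI R) _ _ nu rhoM) => //.
- by move=> i; exact: is_ocitv.
- rewrite -subTset => x _.
  pose n := Num.trunc `|x|; exists n.+1 => //=.
  have xn : (`|x| < n.+1%:R)%R by exact: truncnS_gt.
  move: xn; rewrite ltr_norml in_itv/= => /andP[-> /ltW ->] //.
- move=> B [[x y] _ <-] /=.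
  have [xy|yx] := leP x y; first exact: nuE.
  by rewrite set_itv_ge ?measure0// bnd_simp -leNgt ltW.
- move=> n; rewrite nuE; last by rewrite (@le_trans _ _ 0%R)// oppr_le0.
  apply: (@le_lt_trans _ _ (\int[mu]_r (k r)%:E)).
    by apply: ge0_subset_integral => // x _; rewrite lee_fin.
  have /integrableP[_] := ik; under eq_integral do rewrite gee0_abs ?lee_fin//.
  by [].
Qed.

End density.

(** * Absolutely continuous functions *)

Section interval_integrals.
Context {R : realType}.
Local Notation mu := (@lebesgue_measure R).

Lemma integrable_subitv (f : R -> R) (a b x y : R) :
  mu.-integrable `[a, b] (EFin \o f) -> a <= x -> y <= b ->
  mu.-integrable `[x, y] (EFin \o f).
Proof.
move=> fi ax yb; apply: integrableS fi => //.
by apply: subset_itv; rewrite bnd_simp.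
Qed.

Lemma Rintegral_itv_cat (f : R -> R) (a b c : R) :
  mu.-integrable `[a, c] (EFin \o f) -> a <= b -> b <= c ->
  \int[mu]_(r in `[a, c]) f r =
  \int[mu]_(r in `[a, b]) f r + \int[mu]_(r in `[b, c]) f r.
Proof.
move=> fi ab bc.
have := @Rintegral_itvB R f (BLeft a) (BRight c) b fi; rewrite !bnd_simp.
move=> /(_ ab bc).
rewrite Rintegral_itv_obnd_cbnd; first by move=> <-; rewrite addrC subrK.
apply: integrableS fi => //; apply: subset_itvr; by rewrite bnd_simp.
Qed.

Lemma Rintegral_itv_le (f : R -> R) (a b x y : R) :
  (forall r, 0 <= f r) -> mu.-integrable `[a, b] (EFin \o f) ->
  a <= x -> y <= b ->
  \int[mu]_(r in `[x, y]) f r <= \int[mu]_(r in `[a, b]) f r.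
Proof.
move=> f0 fi ax yb.
have [xy|yx] := leP x y; last first.
  rewrite [X in Rintegral _ X _ <= _]set_itv_ge ?bnd_simp -?ltNge// Rintegral_set0.
  exact: Rintegral_ge0.
have fxb : mu.-integrable `[x, b] (EFin \o f) by exact: integrable_subitv fi _ _.
rewrite (Rintegral_itv_cat fi ax (le_trans xy yb)).
rewrite (Rintegral_itv_cat fxb xy yb).
by rewrite addrCA lerDl addr_ge0// Rintegral_ge0.
Qed.

Lemma EFin_Rintegral (D : set R) (f : R -> R) : measurable D ->
  mu.-integrable D (EFin \o f) ->
  (\int[mu]_(r in D) f r)%:E = (\int[mu]_(r in D) (f r)%:E)%E.
Proof. by move=> mD fi; rewrite /Rintegral fineK//; exact: integrable_fin_num. Qed.

Lemma Rintegral_itv_small (f : R -> R) (a b : R) :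
  (forall r, 0 <= f r) -> mu.-integrable `[a, b] (EFin \o f) ->
  forall e, 0 < e -> exists2 d, 0 < d & forall x y, a <= x -> y <= b ->
    y - x < d -> \int[mu]_(r in `[x, y]) f r < e.
Proof.
move=> f0 fi e e0.
have fi' : mu.-integrable setT (EFin \o (f \_ `[a, b])).
  by rewrite -restrict_EFin; apply/integrable_restrict => //=; rewrite setTI.
have [d [d0 dE]] := integral_normr_continuous fi' e0.
exists d => // x y ax yb yxd.
have [xy|yx] := leP x y; last first.
  by rewrite set_itv_ge ?bnd_simp -?ltNge// Rintegral_set0.
have -> : \int[mu]_(r in `[x, y]) f r =
          \int[mu]_(r in `[x, y]) `|(f \_ `[a, b]) r|.
  apply: eq_Rintegral => r /set_mem /=; rewrite in_itv/= => /andP[xr ry].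
  rewrite patchE mem_set ?ger0_norm//= in_itv/= (le_trans ax)//=.
  exact: le_trans yb.
apply: dE => //.
rewrite /= lebesgue_measure_itv/= lte_fin; case: ifPn => _; last by rewrite lte_fin.
by rewrite -EFinB lte_fin.
Qed.

Lemma lebesgue_stieltjes_itv (G : cumulative R R) (x y : R) : x <= y ->
  lebesgue_stieltjes_measure G `]x, y]%classic = (G y - G x)%:E.
Proof.
move=> xy; rewrite /lebesgue_stieltjes_measure /measure_extension measurable_mu_extE/=.
  by rewrite wlength_itv_bnd.
exact: is_ocitv.
Qed.

End interval_integrals.

Section absolutely_continuous.
Context {R : realType}.
Local Notation mu := (@lebesgue_measure R).

(* With M a primitive of [k], both [M + phi] and [M - phi] are cumulative functions
   and their Stieltjes measures add up to the measure of density [2 k]; hence the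
   first one has a Radon-Nikodym density, and so has [phi]. *)
Lemma absolutely_continuous_density_global (phi k : R -> R) :
  (forall r, 0 <= k r) -> mu.-integrable setT (EFin \o k) ->
  (forall x y, x <= y -> `|phi y - phi x| <= \int[mu]_(r in `[x, y]) k r) ->
  exists2 h : R -> R, mu.-integrable setT (EFin \o h) &
    forall x y, x <= y -> phi y - phi x = \int[mu]_(r in `[x, y]) h r.
Proof.
move=> k0 ik phik.
have ikS (D : set R) : measurable D -> mu.-integrable D (EFin \o k).
  by move=> mD; apply: integrableS ik.
pose M x := \int[mu]_(r in `]-oo, x]) k r.
have ME x y : x <= y -> M y - M x = \int[mu]_(r in `[x, y]) k r.
  move=> xy; rewrite /M Rintegral_itvB//; last exact: ikS.
  by rewrite Rintegral_itv_obnd_cbnd//; exact: ikS.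
have Mcont (x e : R) : 0 < e -> exists2 d, 0 < d & forall y, x <= y ->
    y - x < d -> M y - M x < e.
  move=> e0; have [d d0 dE] := Rintegral_itv_small k0 (ikS `[x, x + 1]%classic
    (measurable_itv _)) e0.
  exists (Num.min d 1); first by rewrite lt_min d0 ltr01.
  move=> y xy; rewrite lt_min => /andP[yxd yx1]; rewrite ME//.
  by apply: dE => //; rewrite -lerBlDl ltW.
have bound x y : x <= y -> `|phi y - phi x| <= M y - M x.
  by move=> xy; rewrite ME// phik.
pose G x := M x + phi x; pose H x := M x - phi x.
have Gnd : nondecreasing G.
  by move=> x y /bound; rewrite ler_norml /G => /andP[? ?]; lra.
have Hnd : nondecreasing H.
  by move=> x y /bound; rewrite ler_norml /H => /andP[? ?]; lra.
have rc (F : R -> R) : (forall x y, x <= y -> `|F y - F x| <= 2 * (M y - M x)) ->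
    right_continuous F.
  move=> FM x; apply/cvgrPdist_lt => e e0.
  have e20 : 0 < e / 2 by rewrite divr_gt0.
  have [d d0 dE] := Mcont x _ e20.
  near=> y.
  have xy : x < y by near: y; exact: nbhs_right_gt.
  have yd : y - x < d by rewrite ltrBlDl; near: y; apply: nbhs_right_lt; rewrite ltrDl.
  rewrite distrC (le_lt_trans (FM _ _ (ltW xy)))//.
  by rewrite mulrC -ltr_pdivlMr//; exact: dE (ltW xy) yd.
have Grc : right_continuous G.
  by apply: rc => x y /bound; rewrite !ler_norml /G => /andP[? ?]; apply/andP; split; lra.
have Hrc : right_continuous H.
  by apply: rc => x y /bound; rewrite !ler_norml /H => /andP[? ?]; apply/andP; split; lra.
pose Gc : cumulative R R := HB.pack G (isCumulative.Build R _ R G Gnd Grc).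
pose Hc : cumulative R R := HB.pack H (isCumulative.Build R _ R H Hnd Hrc).
pose nu := lebesgue_stieltjes_measure Gc.
have ik2 : mu.-integrable setT (EFin \o (fun r => 2 * k r)).
  have := @integrableZl _ _ R mu setT measurableT 2 _ ik.
  by apply: eq_integrable => //= r _; rewrite EFinM.
have sumE A : measurable A ->
    (nu A + lebesgue_stieltjes_measure Hc A)%E =
    (\int[mu]_(r in A) (2 * k r)%:E)%E.
  move=> mA.
  have addE := measure_addE (lebesgue_stieltjes_measure Gc)
    (lebesgue_stieltjes_measure Hc).
  rewrite -[LHS]addE; apply: (@measure_density_unique R (fun r => 2 * k r)) => //.
    by move=> x; rewrite mulr_ge0.
  move=> x y xy; rewrite [LHS]addE.
  transitivity ((G y - G x)%:E + (H y - H x)%:E)%E.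
    by congr (_ + _)%E; [exact: (lebesgue_stieltjes_itv Gc)
                        |exact: (lebesgue_stieltjes_itv Hc)].
  rewrite -EFinD -EFin_Rintegral//; last by apply: integrableS ik2.
  congr EFin; rewrite RintegralZl//; last exact: ikS.
  rewrite Rintegral_itv_obnd_cbnd//; last exact: ikS.
  rewrite -ME// /G /H; lra.
have nu_le A : measurable A -> (nu A <= \int[mu]_(r in A) (2 * k r)%:E)%E.
  by move=> mA; rewrite -sumE// leeDl.
have nu_fin : fin_num_fun nu.
  move=> A mA; rewrite ge0_fin_numE// (le_lt_trans (nu_le _ mA))//.
  by rewrite -ge0_fin_numE ?integral_ge0// => [|x _];
    [apply: integrable_fin_num => //; apply: integrableS ik2
    |rewrite lee_fin mulr_ge0].
pose nuF : {finite_measure set (measurableTypeR R) -> \bar R} :=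
  HB.pack nu (Measure_isFinite.Build _ _ _ nu nu_fin).
have nu_mu : nuF `<< mu.
  apply/null_content_dominatesP => A mA muA.
  apply/eqP; rewrite eq_le measure_ge0 andbT (le_trans (nu_le _ mA))//.
  rewrite null_set_integral//.
  exact: (measurable_funS measurableT _ (measurable_int _ ik2)).
have [h0 [_ hfin hi hE]] := radon_nikodym_sigma_finite nu_mu.
(* [h0] is the density of [M + phi]; that of [M] is removed. *)
pose h r := fine (h0 r) - k r.
have ih0 : mu.-integrable setT (EFin \o (fine \o h0)).
  by apply: eq_integrable hi => // r _ /=; rewrite fineK.
exists h.
  have := @integrableB _ _ R mu setT measurableT _ _ ih0 ik.
  by apply: eq_integrable.
move=> x y xy.
rewrite RintegralB//=; [|by apply: integrableS ih0|exact: ikS].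
have -> : \int[mu]_(r in `[x, y]) fine (h0 r) = G y - G x.
  rewrite -Rintegral_itv_obnd_cbnd; last by apply: integrableS ih0.
  apply: EFin_inj; rewrite EFin_Rintegral//; last by apply: integrableS ih0.
  rewrite -(lebesgue_stieltjes_itv Gc)//.
  transitivity (nuF `]x, y]%classic) => //; rewrite hE//.
  by apply: eq_integral => r _ /=; rewrite fineK.
rewrite -ME// /G; lra.
Unshelve. all: by end_near. Qed.

End absolutely_continuous.

Section quotients.
Context {R : realType}.

Lemma dnbhs_shift (t : R) : (fun s => s - t) @ t^' --> (0 : R)^'.
Proof.
move=> A; rewrite /dnbhs /within /= => -[d /= d0 dA].
exists d => //= s; rewrite /ball_/= => ts st.
apply: dA; last by rewrite subr_eq0.
by rewrite /ball_/= sub0r normrN distrC.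
Qed.

Lemma dnbhs0_shift (t : R) : (fun h => h + t) @ (0 : R)^' --> t^'.
Proof.
move=> A; rewrite /dnbhs /within /= => -[d /= d0 dA].
exists d => //= h; rewrite /ball_/= sub0r normrN => ts st.
apply: dA; first by rewrite /ball_/= opprD addrCA subrr addr0 normrN.
by rewrite -subr_eq0 addrK.
Qed.

(** The two-point form along the punctured filter is the one that compares with the quotients of the
    metric derivative and that can be composed with a change of clock. *)
Lemma is_derive_quotientP (F : R -> R) (t l : R) :
  is_derive t 1 F l <-> (F s - F t) / (s - t) @[s --> t^'] --> l.
Proof.
split=> [Fl|Fl].
  have : (fun h : R => h^-1 *: (F (h *: 1 + t) - F t)) @ 0^' --> l.
    have [/cvg_ex[l' Fl'] <-] := Fl.
    by rewrite /derive (cvg_lim _ Fl').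
  move=> /(cvg_comp _ _ (@dnbhs_shift t)).
  apply: cvg_trans; apply: near_eq_cvg; near=> s => /=.
  by rewrite /GRing.scale/= mulr1 subrK mulrC.
have Fl' : (fun h : R => h^-1 *: (F (h *: 1 + t) - F t)) @ 0^' --> l.
  move: Fl => /(cvg_comp _ _ (@dnbhs0_shift t)).
  apply: cvg_trans; apply: near_eq_cvg; near=> s => /=.
  by rewrite /GRing.scale/= mulr1 addrK mulrC.
split; first by apply/cvg_ex; exists l.
exact: cvg_lim Fl'.
Unshelve. all: by end_near. Qed.

Lemma is_derive_norm_le (F K : R -> R) (t a b : R) :
  is_derive t (1 : R) F a -> is_derive t (1 : R) K b ->
  (forall s, `|F s - F t| <= `|K s - K t|) -> `|a| <= `|b|.
Proof.
move=> /is_derive_quotientP/cvg_norm Fa /is_derive_quotientP/cvg_norm Kb FK.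
apply: (ler_cvg_to Fa Kb); near=> s.
by rewrite !normrM ler_wpM2r.
Unshelve. all: by end_near. Qed.

End quotients.

Section rat_seq.
Context {R : realType}.

(** An enumeration of the rationals, with 0 for the codes that decode to nothing. It reduces
    conditions on all end points or base points to countably many, as almost everywhere statements
    require. *)
Definition rat_seq (n : nat) : R := ratr (odflt 0 (unpickle n : option rat)).

Lemma rat_seq_dense (x y : R) : x < y -> exists n, x < rat_seq n /\ rat_seq n < y.
Proof.
move=> /rat_in_itvoo[q]; rewrite in_itv/= => /andP[xq qx]; exists (pickle q).
by rewrite /rat_seq pickleK.
Qed.

End rat_seq.

Section almost_everywhere.
Context {R : realType}.
Local Notation mu := (@lebesgue_measure R).
Implicit Types P Q W : set R.

Lemma ae_mono P Q : (forall t, P t -> Q t) ->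
  {ae mu, forall t, P t} -> {ae mu, forall t, Q t}.
Proof. by move=> PQ; apply: filterS PQ; exact: (ae_filter_ringOfSetsType mu). Qed.

Lemma ae_mono2 P Q W : (forall t, P t -> Q t -> W t) ->
  {ae mu, forall t, P t} -> {ae mu, forall t, Q t} -> {ae mu, forall t, W t}.
Proof. by move=> PQ; apply: filterS2 PQ; exact: (ae_filter_ringOfSetsType mu). Qed.

End almost_everywhere.

(** * Metric derivative *)

Section metric_speed.
Context {R : realType} {S : completeMetricType R}.
Local Notation mu := (@lebesgue_measure R).

Lemma integral_primitive (h : R -> R) : mu.-integrable setT (EFin \o h) ->
  exists H : R -> R, H = (fun x => \int[mu]_(r in `]-oo, x]) h r) /\
    forall x y, x <= y -> H y - H x = \int[mu]_(r in `[x, y]) h r.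
Proof.
move=> ih; have ihS (D : set R) : measurable D -> mu.-integrable D (EFin \o h).
  by move=> mD; apply: integrableS ih.
eexists; split; first by [].
move=> x y xy; rewrite Rintegral_itvB//; last exact: ihS.
by rewrite Rintegral_itv_obnd_cbnd//; exact: ihS.
Qed.

(** [F] has the same increments as the primitive of [h] from [-oo], hence the same difference
    quotients, and Lebesgue's differentiation theorem applies to the primitive. *)
Lemma ae_is_derive_integral (F h : R -> R) :
  mu.-integrable setT (EFin \o h) ->
  (forall x y, x <= y -> F y - F x = \int[mu]_(r in `[x, y]) h r) ->
  {ae mu, forall t, is_derive t (1 : R) F (h t)}.
Proof.
move=> ih FE.
have ihS (D : set R) : measurable D -> mu.-integrable D (EFin \o h).
  by move=> mD; apply: integrableS ih.
have lh : locally_integrable setT h by rewrite -(patch_setT (fun=> 0) h); exact: integrable_locally.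
have [H [Hdef HE]] := integral_primitive ih.
have FH x y : F y - F x = H y - H x.
  have [xy|/ltW yx] := leP x y; first by rewrite FE// HE.
  by apply: oppr_inj; rewrite !opprB FE// HE.
have := @FTC1Ny R h (fun y => ihS _ (measurable_itv _)) lh.
apply: ae_mono => t; rewrite -Hdef => -[dH Ht].
have /is_derive_quotientP q : is_derive t 1 H (h t).
  by split => //; rewrite -derive1E.
apply/is_derive_quotientP; apply: cvg_trans q; apply: near_eq_cvg.
by near=> s; rewrite FH.
Unshelve. all: by end_near. Qed.

Lemma mdist_sub_le (x y z : S) : `|mdist x z - mdist y z| <= mdist x y.
Proof.
have := metric_triangle x y z; have := metric_triangle y x z.
by rewrite (metric_sym y x) ler_norml => ? ?; apply/andP; split; lra.
Qed.

(* The speed of [u] is the supremum of the derivatives of the distances to the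
   points of a countable dense subset of the image. *)
Lemma metric_speed_global (u : R -> S) (k : R -> R) :
  (forall r, 0 <= k r) -> mu.-integrable setT (EFin \o k) ->
  (forall x y, x <= y -> mdist (u x) (u y) <= \int[mu]_(r in `[x, y]) k r) ->
  exists g : R -> R, [/\ forall r, 0 <= g r, mu.-integrable setT (EFin \o g),
    forall x y, x <= y -> mdist (u x) (u y) <= \int[mu]_(r in `[x, y]) g r &
    {ae mu, forall t,
      mdist (u t) (u s) / `|t - s| @[s --> t^'] --> g t}].
Proof.
move=> k0 ik uk.
have ikS (D : set R) : measurable D -> mu.-integrable D (EFin \o k).
  by move=> mD; apply: integrableS ik.
pose phi n t := mdist (u t) (u (rat_seq n)).
have phik n x y : x <= y ->
    `|phi n y - phi n x| <= \int[mu]_(r in `[x, y]) k r.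
  by move=> /uk; apply: le_trans; rewrite metric_sym mdist_sub_le.
have /choice[h hP] n : exists h : R -> R, mu.-integrable setT (EFin \o h) /\
    forall x y, x <= y -> phi n y - phi n x = \int[mu]_(r in `[x, y]) h r.
  by have [h] := absolutely_continuous_density_global k0 ik (phik n); exists h.
(* The bound of [|h n t|] by [k t] holds only almost everywhere. Truncating by [k] makes the
   supremum below finite at every [t] and changes nothing outside a null set. *)
pose hk n t := Num.min `|h n t| (k t).
have hk_ub t : has_ubound (range (hk ^~ t)).
  by exists (k t) => _ [n _ <-]; rewrite ge_min lexx orbT.
pose g t := sups (hk ^~ t) 0.
have hkg n t : hk n t <= g t.
  by apply: ub_le_sup; [exact/has_ubound_sdrop|exists n].
have g0 t : 0 <= g t by apply: le_trans (hkg 0 t); rewrite le_min normr_ge0 k0.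
have gk t : g t <= k t.
  apply: ge_sup; first by exists (hk 0 t), 0.
  by move=> _ [n _ <-]; rewrite ge_min lexx orbT.
have mk : measurable_fun [set: measurableTypeR R] k.
  by apply/measurable_EFinP; exact: measurable_int ik.
have mg : measurable_fun [set: measurableTypeR R] g.
  apply: measurable_fun_sups => [t _|n]; first exact: hk_ub.
  apply: measurable_minr => //; apply: measurableT_comp => //.
  by apply/measurable_EFinP; exact: measurable_int (hP n).1.
have ig : mu.-integrable setT (EFin \o g).
  apply: le_integrable ik => //; first exact/measurable_EFinP.
  by move=> r _ /=; rewrite lee_fin !ger0_norm.
have igS (D : set R) : measurable D -> mu.-integrable D (EFin \o g).
  by move=> mD; apply: integrableS ig.
have [K [_ KE]] := integral_primitive ik.
have [G [_ GE]] := integral_primitive ig.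
have dphi : {ae mu, forall t, forall n, is_derive t (1 : R) (phi n) (h n t)}.
  by apply: ae_foralln => n; exact: ae_is_derive_integral (hP n).1 (hP n).2.
have dK := ae_is_derive_integral ik KE.
have dG := ae_is_derive_integral ig GE.
have hle : {ae mu, forall t, forall n, `|h n t| <= g t}.
  apply: ae_mono2 dphi dK => t dphi dK n.
  suff hkt : `|h n t| <= k t by rewrite (le_trans _ (hkg n t))// le_min lexx.
  rewrite -(ger0_norm (k0 t)); apply: is_derive_norm_le (dphi n) dK _ => s.
  have [ts|/ltW st] := leP t s.
    by rewrite (le_trans (phik n _ _ ts))// KE// ler_norm.
  by rewrite distrC (le_trans (phik n _ _ st))// -KE// distrC ler_norm.
have ug x y : x <= y -> mdist (u x) (u y) <= \int[mu]_(r in `[x, y]) g r.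
  move=> xy; apply/ler_addgt0Pr => e e0.
  have e20 : 0 < e / 2 by rewrite divr_gt0.
  have [d d0 dE] := Rintegral_itv_small k0 (ikS `[x, x + 1]%classic
    (measurable_itv _)) e20.
  (* [u x] need not be one of the base points; replacing it by the point at a rational time just
     after [x] costs twice their distance, hence less than [e]. *)
  have [n [xrn rnx]] : exists n, x <= rat_seq n /\ rat_seq n - x < Num.min d 1.
    have [|n [xn nx]] := @rat_seq_dense R x (x + Num.min d 1).
      by rewrite ltrDl lt_min d0 ltr01.
    by exists n; rewrite ltW// ltrBlDl.
  move: rnx; rewrite lt_min => /andP[rnd rn1].
  have uxr : mdist (u x) (u (rat_seq n)) < e / 2.
    apply: le_lt_trans (uk _ _ xrn) _; apply: dE => //.
    by rewrite -lerBlDl ltW.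
  have phiE : phi n y - phi n x <= \int[mu]_(r in `[x, y]) g r.
    rewrite (hP n).2// (le_trans (ler_norm _))//.
    have ihS : mu.-integrable `[x, y] (EFin \o h n).
      by apply: integrableS (hP n).1.
    rewrite (le_trans (le_normr_Rintegral _ ihS))//.
    rewrite -lee_fin !EFin_Rintegral//; [|exact: igS|exact: integrable_norm].
    apply: ae_ge0_le_integral => //.
    - by apply/measurable_EFinP/measurableT_comp => //; apply/measurable_EFinP; exact: measurable_int ihS.
    - by move=> r _; rewrite lee_fin.
    - by have := measurable_int _ (igS `[x, y]%classic (measurable_itv _)).
    - by apply: ae_mono hle => r hr _; rewrite lee_fin.
  rewrite /phi in phiE.
  have := metric_triangle (u x) (u (rat_seq n)) (u y).
  rewrite (metric_sym (u (rat_seq n)) (u y)); lra.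
exists g; split => //.
have bad : {ae mu, forall t, (forall n, is_derive t (1 : R) (phi n) (h n t)) /\
    (forall n, `|h n t| <= g t)} by apply: ae_mono2 dphi hle.
apply: ae_mono2 bad dG => t [dphit hlet] dGt.
apply/cvgrPdist_le => e e0.
(* The quotients are squeezed: from below by those of a distance function whose derivative almost
   attains the supremum [g t], from above by those of a primitive of [g]. *)
have [n hn] : exists n, g t - e / 2 < `|h n t|.
  apply: contrapT => /forallNP no.
  suff : g t <= g t - e / 2 by move: e0; clear; set x := g t; lra.
  apply: ge_sup; first by exists (hk 0 t), 0.
  move=> _ [n _ <-]; rewrite ge_min; apply/orP; left.
  by have /negP := no n; rewrite -leNgt.
have /is_derive_quotientP/cvg_norm/cvgr_gt/(_ _ hn) near_phi := dphit n.
have gte : `|g t| < g t + e by rewrite ger0_norm// ltrDl.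
have /is_derive_quotientP/cvg_norm/cvgr_lt/(_ _ gte) near_G := dGt.
near=> s.
have st : s != t by near: s; exact: nbhs_dnbhs_neq.
have st0 : 0 < `|t - s| by rewrite normr_gt0 subr_eq0 eq_sym.
have lower : g t - e / 2 < `|(phi n s - phi n t) / (s - t)|.
  by near: s.
have upper : `|(G s - G t) / (s - t)| < g t + e by near: s.
rewrite ler_distlC; apply/andP; split.
  rewrite ltW// (lt_le_trans (lt_trans _ lower))//.
    by rewrite ltrD2l ltrN2 gtr_pMr// invf_lt1// ltr1n.
  rewrite normrM normfV (distrC s t) ler_wpM2r ?invr_ge0//.
  by rewrite (metric_sym (u t)) mdist_sub_le.
rewrite (le_trans _ (ltW upper))// normrM normfV (distrC s t).
rewrite ler_wpM2r ?invr_ge0//.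
have [ts|/ltW st'] := leP t s.
  by rewrite (le_trans (ug _ _ ts))// -GE// ler_norm.
by rewrite metric_sym distrC (le_trans (ug _ _ st'))// -GE// ler_norm.
Unshelve. all: by end_near. Qed.

(** Clamping time to [[0, b]] reduces this to the global case; [m], which may take negative values,
    is replaced by its absolute value cut off to [[0, b]]. *)
Lemma metric_speed_segment (u : R -> S) (m : R -> R) (b : R) :
  0 <= b -> mu.-integrable `[0, b] (EFin \o m) ->
  (forall s t, 0 <= s -> s <= t -> t <= b ->
    ((mdist (u s) (u t))%:E <= \int[mu]_(r in `[s, t]) (m r)%:E)%E) ->
  exists g : R -> R, [/\ forall r, 0 <= g r, mu.-integrable setT (EFin \o g),
    forall s t, 0 <= s -> s <= t -> t <= b ->
      mdist (u s) (u t) <= \int[mu]_(r in `[s, t]) g r &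
    {ae mu, forall t, 0 < t < b ->
      mdist (u t) (u s) / `|t - s| @[s --> t^'] --> g t}].
Proof.
move=> b0 im um.
pose c (t : R) : R := Num.max 0 (Num.min b t).
pose k := (fun r => `|m r|) \_ `[0, b].
have im' : mu.-integrable `[0, b] (EFin \o (fun r => `|m r|)).
  exact: integrable_norm.
have k0 r : 0 <= k r by rewrite /k patchE; case: ifP.
have ik : mu.-integrable setT (EFin \o k).
  by rewrite -restrict_EFin; apply/integrable_restrict => //=; rewrite setTI.
have cE t : 0 <= t -> t <= b -> c t = t.
  by move=> t0 tb; rewrite /c (min_idPr tb) (max_idPr t0).
have uk x y : x <= y -> mdist (u (c x)) (u (c y)) <= \int[mu]_(r in `[x, y]) k r.
  move=> xy.
  have [->|cxy] := eqVneq (c x) (c y); first by rewrite mdistxx Rintegral_ge0.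
  have xb : x <= b.
    rewrite leNgt; apply: contra_neqN cxy => bx.
    have by_ : b < y := lt_le_trans bx xy.
    by rewrite /c (min_idPl (ltW bx)) (min_idPl (ltW by_)).
  have y0 : 0 <= y.
    rewrite leNgt; apply: contra_neqN cxy => y0.
    have x0 : x < 0 := le_lt_trans xy y0.
    have mx : Num.min b x <= 0 by rewrite ge_min (ltW x0) orbT.
    have my : Num.min b y <= 0 by rewrite ge_min (ltW y0) orbT.
    by rewrite /c (max_idPl mx) (max_idPl my).
  have cx0 : 0 <= c x by rewrite /c le_max lexx.
  have cyb : c y <= b by rewrite /c ge_max b0 ge_min lexx.
  have xcx : x <= c x by rewrite /c (min_idPr xb) le_max lexx orbT.
  have ycy : c y <= y by rewrite /c ge_max y0 ge_min lexx orbT.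
  have cxcy : c x <= c y by rewrite /c le_max2// le_min2.
  apply: (@le_trans _ _ (\int[mu]_(r in `[c x, c y]) k r)); last first.
    by apply: Rintegral_itv_le => //; apply: integrableS ik.
  have imS : mu.-integrable `[c x, c y] (EFin \o (fun r => `|m r|)).
    exact: integrable_subitv im' _ _.
  rewrite -lee_fin (le_trans (um _ _ cx0 cxcy cyb))//.
  rewrite EFin_Rintegral//; last by apply: integrableS ik.
  apply: le_integral => //; first exact: integrable_subitv im _ _.
    by apply: integrableS ik.
  move=> r /set_mem/=; rewrite in_itv/= => /andP[cxr rcy].
  rewrite lee_fin /k patchE mem_set ?ler_norm//= in_itv/=.
  by rewrite (le_trans cx0)// (le_trans rcy).
have [g [g0 ig ug dg]] := metric_speed_global k0 ik uk.
exists g; split => // [s t s0 st tb|].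
  by have := ug s t st; rewrite !cE// ?(le_trans s0)// (le_trans st).
apply: ae_mono dg => t tg /andP[t0 tb].
apply: cvg_trans tg; apply: near_eq_cvg; near=> s.
have s0 : 0 < s by near: s; apply: nbhs_dnbhs; exact: lt_nbhsr.
have sb : s < b by near: s; apply: nbhs_dnbhs; exact: lt_nbhsl.
by rewrite !cE// ltW.
Unshelve. all: by end_near. Qed.

End metric_speed.

Section ae_integrals.
Context {R : realType}.
Local Notation mu := (@lebesgue_measure R).

Lemma ae_neq (x : R) : {ae mu, forall t, t != x}.
Proof.
exists [set x]; split => //; first exact: lebesgue_measure_set1.
by move=> t /negP; rewrite negbK => /eqP.
Qed.

Lemma ae_eq_integrable (D : set R) (f g : R -> R) : measurable D ->
  measurable_fun D g -> {ae mu, forall t, D t -> f t = g t} ->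
  mu.-integrable D (EFin \o f) -> mu.-integrable D (EFin \o g).
Proof.
move=> mD mg fg /integrableP[mf fi]; apply/integrableP; split.
  exact/measurable_EFinP.
rewrite (le_lt_trans _ fi)//; apply: ae_ge0_le_integral => //.
- by apply: measurableT_comp => //; exact/measurable_EFinP.
- exact: measurableT_comp.
- by apply: ae_mono fg => t fgt Dt /=; rewrite fgt.
Qed.

Lemma ae_eq_Rintegral (D : set R) (f g : R -> R) : measurable D ->
  measurable_fun D f -> measurable_fun D g ->
  {ae mu, forall t, D t -> f t = g t} ->
  \int[mu]_(t in D) f t = \int[mu]_(t in D) g t.
Proof.
move=> mD mf mg fg; rewrite /Rintegral; congr fine.
apply: ae_eq_integral => //; try exact/measurable_EFinP.
by apply: ae_mono fg => t fgt Dt /=; rewrite fgt.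
Qed.

End ae_integrals.

Section ray.
Context {R : realType}.
Implicit Types a : \bar R.

Lemma ray_le a s t : 0 <= s -> s <= t -> ray a t -> ray a s.
Proof. by move=> s0 st [_ ta]; split => //; rewrite (le_lt_trans _ ta)// lee_fin. Qed.

(** A ray is open on the right, so countably many segments [[0, rat_seq n]] exhaust it; local
    statements are glued along them. *)
Lemma ray_rat_seq a t : ray a t -> exists n, t < rat_seq n /\ ray a (rat_seq n).
Proof.
case=> t0; case: a => [r|_|//].
  rewrite lte_fin => /rat_seq_dense[n [tn nr]]; exists n; split => //.
  by split; rewrite ?lte_fin// (le_trans t0)// ltW.
have [//|n [tn _]] := @rat_seq_dense R t (t + 1); first by rewrite ltrDl.
by exists n; split => //; split; rewrite ?ltry// (le_trans t0)// ltW.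
Qed.

Lemma ray_nbhs a t : ray a t -> 0 < t -> \forall s \near t, ray a s.
Proof.
move=> /ray_rat_seq[n [tn an]] t0; near=> s.
have s0 : 0 < s by near: s; exact: lt_nbhsr.
have sn : s < rat_seq n by near: s; exact: lt_nbhsl.
exact: ray_le (ltW s0) (ltW sn) an.
Unshelve. all: by end_near. Qed.

Lemma ray_itv a t : ray a t -> `[0, t] `<=` ray a.
Proof. by move=> at_ s /=; rewrite in_itv/= => /andP[s0 st]; exact: ray_le at_. Qed.

Lemma measurable_ray a : measurable (ray a).
Proof.
apply: is_interval_measurable => x y [x0 _] [_ ya] z /andP[xz zy].
by split; [exact: le_trans xz|rewrite (le_lt_trans _ ya)// lee_fin].
Qed.

End ray.

Section speed.
Context {R : realType} {S : completeMetricType R}.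
Local Notation mu := (@lebesgue_measure R).
Implicit Types (a : \bar R) (u : R -> S) (g : R -> R).

(** Besides being almost everywhere the metric derivative on [[0, a[], [g] is measurable and
    nonnegative on the whole line and is itself an admissible bound for the distances, so integrals
    can be handled without [metric_derivative]. *)
Definition has_speed a u g :=
  [/\ measurable_fun [set: R] g, forall r, 0 <= g r,
    forall b, ray a b -> mu.-integrable `[0, b] (EFin \o g),
    forall s t, 0 <= s -> s <= t -> ray a t ->
      mdist (u s) (u t) <= \int[mu]_(r in `[s, t]) g r &
    {ae mu, forall t, ray a t ->
      mdist (u t) (u s) / `|t - s| @[s --> t^'] --> g t}].

Lemma ACloc_has_speed a u : ACloc a u -> exists g, has_speed a u g.
Proof.
move=> [m im um].
have /choice[gn gnP] (n : nat) : exists g : R -> R,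
  [/\ forall r, 0 <= g r, mu.-integrable setT (EFin \o g) &
    ray a (rat_seq n) -> (forall s t, 0 <= s -> s <= t -> t <= rat_seq n ->
      mdist (u s) (u t) <= \int[mu]_(r in `[s, t]) g r) /\
    {ae mu, forall t, 0 < t < rat_seq n ->
      mdist (u t) (u s) / `|t - s| @[s --> t^'] --> g t}].
  have [an|an] := pselect (ray a (rat_seq n)); last first.
    by exists (fun=> 0); split => //; exact: integrable0.
  have [|s t s0 st tn|g [g0 ig ug dg]] := @metric_speed_segment _ S u m (rat_seq n) an.1.
  - by apply: im; [exact: segment_compact|exact: ray_itv].
  - have t0 := le_trans s0 st.
    by apply: um => //; apply: ray_le an => //; exact: le_trans tn.
  - by exists g.
have mgn n : measurable_fun [set: R] (gn n).
  by have [_ ign _] := gnP n; apply/measurable_EFinP; exact: measurable_int ign.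
pose G n := if `[< ray a (rat_seq n) >] then gn n \_ `]0, rat_seq n[ else fun=> 0.
have mG n : measurable_fun [set: R] (G n).
  rewrite /G; case: ifP => _ //; apply/(measurable_restrictT _ _).1 => //.
  exact: measurable_funTS.
have G0 n r : 0 <= G n r.
  rewrite /G; case: ifP => _ //; rewrite patchE; case: ifP => _ //.
  by have [->] := gnP n.
(* At almost every [t] all the [gn n] with [rat_seq n] in the ray and beyond [t] are the same limit,
   so the supremum of the cut-off functions is their common value; it is measurable without choosing
   [n] as a function of [t]. [fine] takes care of a possible [+oo] on the remaining null set. *)
pose g t := fine (ereal_sup (range (fun n => (G n t)%:E))).
have mg : measurable_fun [set: R] g.
  apply: measurableT_comp => //.
  have mE : measurable_fun [set: R] (fun t => esups ((fun n => (G n t)%:E)) 0).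
    by apply: measurable_fun_esups => n; exact/measurable_EFinP.
  apply: eq_measurable_fun mE => t _; rewrite /esups/=; congr ereal_sup.
  by rewrite predeqE => x; split=> [[n _ <-]|[n _ <-]]; exists n.
have good : {ae mu, forall t, ray a t ->
    mdist (u t) (u s) / `|t - s| @[s --> t^'] --> g t /\
    forall n, ray a (rat_seq n) -> t < rat_seq n -> gn n t = g t}.
  have dgn : {ae mu, forall t, forall n, ray a (rat_seq n) -> 0 < t < rat_seq n ->
      mdist (u t) (u s) / `|t - s| @[s --> t^'] --> gn n t}.
    apply: ae_foralln => n; have [an|an] := pselect (ray a (rat_seq n)).
      have [_ _ /(_ an)[_]] := gnP n; exact: ae_mono.
    by apply: aeW => t.
  apply: ae_mono2 (ae_neq 0) dgn => t t0 dgn at_.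
  have {}t0 : 0 < t by rewrite lt_neqAle eq_sym t0; case: at_.
  have [N [tN aN]] := ray_rat_seq at_.
  have cN := dgn N aN (introT andP (conj t0 tN)).
  have gnE n : ray a (rat_seq n) -> t < rat_seq n -> gn n t = gn N t.
    move=> an tn; have cn := dgn n an (introT andP (conj t0 tn)).
    by rewrite -(cvg_lim _ cn)// -(cvg_lim _ cN).
  have gNt : g t = gn N t.
    rewrite /g (_ : ereal_sup _ = (gn N t)%:E)//.
    apply/eqP; rewrite eq_le; apply/andP; split.
      apply: ge_ereal_sup => _ [n _ <-]; rewrite lee_fin /G.
      have gN0 : 0 <= gn N t by have [->] := gnP N.
      case: asboolP => // an; rewrite patchE; case: ifPn => //.
      by move=> /set_mem/=; rewrite in_itv/= => /andP[_ tn]; rewrite gnE.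
    apply: ereal_sup_ubound; exists N => //; rewrite /G asboolT// patchE mem_set//=.
    by rewrite in_itv/= t0 tN.
  by rewrite gNt; split.
have gnE n b : ray a (rat_seq n) -> b < rat_seq n ->
    {ae mu, forall t, `[0, b]%classic t -> gn n t = g t}.
  move=> an bn; apply: ae_mono good => t tg /=; rewrite in_itv/= => /andP[t0 tb].
  have tn := le_lt_trans tb bn.
  by have [|_ ->] := tg _ => //; exact: ray_le (ltW tn) an.
exists g; split => //.
- move=> r; rewrite fine_ge0//; apply: (@le_trans _ _ (G 0%N r)%:E).
    by rewrite lee_fin.
  by apply: ereal_sup_ubound; exists 0%N.
- move=> b ab; have [n [bn an]] := ray_rat_seq ab.
  have [_ ign _] := gnP n.
  apply: (ae_eq_integrable _ _ (gnE _ _ an bn)) => //; first exact: measurable_funTS.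
  by apply: integrableS ign.
- move=> s t s0 st at_; have [n [tn an]] := ray_rat_seq at_.
  have [_ ign /(_ an)[dgn _]] := gnP n.
  rewrite (le_trans (dgn _ _ s0 st (ltW tn)))// le_eqVlt; apply/orP; left; apply/eqP.
  apply: ae_eq_Rintegral => //; [exact: measurable_funTS|exact: measurable_funTS|].
  apply: ae_mono (gnE _ _ an tn) => r + rst; apply.
  by move: rst => /=; rewrite !in_itv/= => /andP[/(le_trans s0) -> ->].
- by apply: ae_mono good => t tg /tg[].
Qed.

End speed.

(** * Change of variables *)

Section translation.
Context {R : realType}.
Local Notation mu := (@lebesgue_measure R).

Lemma lebesgue_measure_translate (h : R) (A : set R) : measurable A ->
  pushforward mu ((fun x : R => x + h) : _ -> measurableTypeR R) A = mu A.
Proof.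
move=> mA; apply/esym/lebesgue_measure_unique => //=.
  exact: measurable_funD.
move=> mf _ [[a b]] _ <-.
rewrite /pushforward (_ : _ @^-1` _ = `]a - h, b - h]%classic); last first.
  by apply/seteqP; split=> x /=; rewrite !in_itv/= ltrBlDr lerBrDr.
rewrite !lebesgue_measure_itv/= !lte_fin ltrD2r; case: ifPn => // _.
by rewrite -!EFinD; congr EFin; lra.
Qed.

Lemma ge0_integral_translate (f : R -> R) (a b h : R) :
  measurable_fun [set: R] f -> (forall r, 0 <= f r) ->
  (\int[mu]_(x in `[a, b]) (f (x + h))%:E =
   \int[mu]_(x in `[(a + h)%R, (b + h)%R]) (f x)%:E)%E.
Proof.
move=> mf f0.
have -> : `[a, b]%classic =
    ((fun x : R => x + h) : _ -> measurableTypeR R) @^-1` `[a + h, b + h].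
  by apply/seteqP; split=> x /=; rewrite !in_itv/= !lerD2r.
transitivity (\int[pushforward mu ((fun x : R => x + h)%R : _ -> measurableTypeR R)]_(x in `[(a + h)%R, (b + h)%R]) (f x)%:E)%E.
  rewrite ge0_integral_pushforward//=.
  - exact: measurable_funD.
  - by apply/measurable_EFinP; exact: measurable_funTS.
  - by move=> x _; rewrite lee_fin.
apply: eq_measure_integral; first exact: measurable_funD.
by move=> mf' A mA _; exact: lebesgue_measure_translate.
Qed.

End translation.

Section integral_derivative.
Context {R : realType}.
Local Notation mu := (@lebesgue_measure R).

(** After a translation the difference is the integral over [[b, b + h]] minus that over
    [[a, a + h]], and [F] lies between [F a] and [F b]. Subtracting [F a] makes every integrand
    nonnegative. *)
Let difference_quotient_integral (F : R -> R) (a b h : R) : a <= b -> 0 < h ->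
  nondecreasing_fun F -> (forall x, F a <= F x <= F b) ->
  (\int[mu]_(x in `[a, b]) ((F (x + h) - F x) / h)%:E <= (F b - F a)%:E)%E.
Proof.
move=> ab h0 Fnd Fab; pose f x := F x - F a.
have f0 x : 0 <= f x by rewrite subr_ge0; have /andP[] := Fab x.
have fb x : f x <= f b by rewrite lerD2r; have /andP[] := Fab x.
have mf : measurable_fun [set: R] f.
  by apply: measurable_funB => //; exact: nondecreasing_measurable.
have fi x y : mu.-integrable `[x, y] (EFin \o f).
  apply: measurable_bounded_integrable => //.
  - by rewrite /= lebesgue_measure_itv/=; case: ifP => _; rewrite ?ltry// -EFinB ltry.
  - exact: measurable_funTS.
  - exists (f b); split; first by rewrite num_real.
    move=> M fM x0 _ /=; rewrite ger0_norm//; exact: le_trans (fb _) (ltW fM).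
have mfh : measurable_fun [set: R] (fun x => f (x + h)).
  by apply: measurableT_comp => //; exact: measurable_funD.
have trans : \int[mu]_(x in `[a, b]) f (x + h) = \int[mu]_(x in `[a + h, b + h]) f x.
  by rewrite /Rintegral ge0_integral_translate.
have fhi : mu.-integrable `[a, b] (EFin \o (fun x => f (x + h))).
  apply/integrableP; split; first by apply/measurable_EFinP; exact: measurable_funTS.
  under eq_integral do rewrite gee0_abs ?lee_fin//.
  rewrite ge0_integral_translate//.
  by have /integrableP[_] := fi (a + h) (b + h);
    under eq_integral do rewrite gee0_abs ?lee_fin//.
have diffi : mu.-integrable `[a, b] (EFin \o (fun x => (f (x + h) - f x))).
  by have := @integrableB _ _ R mu `[a, b]%classic (measurable_itv _) _ _ fhi (fi a b); apply: eq_integrable.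
have -> : (\int[mu]_(x in `[a, b]) ((F (x + h) - F x) / h)%:E =
    (\int[mu]_(x in `[a, b]) ((f (x + h) - f x) * h^-1)%R)%:E)%E.
  rewrite EFin_Rintegral//.
    by apply: eq_integral => x _; congr (EFin (_ / _)); rewrite /f; lra.
  by have := @integrableZr _ _ R mu `[a, b]%classic (measurable_itv _) h^-1 _ diffi; apply: eq_integrable.
rewrite lee_fin RintegralZr// ler_pdivrMr// RintegralB// trans.
have ah : a <= a + h by rewrite lerDl ltW.
have bh : b <= b + h by rewrite lerDl ltW.
have ahbh : a + h <= b + h by rewrite lerD2r.
have cat1 := Rintegral_itv_cat (fi a (b + h)) ab bh.
have cat2 := Rintegral_itv_cat (fi a (b + h)) ah ahbh.
have le1 : \int[mu]_(x in `[b, b + h]) f x <= f b * h.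
  apply: (@le_trans _ _ (\int[mu]_(x in `[b, b + h]) cst (f b) x)).
    apply: le_Rintegral => //; apply: measurable_bounded_integrable => //.
    - by rewrite /= lebesgue_measure_itv/=; case: ifP => _; rewrite ?ltry// -EFinB ltry.
    - exists `|f b|; split; first by rewrite num_real.
      by move=> M fM x0 _ /=; exact: ltW.
  rewrite Rintegral_cst//= lebesgue_measure_itv/= lte_fin ltrDl h0 -EFinB/=.
  by rewrite addrAC subrr add0r.
have ge1 : 0 <= \int[mu]_(x in `[a, a + h]) f x by apply: Rintegral_ge0.
by apply: le_trans le1 => //; rewrite lerBlDl -cat1 cat2 lerDr.
Qed.

(** A monotone function may jump or have a singular part, whence an inequality only: Fatou's lemma
    for the difference quotients of step [1 / n.+1]. Clamping extends [F] by constants beyond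
    [[a, b]], which bounds the integrals of all these quotients by [F b - F a]. *)
Lemma ge0_integral_derive_le (F k : R -> R) (a b : R) : a <= b ->
  (forall x y, a <= x -> x <= y -> y <= b -> F x <= F y) ->
  measurable_fun [set: R] k -> (forall r, 0 <= k r) ->
  {ae mu, forall t, a < t < b -> exists2 l, is_derive t (1 : R) F l & k t <= l} ->
  (\int[mu]_(x in `[a, b]) (k x)%:E <= (F b - F a)%:E)%E.
Proof.
move=> ab Fnd mk k0 dF.
pose c (t : R) : R := Num.max a (Num.min b t).
pose G := F \o c.
have ac t : a <= c t by rewrite /c le_max lexx.
have cb t : c t <= b by rewrite /c ge_max ab ge_min lexx.
have cE t : a <= t -> t <= b -> c t = t.
  by move=> at_ tb; rewrite /c (min_idPr tb) (max_idPr at_).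
have Gnd : nondecreasing_fun G.
  by move=> x y xy; apply: Fnd => //; rewrite /c le_max2// le_min2.
have Ga : G a = F a by rewrite /G/= cE.
have Gb : G b = F b by rewrite /G/= cE.
have Gab x : G a <= G x <= G b by rewrite Ga Gb /G/= !Fnd.
pose h (n : nat) : R := n.+1%:R^-1.
have h0 n : 0 < h n by rewrite invr_gt0 ltr0n.
pose q n x := (G (x + h n) - G x) / h n.
have q0 n x : 0 <= q n x.
  by rewrite divr_ge0 ?(ltW (h0 _))// subr_ge0 Gnd// lerDl ltW.
have mG : measurable_fun [set: R] G by exact: nondecreasing_measurable.
have mq n : measurable_fun [set: R] (q n).
  apply: measurable_funM => //; apply: measurable_funB => //.
  by apply: measurableT_comp => //; exact: measurable_funD.
have qlim : {ae mu, forall t, `[a, b]%classic t ->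
    ((k t)%:E <= limn_einf (fun n => (q n t)%:E))%E}.
  apply: ae_mono2 (ae_neq a) (_ : {ae mu, forall t, t != b /\ (a < t < b ->
    exists2 l, is_derive t (1 : R) F l & k t <= l)}); last first.
    by apply: ae_mono2 (ae_neq b) dF.
  move=> t ta [tb dFt]; rewrite /= in_itv/= => /andP[at_ tb'].
  have {}ta : a < t by rewrite lt_neqAle eq_sym ta.
  have {}tb : t < b by rewrite lt_neqAle tb.
  have [|l Fl kl] := dFt; first by rewrite ta.
  have hcvg : (fun n => h n + t) @ \oo --> t^'.
    apply: (cvg_comp _ _ _ (@dnbhs0_shift R t)).
    move=> A [d /= d0 dA]; near=> n; apply: dA; last by rewrite gt_eqF.
    rewrite /ball_/= sub0r normrN gtr0_norm//; near: n.
    exact: (near_infty_natSinv_lt (PosNum d0)).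
  have qcvg : (fun n => (q n t)%:E) @ \oo --> l%:E.
    apply: cvg_EFin; first by near=> n.
    have := cvg_comp _ _ hcvg ((is_derive_quotientP F t l).1 Fl).
    apply: cvg_trans; apply: near_eq_cvg; near=> n.
    have hb : t + h n < b.
      by rewrite addrC; near: n; exact: (hcvg _ (nbhs_dnbhs (lt_nbhsl tb))).
    rewrite /q /G /= addrK (addrC t) !cE ?ltW//.
      by rewrite (lt_le_trans ta)// lerDr ltW.
    by rewrite addrC.
  by rewrite (is_cvg_limn_einfE _) ?(cvg_lim _ qcvg)//; apply/cvg_ex; exists l%:E.
apply: (@le_trans _ _ (\int[mu]_(x in `[a, b]) limn_einf (fun n => (q n x)%:E))%E).
  apply: ae_ge0_le_integral => //.
  - by move=> x _; rewrite lee_fin.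
  - by apply/measurable_EFinP; exact: measurable_funTS.
  - move=> x _; rewrite limn_einf_lim; apply: lime_ge; first exact: is_cvg_einfs.
    by near=> n; apply: le_ereal_inf_tmp => _ [m _ <-]; rewrite lee_fin.
  - rewrite /limn_einf; apply: measurableT_comp => //.
    apply: measurable_fun_limn_esup => n.
    apply: measurableT_comp => //.
    by apply/measurable_EFinP; exact: (measurable_funTS (mq n)).
apply: (le_trans (fatou _ _ _ _)) => //.
- by move=> n; apply/measurable_EFinP; exact: (measurable_funTS (mq n)).
- by move=> n x _; rewrite lee_fin.
have := @limn_einf_sup R (fun n => \int[mu]_(x in `[a, b]) (q n x)%:E)%E.
move=> /le_trans; apply; rewrite limn_esup_lim; apply: lime_le.
  exact: is_cvg_esups.
near=> n; apply: ge_ereal_sup => _ [m _ <-].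
by rewrite -Ga -Gb; exact: difference_quotient_integral.
Unshelve. all: by end_near. Qed.

End integral_derivative.

Section density_integral.
Context {R : realType}.
Local Notation mu := (@lebesgue_measure R).
Local Open Scope ereal_scope.

(** [k] agrees almost everywhere with the Radon-Nikodym derivative of [nu], for which the change of
    density is known. *)
Lemma integral_measure_density (k : R -> R)
    (nu : {finite_measure set (measurableTypeR R) -> \bar R}) (h : R -> R) :
  (forall x, (0 <= k x)%R) -> mu.-integrable setT (EFin \o k) ->
  (forall x y : R, (x <= y)%R -> nu `]x, y]%classic = \int[mu]_(r in `]x, y]) (k r)%:E) ->
  measurable_fun [set: R] h -> (forall r, (0 <= h r)%R) ->
  \int[nu]_r (h r)%:E = \int[mu]_r (h r * k r)%:E.
Proof.
move=> k0 ik nuE mh h0.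
have nuk := measure_density_unique k0 ik nuE.
have mk := measurable_int _ ik.
have nu_mu : nu `<< mu.
  apply/null_content_dominatesP => A mA muA.
  rewrite nuk// null_set_integral//.
  exact: (measurable_funS measurableT _ mk).
have kf : ae_eq mu setT (EFin \o k) (Radon_Nikodym_SigmaFinite.f nu mu).
  apply: integral_ae_eq => //.
    by apply: measurable_int; exact: Radon_Nikodym_SigmaFinite.f_integrable.
  by move=> E _ mE; rewrite -Radon_Nikodym_SigmaFinite.f_integral// -nuk.
rewrite -(Radon_Nikodym_SigmaFinite.change_of_variables nu_mu)//; last first.
  exact/measurable_EFinP.
have mf : measurable_fun setT (Radon_Nikodym_SigmaFinite.f nu mu).
  by apply: measurable_int; exact: Radon_Nikodym_SigmaFinite.f_integrable.
apply: ge0_ae_eq_integral => //.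
- by apply: emeasurable_funM => //; exact/measurable_EFinP.
- by apply/measurable_EFinP; apply: measurable_funM => //; exact/measurable_EFinP.
- move=> x _; rewrite mule_ge0 ?lee_fin//.
  exact: Radon_Nikodym_SigmaFinite.f_ge0.
- by move=> x _; rewrite lee_fin mulr_ge0.
- by apply: ae_mono kf => x /(_ I) /= <-; rewrite EFinM.
Qed.

(** The measurability proofs are arguments so that the measure structure declared below is inferred
    from the term alone. *)
Definition image_restr (D : set R) (tau : R -> R) (mD : measurable D)
    of measurable_fun [set: R] tau :=
  fun A : set (measurableTypeR R) => mrestr mu mD (tau @^-1` A).

Section image_restr.
Variables (D : set R) (tau : R -> R).
Hypotheses (mD : measurable D) (mtau : measurable_fun [set: R] tau).

Local Notation nu := (image_restr mD mtau).

Let nu0 : nu set0 = 0.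
Proof. by rewrite /image_restr preimage_set0; exact: measure0. Qed.

Let nu_ge0 A : 0 <= nu A.
Proof. exact: measure_ge0. Qed.

Let nuS : semi_sigma_additive nu.
Proof.
  move=> F mF tF mUF; rewrite /image_restr preimage_bigcup.
  apply: measure_semi_sigma_additive.
  - by move=> n; rewrite -[X in measurable X]setTI; apply: mtau => //; exact: mF.
  - apply/trivIsetP => /= i j _ _ ij; rewrite -preimage_setI.
    by move/trivIsetP : tF => /(_ _ _ _ _ ij) ->//; rewrite preimage_set0.
  - by rewrite -preimage_bigcup -[X in measurable X]setTI; apply: mtau => //; exact: mUF.
Qed.

HB.instance Definition _ := isMeasure.Build _ _ _ nu nu0 nu_ge0 nuS.

End image_restr.

(** The image of Lebesgue measure on [D] under [tau] has density [k], as can be tested on half-open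
    intervals. Nothing is asked of [tau] beyond the measure of such preimages, in particular no
    derivative. *)
Lemma integral_comp_density (D : set R) (tau k h : R -> R) : measurable D ->
  measurable_fun [set: R] tau ->
  (forall x, (0 <= k x)%R) -> mu.-integrable setT (EFin \o k) ->
  (forall x y : R, (x <= y)%R -> mu (tau @^-1` `]x, y] `&` D) =
     \int[mu]_(r in `]x, y]) (k r)%:E) ->
  measurable_fun [set: R] h -> (forall r, (0 <= h r)%R) ->
  \int[mu]_(s in D) (h (tau s))%:E = \int[mu]_r (h r * k r)%:E.
Proof.
move=> mD mtau k0 ik tauk mh h0.
pose nu := image_restr mD mtau.
have nuk (x y : R) : (x <= y)%R -> nu `]x, y]%classic = \int[mu]_(r in `]x, y]) (k r)%:E.
  exact: tauk.
have nuE A : measurable A -> nu A = \int[mu]_(r in A) (k r)%:E.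
  exact: (measure_density_unique k0 ik nuk).
have nu_fin : fin_num_fun nu.
  move=> A mA; rewrite nuE//; apply: integrable_fin_num => //.
  by apply: integrableS ik.
pose nuF : {finite_measure set (measurableTypeR R) -> \bar R} :=
  HB.pack nu (Measure_isFinite.Build _ _ _ nu nu_fin).
rewrite -(@integral_measure_density k nuF)//.
have := @ge0_integral_pushforward _ _ (measurableTypeR R) (measurableTypeR R) R
  tau mtau (mrestr mu mD) setT
  (EFin \o h) measurableT.
move=> -> //; last 2 first.
- exact/measurable_EFinP.
- by move=> x _; rewrite /= lee_fin.
rewrite preimage_setT -(setUv D) ge0_integral_setU//; last 4 first.
- exact: measurableC.
- rewrite setUv; apply/measurable_EFinP; exact: measurableT_comp.
- by move=> x _; rewrite lee_fin.
- exact/disj_set2P/setICr.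
rewrite [X in _ = _ + X](_ : _ = 0) ?adde0; last first.
  apply: null_set_integral => //.
  - exact: measurableC.
  - apply/measurable_EFinP; apply: measurable_funTS; exact: measurableT_comp.
  - by transitivity (mu (~` D `&` D)) => //; rewrite setICl measure0.
apply: eq_measure_integral => A mA AD.
by transitivity (mu (A `&` D)) => //; rewrite (setIidl AD).
Qed.

End density_integral.

Section ray_cover.
Context {R : realType}.
Local Notation mu := (@lebesgue_measure R).
Variable T : \bar R.

Let segment n : set R :=
  if `[< ray T (rat_seq n) >] then `[0, rat_seq n]%classic else set0.

Let measurable_segment n : measurable (segment n).
Proof. by rewrite /segment; case: ifP. Qed.

Let bigcup_segment : \bigcup_n segment n = ray T.
Proof.
apply/seteqP; split=> [x [n _]|x Tx].
  by rewrite /segment; case: asboolP => // /ray_itv; exact.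
have [n [xn Tn]] := ray_rat_seq Tx; exists n => //.
rewrite /segment asboolT//= in_itv/=; apply/andP; split; last exact: ltW.
by case: Tx.
Qed.

Lemma measurable_fun_ray (h : R -> R) :
  (forall t, ray T t -> measurable_fun `[0, t] h) -> measurable_fun (ray T) h.
Proof.
move=> mh; rewrite -bigcup_segment; apply/measurable_fun_bigcup => // n.
rewrite /segment; case: asboolP => [/mh//|_]; exact: measurable_fun_set0.
Qed.

(** Monotone convergence along finite unions of the segments [[0, rat_seq n]]; as the rational end
    points come in no order, each union is bounded by the segment up to their maximum. *)
Lemma integral_ray_le (k : R -> R) (c : R) :
  measurable_fun [set: R] k -> (forall r, 0 <= k r) -> 0 <= c ->
  (forall t, ray T t -> \int[mu]_(r in `[0%R, t]) (k r)%:E <= c%:E)%E ->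
  (\int[mu]_(r in ray T) (k r)%:E <= c%:E)%E.
Proof.
move=> mk k0 c0 kc.
pose U n := \big[setU/set0]_(i < n.+1) segment i.
have UT : \bigcup_n U n = ray T by rewrite /U bigcup_bigsetU_bigcup.
have mU n : measurable (U n).
  by apply: bigsetU_measurable => j _; exact: measurable_segment.
rewrite -UT.
have cvgU := @ge0_nondecreasing_set_cvg_integral _ (measurableTypeR R) R U (EFin \o k) mu.
have {}cvgU : (\int[mu]_(x in U i) (k x)%:E @[i --> \oo] -->
    \int[mu]_(x in \bigcup_i U i) (k x)%:E)%E.
  apply: cvgU => //.
  - by move=> i j ij; apply/subsetPset; apply: subset_bigsetU.
  - by move=> i; apply/measurable_EFinP; exact: measurable_funTS.
  - by move=> i x _; rewrite lee_fin.
rewrite -(cvg_lim _ cvgU)//; apply: lime_le.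
  by apply/cvg_ex; eexists; exact: cvgU.
near=> n.
(* The alternative [t = 0] is for the empty union, where no point of the ray is at hand. *)
have [t Ut Tt] : exists2 t, U n `<=` `[0, t]%classic & (t = 0 \/ ray T t).
  rewrite /U; elim: n.+1 => [|m [t Ut Tt]].
    by exists 0; [rewrite big_ord0|left].
  rewrite big_ord_recr/= {2}/segment; case: asboolP => Tm; last first.
    by exists t => //; rewrite setU0.
  exists (Num.max t (rat_seq m)).
    move=> x [/Ut|] /=; rewrite !in_itv/= => /andP[-> h];
    by rewrite le_max h ?orbT.
  by case: (leP t (rat_seq m)) => _; [right|].
have : (\int[mu]_(x in U n) (k x)%:E <= \int[mu]_(x in `[0%R, t]) (k x)%:E)%E.
  apply: ge0_subset_integral => //; first exact: mU.
    by apply/measurable_EFinP; exact: measurable_funTS.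
  by move=> x _; rewrite lee_fin.
move=> /le_trans; apply; case: Tt => [->|/kc//].
by rewrite set_itv1 integral_set1 lee_fin.
Unshelve. all: by end_near. Qed.

End ray_cover.

(** * Clocks with an almost everywhere positive density *)

Section time_change.
Context {R : realType}.
Local Notation mu := (@lebesgue_measure R).
Variables (T : \bar R) (k : R -> R).
Hypotheses (mk : measurable_fun [set: R] k) (k0 : forall r, 0 <= k r).
Hypothesis ik : forall t, ray T t -> mu.-integrable `[0, t] (EFin \o k).
Hypothesis kpos : {ae mu, forall t, ray T t -> 0 < k t}.

Definition new_clock (t : R) : R := \int[mu]_(r in `[0, t]) k r.
Local Notation sigma := new_clock.
Local Notation b := (\int[mu]_(r in ray T) (k r)%:E)%E.

Lemma new_clock0 : sigma 0 = 0.
Proof. by rewrite /sigma set_itv1 Rintegral_set1. Qed.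

Lemma new_clock_sub s t : 0 <= s -> s <= t -> ray T t ->
  sigma t - sigma s = \int[mu]_(r in `[s, t]) k r.
Proof.
move=> s0 st Tt; rewrite /sigma (Rintegral_itv_cat (ik Tt) s0 st).
by rewrite addrAC subrr add0r.
Qed.

Lemma integrable_subray s t : 0 <= s -> ray T t -> mu.-integrable `[s, t] (EFin \o k).
Proof. by move=> s0 Tt; exact: integrable_subitv (ik Tt) _ _. Qed.

(** A zero increment would force [k = 0] almost everywhere on [[s, t]]; as [k] is positive almost
    everywhere on the ray, [[s, t]] would be a null set. *)
Lemma new_clock_lt s t : 0 <= s -> s < t -> ray T t -> sigma s < sigma t.
Proof.
move=> s0 st Tt; rewrite -subr_gt0 new_clock_sub// ?ltW//.
have int_ge0 : 0 <= \int[mu]_(r in `[s, t]) k r by apply: Rintegral_ge0.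
rewrite lt_neqAle int_ge0 andbT; apply/eqP => /esym int0.
have iks := integrable_subray s0 Tt.
have : (\int[mu]_(r in `[s, t]) `|(k r)%:E| = 0)%E.
  under eq_integral do rewrite gee0_abs ?lee_fin//.
  by rewrite -EFin_Rintegral// int0.
move=> /(iffLR (ae_eq_integral_abs mu (measurable_itv `[s, t]) (measurable_int _ iks))) k_ae0.
have [N [mN N0 NP]] : {ae mu, forall r, `[s, t]%classic r -> False}.
  apply: ae_mono2 kpos k_ae0 => r kr0 kr rst.
  have [] : k r = 0 by have [] := kr rst.
  apply/eqP; rewrite gt_eqF// kr0//.
  by move: rst; rewrite /= in_itv/= => /andP[sr rt]; exact: ray_le (le_trans s0 sr) rt Tt.
have : (mu `[s, t]%classic <= mu N)%E.
  by apply: le_measure; rewrite ?inE// => r rst; apply: NP => /= /(_ rst).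
by rewrite N0 /= lebesgue_measure_itv/= lte_fin st -EFinB lee_fin leNgt subr_gt0 st.
Qed.

Lemma new_clock_le s t : 0 <= s -> s <= t -> ray T t -> sigma s <= sigma t.
Proof.
move=> s0; rewrite le_eqVlt => /predU1P[->//|st] Tt.
exact: ltW (new_clock_lt s0 st Tt).
Qed.

Lemma new_clock_ge0 t : 0 <= sigma t.
Proof. by apply: Rintegral_ge0 => *; exact: k0. Qed.

Lemma new_clock_ray t : ray T t -> ray b (sigma t).
Proof.
move=> Tt; split; first exact: new_clock_ge0.
have [n [tn Tn]] := ray_rat_seq Tt.
have t0 : 0 <= t by case: Tt.
apply: (@lt_le_trans _ _ (sigma (rat_seq n))%:E).
  by rewrite lte_fin new_clock_lt.
rewrite /sigma EFin_Rintegral//; last exact: ik.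
apply: ge0_subset_integral => //.
- exact: measurable_ray.
- by apply/measurable_EFinP; exact: measurable_funTS.
- by move=> x _; rewrite lee_fin.
- exact: ray_itv.
Qed.

(** A clock that never exceeds [s] would have total at most [s], against [s < b]; the intermediate
    value theorem does the rest. *)
Lemma new_clock_surj s : ray b s -> exists2 t, ray T t & sigma t = s.
Proof.
move=> [s0 sb].
have [t Tt st] : exists2 t, ray T t & s < sigma t.
  apply: contrapT => no.
  have {}no t : ray T t -> sigma t <= s.
    by move=> Tt; rewrite leNgt; apply/negP => st; apply: no; exists t.
  move: sb; apply/negP; rewrite -leNgt.
  apply: integral_ray_le => // t Tt.
  by rewrite -EFin_Rintegral ?lee_fin; [exact: no| |exact: ik].
have t0 : 0 <= t by case: Tt.
have := @IVT R sigma 0 t s t0 (parameterized_integral_continuous t0 (ik Tt)).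
rewrite new_clock0 (min_idPl (new_clock_ge0 _)) (max_idPr (new_clock_ge0 _)).
rewrite s0 (ltW st) => /(_ isT)[c]; rewrite in_itv/= => /andP[c0 ct] <-.
by exists c => //; exact: ray_le Tt.
Qed.

(** Only a left inverse on the ray is asked for, which covers both [t_tilde], an inverse of
    [new_time], and the inverse of [new_clock] chosen in the proof of uniqueness. *)
Variable tau : R -> R.
Hypothesis tauK : forall t, ray T t -> tau (sigma t) = t.

Lemma old_clock_ray s : ray b s -> ray T (tau s).
Proof. by move=> /new_clock_surj[t Tt <-]; rewrite tauK. Qed.

Lemma old_clockK s : ray b s -> sigma (tau s) = s.
Proof. by move=> /new_clock_surj[t Tt <-]; rewrite tauK. Qed.

Lemma old_clock_lt s1 s2 : ray b s2 -> 0 <= s1 -> s1 < s2 -> tau s1 < tau s2.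
Proof.
move=> bs2 s10 s12; have bs1 := ray_le s10 (ltW s12) bs2.
rewrite ltNge; apply/negP => tle.
have := new_clock_le (old_clock_ray bs2).1 tle (old_clock_ray bs1).
by rewrite !old_clockK// leNgt s12.
Qed.

Lemma old_clock_le s1 s2 : ray b s2 -> 0 <= s1 -> s1 <= s2 -> tau s1 <= tau s2.
Proof.
move=> bs2 s10; rewrite le_eqVlt => /predU1P[->//|s12].
exact: ltW (old_clock_lt bs2 s10 s12).
Qed.

Section change_of_variables.
Variables t1 t2 : R.
Hypotheses (t10 : 0 <= t1) (t12 : t1 <= t2) (Tt2 : ray T t2).

Let Tt1 : ray T t1. Proof. exact: ray_le Tt2. Qed.
Let s12 : sigma t1 <= sigma t2. Proof. exact: new_clock_le. Qed.
(** [tau] is arbitrary outside [[0, b[]; clamping its argument makes it nondecreasing, hence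
    measurable, on the whole line. *)
Let clamp (s : R) : R := Num.max (sigma t1) (Num.min (sigma t2) s).
Let tau' s := tau (clamp s).
Let clamp_ge s : sigma t1 <= clamp s. Proof. by rewrite /clamp le_max lexx. Qed.
Let clamp_le s : clamp s <= sigma t2.
Proof. by rewrite /clamp ge_max s12 ge_min lexx. Qed.
Let clampE s : sigma t1 <= s -> s <= sigma t2 -> clamp s = s.
Proof. by move=> s1 s2; rewrite /clamp (min_idPr s2) (max_idPr s1). Qed.

Let mtau' : measurable_fun [set: R] tau'.
Proof.
apply: nondecreasing_measurable => // x y xy; apply: old_clock_le.
- apply: (@ray_le _ _ _ (sigma t2)) => //; last exact: new_clock_ray.
  exact: le_trans (new_clock_ge0 _) (clamp_ge _).
- exact: le_trans (new_clock_ge0 _) (clamp_ge _).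
- by rewrite /clamp le_max2// le_min2.
Qed.

Lemma measurable_old_clock : measurable_fun `[sigma t1, sigma t2] tau.
Proof.
apply: (eq_measurable_fun tau'); last exact: measurable_funTS.
by move=> s /set_mem/=; rewrite in_itv/= => /andP[? ?]; rewrite /tau' clampE.
Qed.

Let kc := k \_ `]t1, t2].

Let kc0 r : 0 <= kc r.
Proof. by rewrite /kc patchE; case: ifP. Qed.

Let ikc : mu.-integrable setT (EFin \o kc).
Proof.
rewrite -restrict_EFin; apply/integrable_restrict => //=; rewrite setTI.
apply: integrableS (integrable_subray t10 Tt2) => //.
by apply: subset_itvr; rewrite bnd_simp.
Qed.

(** With [x'] and [y'] the end points clamped to [[t1, t2]], the conditions [x < t <= y] and
    [x' < t <= y'] agree on []t1, t2]], so the preimage is []sigma x', sigma y']], whose length is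
    an integral of [k]. *)
Let kcE x y : x <= y -> mu (tau' @^-1` `]x, y] `&` `]sigma t1, sigma t2]%classic) =
  (\int[mu]_(r in `]x, y]) (kc r)%:E)%E.
Proof.
move=> xy.
pose x' := Num.max t1 (Num.min t2 x); pose y' := Num.max t1 (Num.min t2 y).
have t1x' : t1 <= x' by rewrite /x' le_max lexx.
have x'y' : x' <= y' by rewrite /x' /y' le_max2// le_min2.
have y't2 : y' <= t2 by rewrite /y' ge_max t12 ge_min lexx.
have key t : t1 < t -> t <= t2 -> (x < t <= y) = (x' < t <= y').
  move=> t1t tt2; rewrite /x' /y' gt_max t1t gt_min le_max leNgt t1t/= le_min tt2/=.
  by rewrite ltNge tt2.
have Ty' : ray T y' by apply: ray_le Tt2 => //; apply: le_trans t10 (le_trans t1x' x'y').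
have Tx' : ray T x' by apply: ray_le Ty' => //; exact: le_trans t10 t1x'.
have -> : tau' @^-1` `]x, y] `&` `]sigma t1, sigma t2]%classic =
          `]sigma x', sigma y']%classic.
  apply/seteqP; split=> s /=; rewrite !in_itv/=.
    move=> [xsy /andP[t1s st2]].
    have [t Tt ts] : exists2 t, ray T t & sigma t = s.
      apply: new_clock_surj; apply: ray_le (new_clock_ray Tt2) => //.
      exact: le_trans (new_clock_ge0 _) (ltW t1s).
    move: xsy t1s st2; rewrite /tau' -ts => + t1s st2.
    rewrite clampE ?(ltW t1s)// tauK// key//.
    - by move=> /andP[x't ty']; rewrite new_clock_lt ?(le_trans t10)//= new_clock_le//; case: Tt.
    - rewrite ltNge; apply/negP => tt1; move: t1s; rewrite ltNge new_clock_le//.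
      by case: Tt.
    - rewrite leNgt; apply/negP => t2t; move: st2; rewrite leNgt new_clock_lt//.
      exact: le_trans t12.
  move=> /andP[x's sy'].
  have t1s : sigma t1 < s by apply: le_lt_trans x's; exact: new_clock_le.
  have st2 : s <= sigma t2.
    apply: le_trans sy' _; apply: new_clock_le => //; exact: le_trans (le_trans t10 t1x') x'y'.
  rewrite t1s st2; split => //.
  have [t Tt ts] : exists2 t, ray T t & sigma t = s.
    apply: new_clock_surj; apply: ray_le (new_clock_ray Tt2) => //.
    exact: le_trans (new_clock_ge0 _) (ltW t1s).
  move: x's sy' t1s st2; rewrite /tau' -ts => x's sy' t1s st2.
  have x't : x' < t.
    by rewrite ltNge; apply/negP => tx'; move: x's; rewrite ltNge new_clock_le//; case: Tt.
  have ty' : t <= y'.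
    rewrite leNgt; apply/negP => y't; move: sy'; rewrite leNgt new_clock_lt//.
    exact: le_trans (le_trans t10 t1x') x'y'.
  rewrite clampE ?(ltW t1s)// tauK// key ?x't//; first exact: le_lt_trans x't.
  exact: le_trans y't2.
transitivity (sigma y' - sigma x')%:E.
  rewrite lebesgue_measure_itv/= lte_fin; case: ltP => [_|]; first by rewrite EFinB.
  move=> le_yx; congr EFin; apply/eqP; rewrite eq_sym subr_eq0 eq_le le_yx/=.
  by apply: new_clock_le => //; exact: le_trans t10 t1x'.
have x'0 : 0 <= x' := le_trans t10 t1x'.
rewrite new_clock_sub// EFin_Rintegral//; last exact: integrable_subray.
rewrite -integral_itv_obnd_cbnd; last first.
  by apply/measurable_EFinP; exact: measurable_funTS.
rewrite integral_mkcond [RHS]integral_mkcond; apply: eq_integral => r _.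
rewrite !patchE /kc patchE.
case: ifPn => [/set_mem/=|] rx'; case: ifPn => [/set_mem/=|] rx => //.
- rewrite ifT// mem_set//=; move: rx'; rewrite !in_itv/= => /andP[x'r ry'].
  by rewrite (le_lt_trans t1x')// (le_trans ry').
- exfalso; move/negP: rx; apply; rewrite inE/=; move: rx'; rewrite !in_itv/= => /andP[x'r ry'].
  by rewrite key ?x'r//; [exact: le_lt_trans x'r|exact: le_trans y't2].
- case: ifPn => // /set_mem/=; rewrite in_itv/= => /andP[t1r rt2].
  exfalso; move/negP: rx'; apply; rewrite inE/=; move: rx; rewrite !in_itv/=.
  by rewrite key.
Qed.

(** The substitution [s = sigma t], obtained from the image measure because the clock is only
    absolutely continuous. *)
Lemma integral_old_clock (h : R -> R) :
  measurable_fun [set: R] h -> (forall r, 0 <= h r) ->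
  (\int[mu]_(s in `[sigma t1, sigma t2]) (h (tau s))%:E =
   \int[mu]_(t in `[t1, t2]) (h t * k t)%:E)%E.
Proof.
move=> mh h0.
rewrite -integral_itv_obnd_cbnd; last first.
  apply/measurable_EFinP; apply: measurableT_comp => //.
  apply: measurable_funS measurable_old_clock => //.
  by apply: subset_itvr; rewrite bnd_simp.
rewrite -[RHS]integral_itv_obnd_cbnd; last first.
  by apply/measurable_EFinP; apply: measurable_funTS; exact: measurable_funM.
transitivity (\int[mu]_(s in `]sigma t1, sigma t2]) (h (tau' s))%:E)%E.
  apply: eq_integral => s /set_mem/=; rewrite in_itv/= => /andP[/ltW s1 s2].
  by rewrite /tau' clampE.
rewrite (integral_comp_density _ mtau' kc0 ikc kcE)// [RHS]integral_mkcond.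
apply: eq_integral => r _; rewrite patchE /kc patchE.
by case: ifPn => _ //; rewrite mulr0.
Qed.

End change_of_variables.

(** By substitution, the indicator of a null set [N] composed with [tau] has the integral of
    [\1_N * k], which is 0: preimages under [tau] of null sets are null. *)
Lemma ae_old_clock (P : set R) : {ae mu, forall t, ray T t -> P t} ->
  {ae mu, forall s, ray b s -> P (tau s)}.
Proof.
move=> [N [mN N0 NP]].
have bad n : {ae mu, forall s, ray b (rat_seq n) -> 0 <= s <= rat_seq n ->
    ~ N (tau s)}.
  have [bn|nbn] := pselect (ray b (rat_seq n)); last by apply: aeW => s /nbn.
  have [t2 Tt2 t2n] := new_clock_surj bn.
  have T0 : ray T 0 by apply: (@ray_le _ _ _ t2) => //; case: Tt2.
  have t20 : 0 <= t2 by case: Tt2.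
  have mh : measurable_fun [set: R] (\1_N : R -> R) by exact: measurable_indic.
  have := integral_old_clock (lexx 0) t20 Tt2 mh (fun r => ler0n _ _).
  rewrite new_clock0 t2n => int0.
  pose h (s : R) : R := \1_N (tau s).
  have mtau : measurable_fun `[0, rat_seq n] (EFin \o h).
    apply/measurable_EFinP; apply: (measurableT_comp mh).
    by have := measurable_old_clock (lexx 0) t20 Tt2; rewrite new_clock0 t2n.
  have {}int0 : (\int[mu]_(s in `[0%R, rat_seq n]) `|(EFin \o h) s| = 0)%E.
    under eq_integral do rewrite gee0_abs ?lee_fin//.
    rewrite [LHS]int0 -(integral0 mu `[0, t2]%classic).
    apply: ge0_ae_eq_integral => //.
    - by apply/measurable_EFinP; apply: measurable_funTS; exact: measurable_funM.
    - by move=> x _; rewrite lee_fin mulr_ge0.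
    - have : {ae mu, forall t, ~ N t}.
        by exists N; split => // t /= /contrapT.
      by apply: ae_mono => t Nt _; rewrite indicE memNset// mul0r.
  have := iffLR (ae_eq_integral_abs mu (measurable_itv `[0, rat_seq n]) mtau) int0.
  apply: ae_mono => s hs _ sn Ns.
  have /= : `[0, rat_seq n]%classic s by rewrite /= in_itv.
  by move=> /hs []; rewrite /= /h indicE mem_set//; apply/eqP; rewrite oner_eq0.
have := ae_foralln (fun n => bad n); apply: ae_mono => s bads bs.
have [n [sn bn]] := ray_rat_seq bs.
apply: contrapT => Ps; apply: (bads n bn); last first.
  by apply: NP => /= /(_ (old_clock_ray bs)).
by rewrite (ltW sn) andbT; case: bs.
Qed.

Lemma ae_is_derive_new_clock :
  {ae mu, forall t, ray T t -> 0 < t -> is_derive t (1 : R) sigma (k t)}.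
Proof.
have good n : {ae mu, forall t, ray T (rat_seq n) -> 0 < t < rat_seq n ->
    is_derive t (1 : R) sigma (k t)}.
  have [Tn|nTn] := pselect (ray T (rat_seq n)); last by apply: aeW => t /nTn.
  pose kn := k \_ `[0, rat_seq n].
  have ikn : mu.-integrable setT (EFin \o kn).
    by rewrite -restrict_EFin; apply/integrable_restrict => //=; rewrite setTI; exact: ik.
  have [H [_ HE]] := integral_primitive ikn.
  apply: ae_mono (ae_is_derive_integral ikn HE) => t dH _ /andP[t0 tn].
  have -> : k t = kn t.
    by rewrite /kn patchE mem_set//= in_itv/= !ltW.
  apply/is_derive_quotientP; move/is_derive_quotientP: dH.
  have sH x y : 0 <= x -> x <= y -> y <= rat_seq n -> sigma y - sigma x = H y - H x.
    move=> x0 xy yn; rewrite HE// new_clock_sub//; last first.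
      by apply: ray_le Tn => //; exact: le_trans xy.
    apply: eq_Rintegral => r /set_mem/=; rewrite in_itv/= => /andP[xr ry].
    by rewrite /kn patchE mem_set//= in_itv/= (le_trans x0)//= (le_trans ry).
  apply: cvg_trans; apply: near_eq_cvg; near=> s.
  have s0 : 0 < s by near: s; apply: nbhs_dnbhs; exact: lt_nbhsr.
  have sn : s < rat_seq n by near: s; apply: nbhs_dnbhs; exact: lt_nbhsl.
  congr (_ / _); have [st|/ltW ts] := leP s t.
    by apply: oppr_inj; rewrite !opprB sH// ltW.
  by rewrite sH// ltW.
apply: ae_mono (ae_foralln (fun n => good n)) => t goodt Tt t0.
have [n [tn Tn]] := ray_rat_seq Tt.
by apply: (goodt n Tn); rewrite t0.
Unshelve. all: by end_near. Qed.

Lemma near_old_clockK t : ray T t -> 0 < t -> {near t, cancel sigma tau}.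
Proof.
move=> Tt t0; have Tn := ray_nbhs Tt t0.
by near=> s; rewrite tauK//; near: s.
Unshelve. all: by end_near. Qed.

Lemma new_clock_continuous t : ray T t -> 0 < t -> {for t, continuous sigma}.
Proof.
move=> Tt t0; have [n [tn Tn]] := ray_rat_seq Tt.
have tn0 : 0 <= rat_seq n := le_trans (ltW t0) (ltW tn).
have := parameterized_integral_continuous tn0 (ik Tn).
move=> /continuous_within_itvP - /(_ (lt_trans t0 tn))[+ _ _].
by apply; rewrite in_itv/= t0.
Qed.

(* The last conjunct carries limits of difference quotients through [tau]. *)
Lemma ae_is_derive_old_clock : {ae mu, forall s, ray b s ->
  [/\ 0 < k (tau s), is_derive s (1 : R) tau (k (tau s))^-1 &
      tau @ s^' --> (tau s)^']}.
Proof.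
have good : {ae mu, forall t, ray T t -> 0 < t -> 0 < k t /\
    is_derive t (1 : R) sigma (k t)}.
  by apply: ae_mono2 kpos ae_is_derive_new_clock => t kt st Tt t0; split; auto.
(* Two-sided limits at time 0 would see arguments outside the ray; that single time is discarded. *)
apply: ae_mono2 (ae_neq 0) (ae_old_clock good) => s sn0 gs bs.
have Tt := old_clock_ray bs.
have s0 : 0 < s by rewrite lt_neqAle eq_sym sn0; case: bs.
have t0 : 0 < tau s.
  rewrite lt_neqAle eq_sym andbC; case: (Tt) => -> _ /=.
  by apply: contra_neq sn0 => tau0; rewrite -(old_clockK bs) tau0 new_clock0.
have [kt st] := gs bs t0.
have dtau : is_derive s (1 : R) tau (k (tau s))^-1.
  rewrite -{1}(old_clockK bs); apply: is_derive_inverse => //.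
  - exact: near_old_clockK.
  - have Tn := ray_nbhs Tt t0.
    near=> x; apply: new_clock_continuous; near: x => //; exact: lt_nbhsr.
  - by rewrite gt_eqF.
split => // A A_nbhs.
have {}A_nbhs : \forall y \near tau s, y != tau s -> A y := A_nbhs.
have ctau : {for s, continuous tau}.
  apply: differentiable_continuous; apply/derivable1_diffP; exact: ex_derive.
have bn := ray_nbhs bs s0.
suff : \forall x \near s^', A (tau x) by [].
near=> x.
suff : (tau x != tau s) -> A (tau x).
  apply; apply/eqP => xs; have bx : ray b x by near: x; exact: nbhs_dnbhs.
  have /eqP : x != s by near: x; exact: nbhs_dnbhs_neq.
  by apply; rewrite -(old_clockK bx) -(old_clockK bs) xs.
by near: x; exact: (nbhs_dnbhs (ctau _ A_nbhs)).
Unshelve. all: by end_near. Qed.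

End time_change.

(** * Local slope *)

Section slope.
Context {R : realType} {S : completeMetricType R}.
Variables (f : S -> \bar R) (p lambda : R).
Hypotheses (f_gtNy : forall v, f v != -oo%E) (lambda_lt0 : lambda < 0).
Hypotheses (p_gt1 : 1 < p) (f_convex : plambda_convex f p lambda).

Lemma dom_fine v : dom f v -> f v = (fine (f v))%:E.
Proof.
by move=> fv; rewrite fineK// fin_numE f_gtNy; move: fv; rewrite /dom/= ltey => ->.
Qed.

Lemma local_slope_ge0 v : (0 <= local_slope f v)%E.
Proof. by rewrite /local_slope; case: ifP => _; rewrite ?leey// le_max lexx. Qed.

Lemma mdist_cvg0 (v : S) (e : R) : 0 < e -> \forall w \near v, mdist v w < e.
Proof.
move=> e0; have := nbhsx_ballx v e e0.
by rewrite ballEmdist.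
Qed.

(** Along the convexity curve from [v] to [w], [f] has dropped at [gamma t] by at least [t] times
    the left-hand numerator, within distance [t * mdist v w] of [v]; small [t] give points near [v].
    Because [lambda < 0], the factor [1 - psi t] may be replaced by 1 for every [t]. *)
Lemma local_slope_lower v w : dom f v -> dom f w ->
  ((fine (f v) - fine (f w) + lambda * mdist v w `^ p)%:E <=
   local_slope f v * (mdist v w)%:E)%E.
Proof.
move=> dv dw; have [->|vw] := eqVneq v w.
  by rewrite mdistxx powR0 ?mulr0 ?mule0 ?subrr ?addr0// gt_eqF// (lt_trans _ p_gt1).
have d0 : 0 < mdist v w by rewrite mdist_gt0.
set d := mdist v w in d0 *; set A := _ + _.
have [A0|A0] := leP A 0.
  by rewrite (@le_trans _ _ 0%E)// mule_ge0 ?local_slope_ge0// lee_fin ltW.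
have [psi [psi01 _ _ /(_ v w)[gamma [_ g0 g1 gP]]]] := f_convex.
rewrite -lee_pdivrMr// /local_slope mem_set// le_max; apply/orP; right.
rewrite limf_esupE; apply: le_ereal_inf_tmp => _ [U vU <-].
have {vU}[e /= e0 eU] : exists2 e : R, 0 < e & forall x, mdist v x < e -> x != v -> U x.
  have /nbhs_ballP[e /= e0 eU] : nbhs v (fun x => x != v -> U x) := vU.
  by exists e => // x vx; apply: eU; rewrite ballEmdist.
(* Then [t * d <= e / 2], so [gamma t] falls into the given neighbourhood. *)
pose t := Num.min 1 (e / (2 * d)).
have t0 : 0 < t by rewrite lt_min ltr01 divr_gt0// mulr_gt0.
have t1 : t <= 1 by rewrite ge_min lexx.
have t01 : t \in `[0, 1] by rewrite in_itv/= ltW.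
have tde : t * d < e.
  have : t <= e / (2 * d) by rewrite ge_min lexx orbT.
  rewrite ler_pdivlMr ?mulr_gt0// => h; have := mulr_gt0 t0 d0; lra.
have [gd fg] := gP t t01.
rewrite g0 g1 metric_sym (metric_sym w) -/d in gd fg.
have dg : dom f (gamma t).
  apply: le_lt_trans fg _; rewrite (dom_fine dv) (dom_fine dw) -!EFinM -EFinD.
  by rewrite -?EFinB ltry.
rewrite (dom_fine dv) (dom_fine dw) (dom_fine dg) -!EFinM -EFinD -?EFinB lee_fin in fg.
have psi0 : 0 <= psi t by move: (psi01 t t01); rewrite in_itv/= => /andP[].
have tA : t * A <= fine (f v) - fine (f (gamma t)).
  have : lambda * t * d `^ p <= lambda * t * (1 - psi t) * d `^ p.
    rewrite -subr_ge0 (_ : _ - _ = - lambda * t * psi t * d `^ p); last by ring.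
    by rewrite !mulr_ge0 ?powR_ge0// ?(ltW t0)// oppr_ge0 ltW.
  by move: fg; rewrite /A; nra.
have gv : gamma t != v.
  apply/eqP => gv; move: tA; rewrite gv subrr leNgt mulr_gt0//.
have gd0 : 0 < mdist v (gamma t) by rewrite mdist_gt0 eq_sym.
have Ug : U (gamma t) by apply: eU gv; exact: le_lt_trans tde.
apply: le_trans (ereal_sup_ubound _); last by exists (gamma t).
rewrite /= (dom_fine dv) (dom_fine dg) -EFinB.
rewrite (max_idPl _) ?lee_fin; last first.
  by apply: le_trans tA; rewrite mulr_ge0 ?ltW.
rewrite ler_pdivlMr// (le_trans _ tA)// mulrAC ler_pdivrMr//.
rewrite -mulrA (mulrC t) -mulrA; apply: ler_wpM2l; first exact: ltW.
by rewrite mulrC.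
Qed.

(* With the converse [local_slope_lower], this makes the slope a supremum of
   nonlocal difference quotients, hence lower semicontinuous. *)
Lemma local_slope_gt v (c : R) : dom f v -> 0 <= c -> (c%:E < local_slope f v)%E ->
  exists w, [/\ w != v, dom f w &
    c * mdist v w < fine (f v) - fine (f w) + lambda * mdist v w `^ p].
Proof.
move=> dv c0 cs.
have [c' cc' c's] : exists2 c', c < c' & (c'%:E < local_slope f v)%E.
  case: (local_slope f v) cs => [s| |//]; last by exists (c + 1); rewrite ?ltrDl ?ltry.
  by rewrite lte_fin => cs; exists ((c + s) / 2); rewrite ?lte_fin; lra.
have c'0 := le_lt_trans c0 cc'.
move: c's; rewrite /local_slope mem_set// lt_max (lte_fin c' 0) (ltNge c' 0) (ltW c'0)/=.
rewrite limf_esupE => c's.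
(* Within distance [del] the convexity correction is at most [(c' - c) * mdist v w]: it only
   consumes the gap between [c'] and [c]. *)
pose del : R := ((c' - c) / - lambda) `^ (p - 1)^-1.
have p10 : 0 < p - 1 by rewrite subr_gt0.
have del0 : 0 < del by rewrite powR_gt0// divr_gt0 ?subr_gt0// oppr_gt0.
pose U : set S := [set w | mdist v w < del /\ w != v].
have vU : v^' U.
  rewrite /dnbhs/within/=; have := mdist_cvg0 v del0.
  by apply: filterS => w vw wv; split.
have : (c'%:E < ereal_sup ((fun w => maxe (f v - f w) 0 * ((mdist v w)^-1)%:E)%E @` U))%E.
  by apply: lt_le_trans c's _; apply: ereal_inf_lbound; exists U.
move=> /ereal_sup_gt[_ [w [wd wv] <-]] c'w.
have d0 : 0 < mdist v w by rewrite mdist_gt0 eq_sym.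
have dw : dom f w.
  rewrite /dom/= ltey; apply/eqP => fw; move: c'w.
  by rewrite fw (dom_fine dv)/= maxNye mul0e lte_fin ltNge (ltW c'0).
exists w; split => //.
move: c'w; rewrite (dom_fine dv) (dom_fine dw) -EFinB -EFin_max -EFinM lte_fin/=.
rewrite ltr_pdivlMr// lt_max => /orP[|]; last first.
  by rewrite ltNge mulr_ge0 ?ltW.
move=> c'd; apply: (@le_lt_trans _ _ (c' * mdist v w + lambda * mdist v w `^ p)).
  have : mdist v w `^ p <= mdist v w * ((c' - c) / - lambda).
    rewrite -(mulr_powRB1 (ltW d0) (lt_trans ltr01 p_gt1)) ler_wpM2l ?ltW//.
    rewrite (_ : (c' - c) / - lambda = del `^ (p - 1)); last first.
      rewrite /del -powRrM mulVf ?gt_eqF// powRr1//.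
      by rewrite divr_ge0 ?oppr_ge0 ?subr_ge0 ?ltW.
    by rewrite gt0_ltr_powR// ?nnegrE ?ltW.
  rewrite -(ler_nM2l lambda_lt0) mulrCA.
  rewrite (_ : lambda * ((c' - c) / - lambda) = c - c'); last first.
    by field; rewrite lt_eqF.
  lra.
by rewrite ltrD2r.
Qed.

(** One point [w] witnessing the strict bound at [v] still does so at nearby points, since the
    distance to [w] is continuous and [f] lower semicontinuous; outside the domain the slope is
    [+oo]. *)
Lemma local_slope_lsc v (c : R) : lower_semicontinuous f -> dom f v -> 0 <= c ->
  (c%:E < local_slope f v)%E -> \forall v' \near v, (c%:E < local_slope f v')%E.
Proof.
move=> f_lsc dv c0 /(local_slope_gt dv c0)[w [wv dw cw]].
pose d := mdist v w.
have d0 : 0 < d by rewrite mdist_gt0 eq_sym.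
(* The midpoint between [fine (f v)] and the threshold that it exceeds leaves room on both sides:
   for the semicontinuity of [f] and for the continuity of the distance. *)
pose a : R := (fine (f v) + (c * d + fine (f w) - lambda * d `^ p)) / 2.
have av : a < fine (f v) by rewrite /a; rewrite -/d in cw; lra.
have ca : c * d - lambda * d `^ p < a - fine (f w) by rewrite /a; rewrite -/d in cw; lra.
have /f_lsc [V vV Va] : (a%:E < f v)%E by rewrite (dom_fine dv) lte_fin.
have cont : {for d, continuous (fun r : R => c * r - lambda * r `^ p)}.
  apply: cvgB; first by apply: cvgM; [exact: cvg_cst|exact: cvg_id].
  have dpow : derivable (fun r : R => r `^ p) d 1.
    by apply: derivable_powR; rewrite in_itv/= d0.
  have cpow := differentiable_continuous (iffLR (derivable1_diffP _ _) dpow).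
  by apply: cvgM; [exact: cvg_cst|exact: cpow].
have near_d : \forall r \near d, c * r - lambda * r `^ p < a - fine (f w).
  by move: (cont) => /cvgr_lt/(_ _ ca).
have dist_cvg : mdist x w @[x --> v] --> d.
  apply/cvgrPdist_lt => e e0; near=> x.
  by rewrite (le_lt_trans (mdist_sub_le _ _ _))//; near: x; exact: mdist_cvg0.
near=> v'.
have v'r : c * mdist v' w - lambda * mdist v' w `^ p < a - fine (f w).
  by near: v'; exact: dist_cvg near_d.
have v'0 : 0 < mdist v' w.
  near: v'; exact: dist_cvg (lt_nbhsr d0).
have av' : (a%:E < f v')%E by apply: Va; near: v'.
have [dv'|ndv'] := pselect (dom f v'); last first.
  by rewrite /local_slope memNset// ltry.
have := local_slope_lower dv' dw.
rewrite (dom_fine dv') lte_fin in av'.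
case: (local_slope f v') (local_slope_ge0 v') => [s| |//]; rewrite ?ltry//.
rewrite -EFinM !lee_fin lte_fin => s0 h.
rewrite -(ltr_pM2r v'0) (lt_le_trans _ h)//; lra.
Unshelve. all: by end_near. Qed.

End slope.

(** * Conjugate exponents and Young's inequality *)

Section exponents.
Context {R : realType}.
Implicit Types p a s : R.

Lemma conj_exponentE p : 1 < p -> conj_exponent p = p / (p - 1).
Proof.
move=> p1; rewrite /conj_exponent /hoelder_conjugate/= eqe gt_eqF ?(lt_trans _ p1)//=.
by rewrite -EFinD inver subr_eq0 gt_eqF.
Qed.

Lemma conj_exponentV p : 1 < p -> (conj_exponent p)^-1 = 1 - p^-1.
Proof. by move=> p1; rewrite conj_exponentE//; field; apply/andP; split; lra. Qed.

Lemma conj_exponent_gt0 p : 1 < p -> 0 < conj_exponent p.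
Proof. by move=> p1; rewrite conj_exponentE// divr_gt0//; lra. Qed.

(** Since [p / q = p - 1]. In this form [(1 - alpha p p') * (p' - 1) = p - 1]: a curve run at speed
    [g ^ (1 - alpha p p')] has the slope that the exponent [p'] requires. *)
Lemma alphaE p p' : 1 < p -> 1 < p' -> alpha p p' = 1 - (p - 1) / (p' - 1).
Proof.
by move=> p1 p'1; rewrite /alpha !conj_exponentE//; field; apply/and4P; split; lra.
Qed.

Lemma expR_tangent_lt (M x : R) : x != M -> expR M * (1 + (x - M)) < expR x.
Proof.
move=> xM; rewrite -{2}(subrK M x) expRD mulrC ltr_pM2r ?expR_gt0//.
by apply: expR_gt1Dx; rewrite subr_eq0.
Qed.

Lemma expR_tangent_le (M x : R) : expR M * (1 + (x - M)) <= expR x.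
Proof.
by have [->|/expR_tangent_lt/ltW//] := eqVneq x M; rewrite subrr addr0 mulr1.
Qed.

(** For positive [a] and [s] put [X = p * ln a] and [Y = q * ln s]: then [a * s] is the exponential
    of their weighted mean [M], and the strict tangent inequality of [expR] at [M] leaves only
    [X = Y = M]. *)
Lemma young_equality p a s : 1 < p -> 0 <= a -> 0 <= s ->
  p^-1 * a `^ p + (conj_exponent p)^-1 * s `^ conj_exponent p <= a * s ->
  s = a `^ (p - 1).
Proof.
move=> p1 a0 s0; have q0 := conj_exponent_gt0 p1; have qV := conj_exponentV p1.
have pV : 0 < p^-1 < 1 by rewrite invr_gt0 invf_lt1 ?(lt_trans ltr01).
set q := conj_exponent p in q0 qV *.
have p0 : 0 < p by lra.
have qV0 : 0 < q^-1 by rewrite invr_gt0.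
have [->|an0] := eqVneq a 0.
  rewrite mul0r powR0 ?gt_eqF// mulr0 add0r pmulr_rle0// => sq.
  have /eqP : s `^ q = 0 by apply/eqP; rewrite eq_le sq powR_ge0.
  by rewrite powR_eq0 => /andP[/eqP -> _]; rewrite powR0// gt_eqF// subr_gt0.
have {an0}a0 : 0 < a by rewrite lt_neqAle eq_sym an0.
have [->|sn0] := eqVneq s 0.
  rewrite mulr0 powR0 ?gt_eqF// mulr0 addr0 pmulr_rle0 ?invr_gt0//.
  by rewrite leNgt powR_gt0.
have {sn0}s0 : 0 < s by rewrite lt_neqAle eq_sym sn0.
rewrite /powR !gt_eqF//.
set X := p * ln a; set Y := q * ln s; set M := p^-1 * X + q^-1 * Y.
have -> : a * s = expR M.
  by rewrite /M /X /Y !mulrA !mulVf ?gt_eqF// !mul1r expRD !lnK.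
move=> young.
have ME : M = p^-1 * X + (1 - p^-1) * Y by rewrite -qV.
have MX : X = M.
  apply/eqP; apply: contraTT young => XM; rewrite -ltNge.
  have h1 := expR_tangent_lt XM; have h2 := expR_tangent_le M Y.
  have {}h1 : p^-1 * (expR M * (1 + (X - M))) < p^-1 * expR X.
    by rewrite ltr_pM2l//; case/andP: pV.
  have {}h2 : q^-1 * (expR M * (1 + (Y - M))) <= q^-1 * expR Y by rewrite ler_pM2l.
  apply: le_lt_trans (ltr_leD h1 h2).
  by rewrite le_eqVlt; apply/orP; left; apply/eqP; rewrite qV ME; ring.
have YM : Y = M.
  have : q^-1 * Y = q^-1 * M by move: ME; rewrite qV MX; lra.
  by move/mulfI; apply; rewrite gt_eqF.
have : X = Y by rewrite MX YM.
rewrite /X /Y /q conj_exponentE// => h.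
rewrite -[LHS]lnK ?posrE//; congr expR.
have := congr1 (fun x => (p - 1) / p * x) h.
have -> : (p - 1) / p * (p * ln a) = (p - 1) * ln a by field; lra.
by have -> : (p - 1) / p * (p / (p - 1) * ln s) = ln s by field; apply/andP; split; lra.
Qed.

End exponents.

(** * Curves of maximal slope *)

Section steepest.
Context {R : realType} {S : completeMetricType R}.
Local Notation mu := (@lebesgue_measure R).
Implicit Types (a : \bar R) (u : R -> S) (g : R -> R).

(** Restricted to times of the ray, so that it also holds at [t = 0], before which the values of [u]
    are arbitrary. *)
Lemma speed_continuous a u g t : has_speed a u g -> ray a t ->
  forall e, 0 < e -> exists2 d, 0 < d &
    forall s, ray a s -> `|s - t| < d -> mdist (u t) (u s) < e.
Proof.
move=> [_ g0 ig ug _] at_ e e0; have [n [tn an]] := ray_rat_seq at_.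
have [d d0 dE] := Rintegral_itv_small g0 (ig _ an) e0.
exists (Num.min d (rat_seq n - t)); first by rewrite lt_min d0 subr_gt0.
move=> s as_; rewrite lt_min => /andP[std stn].
have t0 : 0 <= t by case: at_.
have s0 : 0 <= s by case: as_.
have sn : s <= rat_seq n.
  by rewrite -(lerD2r (- t)) (le_trans (ler_norm _))// ltW.
have [ts|/ltW st] := leP t s.
  apply: le_lt_trans (ug _ _ t0 ts as_) _; apply: dE => //.
  exact: le_lt_trans (ler_norm _) std.
rewrite metric_sym; apply: le_lt_trans (ug _ _ s0 st at_) _; apply: dE => //.
  exact: ltW.
by rewrite distrC in std; exact: le_lt_trans (ler_norm _) std.
Qed.

Lemma speed_cvg a u g t : has_speed a u g -> ray a t -> 0 < t -> u @ t --> u t.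
Proof.
move=> ug at_ t0 A /nbhs_ballP[e /= e0 eA].
have [d d0 dE] := speed_continuous ug at_ e0.
have near_ray := ray_nbhs at_ t0.
suff : \forall s \near t, A (u s) by [].
near=> s; apply: eA; rewrite ballEmdist/=; apply: dE; first by near: s.
by near: s; exists d => //= s; rewrite /ball_/= distrC.
Unshelve. all: by end_near. Qed.

Variable f : S -> \bar R.
Hypothesis f_gtNy : forall v, f v != -oo%E.

Lemma local_slope_upper v (c e : R) : dom f v -> (local_slope f v <= c%:E)%E ->
  0 < e -> \forall w \near v, dom f w ->
    fine (f v) - fine (f w) <= (c + e) * mdist v w.
Proof.
move=> dv; rewrite /local_slope mem_set// ge_max => /andP[]; rewrite lee_fin => c0.
rewrite limf_esupE => sc e0.
have : (ereal_inf [set ereal_sup ((fun w => maxe (f v - f w) 0 * ((mdist v w)^-1)%:E)%E @` V) |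
    V in v^'] < (c + e)%:E)%E.
  by apply: le_lt_trans sc _; rewrite lte_fin ltrDl.
move=> /ereal_inf_lt[_ [U vU <-] supU].
have {vU} : \forall w \near v, w != v -> U w := vU.
apply: filterS => w wU dw.
have [->|wv] := eqVneq w v; first by rewrite mdistxx mulr0 subrr.
have d0 : 0 < mdist v w by rewrite mdist_gt0 eq_sym.
have : (maxe (f v - f w) 0 * ((mdist v w)^-1)%:E <= (c + e)%:E)%E.
  by apply: le_trans (ltW supU); apply: ereal_sup_ubound; exists w => //; exact: wU.
rewrite (dom_fine f_gtNy dv) (dom_fine f_gtNy dw) -EFinB -EFin_max -EFinM lee_fin.
rewrite ler_pdivrMr//; apply: le_trans; by rewrite le_max lexx.
Qed.

(* For a curve of maximal slope Young's inequality is an equality at almost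
   every time, which determines the slope and the dissipation from the speed. *)
Definition steepest (p : R) a (u0 : S) u g :=
  [/\ has_speed a u g, u 0 = u0,
    forall s t, ray a s -> ray a t -> s <= t -> (f (u t) <= f (u s))%E &
    {ae mu, forall t, ray a t ->
      local_slope f (u t) = (g t `^ (p - 1))%:E /\
      is_derive t (1 : R) (fine \o f \o u) (- g t `^ p)}].

Variables (p : R) (u0 : S).
Hypotheses (p_gt1 : 1 < p) (u0_dom : dom f u0).

Lemma curve_dom a u t :
  u 0 = u0 -> (forall s t, ray a s -> ray a t -> s <= t -> (f (u t) <= f (u s))%E) ->
  ray a t -> dom f (u t).
Proof.
move=> u00 fu at_; apply: (le_lt_trans _ u0_dom); rewrite -u00.
have t0 : 0 <= t by case: at_.
by apply: fu => //; exact: ray_le t0 at_.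
Qed.

(** By definition of the slope, the quotients of the energy are at most the slope, up to a small
    error, times those of the distance, so [- D <= g t * s]. Together with the defining inequality
    this reverses Young's inequality, whose equality case gives the slope. *)
Lemma max_slope_curve_steepest a u : max_slope_curve f p a u0 u ->
  exists g, steepest p a u0 u g.
Proof.
move=> [/ACloc_has_speed[g ug] u00 fu fu']; exists g; split => //.
have [mg g0 ig dg du] := ug.
apply: ae_mono2 (_ : {ae mu, forall t, t != 0 /\ (ray a t ->
  mdist (u t) (u s) / `|t - s| @[s --> t^'] --> g t)}) fu'; last first.
  by apply: ae_mono2 (ae_neq 0) du.
move=> t [tn0 dut] fut at_.
have t0 : 0 < t by rewrite lt_neqAle eq_sym tn0; case: at_.
have {}dut := dut at_; have [dfu] := fut at_.
have -> : metric_derivative u t = g t by exact: cvg_lim.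
set F := fine \o f \o u in dfu *; set D := derive1 F t.
have dF : is_derive t (1 : R) F D by split => //; rewrite -derive1E.
have dv : dom f (u t) by exact: curve_dom fu at_.
have q0 := conj_exponent_gt0 p_gt1.
have := local_slope_ge0 f (u t).
(* An infinite slope would put the real derivative below [-oo]. *)
case slopeE : (local_slope f (u t)) => [s| |] // s0; last first.
  rewrite poweRyr ?gt_eqF// gt0_muley ?lte_fin ?invr_gt0//.
rewrite poweR_EFin -EFinM -EFinN -EFinB lee_fin => Dle.
have upper : - D <= g t * s.
  apply/ler_addgt0Pr => e e0.
  (* Adding 1 avoids division by a zero speed; the error becomes [e * g t / (g t + 1) <= e]. *)
  have e'0 : 0 < e / (g t + 1) by rewrite divr_gt0// ltr_wpDl.
  set e' := e / (g t + 1) in e'0.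
  have slope_le : (local_slope f (u t) <= s%:E)%E by rewrite slopeE.
  have near_slope := local_slope_upper dv slope_le e'0.
  have quot_F := (is_derive_quotientP F t D).1 dF.
  have {}quot_F : - ((F s - F t) / (s - t)) @[s --> t^'+] --> - D.
    by apply: cvgN; exact: cvg_dnbhs_at_right quot_F.
  have quot_u : (s + e') * (mdist (u t) (u x) / `|t - x|) @[x --> t^'+] --> (s + e') * g t.
    by apply: cvgM; [exact: cvg_cst|exact: cvg_dnbhs_at_right dut].
  have : - D <= (s + e') * g t.
    apply: (ler_cvg_to quot_F quot_u); near=> x.
    have tx : t < x by near: x; exact: nbhs_right_gt.
    have ax : ray a x.
      by near: x; apply: cvg_within; exact: (ray_nbhs at_ t0).
    rewrite -mulNr opprB distrC (gtr0_norm (_ : 0 < x - t)) ?subr_gt0// mulrA.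
    rewrite ler_wpM2r ?invr_ge0 ?subr_ge0 ?(ltW tx)//.
    have dx : dom f (u x) by exact: curve_dom fu ax.
    by move: dx; near: x; apply: cvg_within; exact: (speed_cvg ug at_ t0 near_slope).
  rewrite mulrDl => /le_trans; apply; rewrite mulrC lerD2l /e' mulrAC.
  by rewrite ler_pdivrMr ?ltr_wpDl// ler_wpM2l ?(ltW e0)// lerDl.
have sE : s = g t `^ (p - 1).
  apply: young_equality => //; rewrite ?lee_fin// in s0 *.
  by apply: le_trans upper; lra.
split; first by rewrite sE.
suff -> : - g t `^ p = D by [].
have qV := conj_exponentV p_gt1.
have gp : g t `^ p = g t * g t `^ (p - 1).
  by rewrite mulr_powRB1// (lt_trans _ p_gt1).
have sq : s `^ conj_exponent p = g t `^ p.
  rewrite sE -powRrM conj_exponentE//; congr (_ `^ _).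
  by field; rewrite subr_eq0 gt_eqF.
move: Dle upper; rewrite sq qV sE -gp => Dle upper.
by apply/eqP; rewrite eq_le; apply/andP; split; lra.
Unshelve. all: by end_near. Qed.

Lemma steepest_max_slope_curve a u g : steepest p a u0 u g -> max_slope_curve f p a u0 u.
Proof.
move=> [ug u00 fu fu']; have [mg g0 ig dg du] := ug.
split => //.
  exists g.
    move=> K cK Ka; have [[x Kx]|] := pselect (K !=set0); last first.
      by move=> /set0P/negP/negbNE/eqP ->; exact: integrable_set0.
    have [||c cK' Kc] := @compact_EVT_max R R id K _ cK; first by exists x.
      by apply: continuous_subspaceT => y; exact: cvg_id.
    apply: integrableS (ig c (Ka _ (set_mem cK'))) => //.
      exact: compact_measurable.
    move=> y Ky; rewrite /= in_itv/= (Kc y (mem_set Ky)) andbT.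
    by case: (Ka _ Ky).
  move=> s t as_ at_ st; have s0 : 0 <= s by case: as_.
  rewrite -EFin_Rintegral//; first by rewrite lee_fin dg.
  exact: integrable_subitv (ig _ at_) _ _.
apply: ae_mono2 du fu' => t dut fut at_.
have [slopeE dF] := fut at_; split; first exact: ex_derive.
rewrite derive1E derive_val (_ : metric_derivative u t = g t); last first.
  by apply: cvg_lim => //; exact: dut.
rewrite slopeE poweR_EFin -EFinM -EFinN -EFinB lee_fin.
have -> : (g t `^ (p - 1)) `^ conj_exponent p = g t `^ p.
  rewrite -powRrM conj_exponentE//; congr (_ `^ _).
  by field; rewrite subr_eq0 gt_eqF.
by rewrite conj_exponentV//; lra.
Qed.

End steepest.

(** * Integrands not known to be measurable *)

Section nonmeasurable_integral.
Context d (T : measurableType d) (R : realType) (mu : {measure set T -> \bar R}).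
Local Open Scope ereal_scope.

Let ge0_le_integral_nonmeasurable (D : set T) (f g : T -> \bar R) :
  (forall x, D x -> 0 <= f x) -> (forall x, D x -> f x <= g x) ->
  \int[mu]_(x in D) f x <= \int[mu]_(x in D) g x.
Proof.
move=> f0 fg; have g0 x : D x -> 0 <= g x.
  by move=> Dx; rewrite (le_trans (f0 _ Dx)) ?fg.
rewrite !ge0_integralE//; apply: le_ereal_sup => _ [h hf <-]; exists h => // x.
apply: le_trans (hf x) _; rewrite !patchE; case: ifPn => // /set_mem; exact: fg.
Qed.

(** The integral of a nonnegative function is a supremum over simple functions below it, hence
    monotone without measurability. Redefining [g] on the null set as [+oo], then as 0, encloses [f]
    between two measurable functions with the integral of [g]. This is what evaluates [new_time] and
    [new_stop_time]. *)
Lemma ge0_ae_eq_integral_nonmeasurable (D : set T) (f g : T -> \bar R) :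
  measurable D -> measurable_fun D g ->
  (forall x, D x -> 0 <= f x) -> (forall x, D x -> 0 <= g x) ->
  (\forall x \ae mu, D x -> f x = g x) ->
  \int[mu]_(x in D) f x = \int[mu]_(x in D) g x.
Proof.
move=> mD mg f0 g0 [N [mN N0 NP]].
pose g' (c : \bar R) x := (g \_ (~` N)) x + (cst c \_ N) x.
have g'N c x : x \in N -> g' c x = c.
  by move=> xN; rewrite /g' !patchE in_setC xN/= add0e.
have g'C c x : x \notin N -> g' c x = g x.
  by move=> xN; rewrite /g' !patchE in_setC xN (negbTE xN) adde0.
have g'E c : 0 <= c -> \int[mu]_(x in D) g x = \int[mu]_(x in D) g' c x.
  move=> c0; apply: ge0_ae_eq_integral => //.
  - apply: emeasurable_funD; apply/measurable_restrict => //.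
    + exact: measurableC.
    + exact: measurable_funS mg.
  - move=> x Dx; have [xN|xN] := boolP (x \in N); first by rewrite g'N.
    by rewrite g'C// g0.
  - exists N; split => // x /=; apply: contra_notP => Nx _.
    by rewrite g'C// notin_setE.
have fN x : D x -> x \notin N -> f x = g x.
  move=> Dx; apply: contraNeq => fgx; rewrite inE; apply: NP => /= /(_ Dx).
  exact/eqP.
apply/eqP; rewrite eq_le; apply/andP; split.
  rewrite (g'E +oo) ?leey//; apply: ge0_le_integral_nonmeasurable => // x Dx.
  have [xN|xN] := boolP (x \in N); first by rewrite g'N// leey.
  by rewrite g'C// fN.
rewrite (g'E 0)//; apply: ge0_le_integral_nonmeasurable => x Dx;
  have [xN|xN] := boolP (x \in N).
- by rewrite g'N.
- by rewrite g'C// g0.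
- by rewrite g'N// f0.
- by rewrite g'C// fN.
Qed.

End nonmeasurable_integral.

Lemma integrable_itv_cst {R : realType} (c s t : R) :
  (@lebesgue_measure R).-integrable `[s, t] (EFin \o cst c).
Proof.
apply: measurable_bounded_integrable => //.
  by rewrite /= lebesgue_measure_itv/=; case: ifP => _; rewrite ?ltry// -EFinB ltry.
exists `|c|; split; first by rewrite num_real.
by move=> M cM x _ /=; exact: ltW.
Qed.

Section dynamics.
Context {R : realType} {S : completeMetricType R}.
Local Notation mu := (@lebesgue_measure R).
Variables (f : S -> \bar R) (p0 lambda : R) (u0 : S).
Hypotheses (f_gtNy : forall v, f v != -oo%E) (f_lsc : lower_semicontinuous f).
Hypotheses (u0_dom : dom f u0) (lambda_lt0 : lambda < 0) (p0_gt1 : 1 < p0).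
Hypothesis f_convex : plambda_convex f p0 lambda.
Implicit Types (a : \bar R) (u : R -> S) (g : R -> R) (p : R).

(** An inequality only: the energy, known to be merely monotone, might lose more than its derivative
    accounts for. *)
Lemma steepest_energy p a u g s t : steepest f p a u0 u g ->
  0 <= s -> s <= t -> ray a t ->
  (\int[mu]_(r in `[s, t]) (g r `^ p)%:E <= (fine (f (u s)) - fine (f (u t)))%:E)%E.
Proof.
move=> [[mg g0 _ _ _] u00 fu fu'] s0 st at_.
have at' r : s <= r -> r <= t -> ray a r.
  by move=> sr rt; apply: ray_le rt at_; exact: le_trans sr.
pose F r := - fine (f (u r)).
have -> : fine (f (u s)) - fine (f (u t)) = F t - F s by rewrite /F opprK addrC.
apply: ge0_integral_derive_le => //.
- move=> x y sx xy yt; rewrite /F lerN2.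
  have ax := at' _ sx (le_trans xy yt); have ay := at' _ (le_trans sx xy) yt.
  have dx := curve_dom u0_dom u00 fu ax; have dy := curve_dom u0_dom u00 fu ay.
  by rewrite -lee_fin -(dom_fine f_gtNy dx) -(dom_fine f_gtNy dy) fu.
- by apply: (measurableT_comp (measurable_powR p)).
- by move=> r; rewrite powR_ge0.
- apply: ae_mono fu' => r fr /andP[sr rt].
  have [_ dfr] := fr (at' _ (ltW sr) (ltW rt)).
  exists (g r `^ p) => //.
  by have := is_deriveN dfr; rewrite opprK.
Qed.

(* The slope being 0 at [u s], convexity bounds the drop of [f] by
   [- lambda * D `^ p0], D the distance travelled; by Hoelder and the energy
   inequality [D `^ p] is at most [(t - s) `^ (p - 1)] times that drop, which for
   small [t - s] is only possible if D = 0. *)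
Lemma steepest_stationary_step p a u g s t (B : R) : 1 < p -> p <= p0 ->
  steepest f p a u0 u g -> 0 <= s -> s <= t -> ray a t ->
  local_slope f (u s) = 0%E -> mdist (u s) (u t) <= B ->
  - lambda * B `^ (p0 - p) * (t - s) `^ (p - 1) < 1 -> u t = u s.
Proof.
move=> p1 pp0 st_u s0 st at_ slope0 DB small.
have energy := steepest_energy st_u s0 st at_.
have [ug u00 fu fu'] := st_u; have [mg g0 ig dg _] := ug.
have as_ := ray_le s0 st at_.
have ds := curve_dom u0_dom u00 fu as_.
have dt := curve_dom u0_dom u00 fu at_.
set D := mdist (u s) (u t) in DB *.
apply/eqP; rewrite eq_sym -[_ == _]negbK -mdist_gt0 -/D; apply/negP => D0.
have := local_slope_lower f_gtNy lambda_lt0 p0_gt1 f_convex ds dt.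
rewrite slope0 mul0e lee_fin -/D.
set E := fine (f (u s)) - fine (f (u t)) in energy * => ED.
have sltt : s < t.
  rewrite lt_neqAle st andbT; apply: contraTneq D0 => st_eq.
  by rewrite /D st_eq mdistxx ltxx.
set del := t - s; have del0 : 0 < del by rewrite subr_gt0.
(* The mean speed of a curve of length [D]. Young's inequality scaled by [M] stands in for Hoelder:
   integrated over [[s, t]], its constant term is [D / q], which is absorbed into [D]. *)
pose M := D / del; have M0 : 0 < M by rewrite divr_gt0.
have p_gt0 : 0 < p by lra.
have iks : mu.-integrable `[s, t] (EFin \o g) by exact: integrable_subitv (ig _ at_) _ _.
have mgp : measurable_fun [set: R] (fun r => g r `^ p).
  exact: (measurableT_comp (measurable_powR p)).
have igp : mu.-integrable `[s, t] (EFin \o (fun r => g r `^ p)).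
  apply/integrableP; split; first by apply/measurable_EFinP; exact: measurable_funTS.
  under eq_integral do rewrite gee0_abs ?lee_fin ?powR_ge0//.
  exact: le_lt_trans energy (ltry _).
have icst : mu.-integrable `[s, t] (EFin \o cst (M / conj_exponent p)).
  exact: integrable_itv_cst.
have igpM : mu.-integrable `[s, t] (EFin \o (fun r => M `^ (1 - p) / p * g r `^ p)).
  have := @integrableZl _ _ R mu `[s, t]%classic (measurable_itv _) (M `^ (1 - p) / p) _ igp.
  by apply: eq_integrable.
have young r : g r <= M `^ (1 - p) / p * g r `^ p + M / conj_exponent p.
  have := @conjugate_powR R (g r / M) 1 p (conj_exponent p).
  rewrite powR1 mulr1 => /(_ _ _ _ (conj_exponent_gt0 p1)) h.
  have {}h : g r / M <= (g r / M) `^ p / p + 1 / conj_exponent p.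
    apply: h => //; first by rewrite divr_ge0// ltW.
    by rewrite conj_exponentV//; lra.
  rewrite ler_pdivrMr// in h; apply: le_trans h _.
  rewrite powRM ?invr_ge0 ?(ltW M0)//.
  have -> : M^-1 `^ p = M `^ (1 - p) / M.
    have -> : M `^ (1 - p) = M / M `^ p.
      by rewrite powRB ?powRr1 ?(ltW M0)//; apply/implyP => _; rewrite (gt_eqF M0).
    rewrite -[in LHS](powR_inv1 (ltW M0)) -powRrM mulN1r powRN.
    by rewrite mulrC mulrA mulVf ?gt_eqF// mul1r.
  rewrite le_eqVlt; apply/orP; left; apply/eqP.
  by field; rewrite !gt_eqF// ?conj_exponent_gt0.
have DE : D <= M `^ (1 - p) / p * E + M / conj_exponent p * del.
  apply: le_trans (dg _ _ s0 st at_) _.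
  apply: (@le_trans _ _ (\int[mu]_(r in `[s, t])
     (M `^ (1 - p) / p * g r `^ p + M / conj_exponent p))).
    apply: le_Rintegral => //.
    by have := @integrableD _ _ R mu `[s, t]%classic (measurable_itv _) _ _ igpM icst; apply: eq_integrable.
  rewrite RintegralD// RintegralZl// Rintegral_cst//= lebesgue_measure_itv/= lte_fin sltt.
  rewrite -EFinB/= lerD2r ler_wpM2l//; first by rewrite mulr_ge0 ?powR_ge0 ?invr_ge0 ?ltW.
  by rewrite -lee_fin EFin_Rintegral.
have {}DE : D <= M `^ (1 - p) * E.
  have : M / conj_exponent p * del = D * (1 - p^-1).
    by rewrite conj_exponentV// /M; field; rewrite !gt_eqF.
  move: DE => /[swap] -> DE.
  have : D * p^-1 <= M `^ (1 - p) * E * p^-1 by lra.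
  by rewrite ler_pM2r ?invr_gt0.
(* Here [p <= p0] enters: the surplus power of [D] is bounded by that of [B], leaving the power [p],
   which [M ^ (1 - p)] reduces to a linear bound in [D]. *)
have {}ED : E <= - lambda * B `^ (p0 - p) * D `^ p.
  apply: (@le_trans _ _ (- lambda * D `^ p0)); first lra.
  rewrite -mulrA ler_wpM2l ?oppr_ge0 ?(ltW lambda_lt0)//.
  have -> : D `^ p0 = D `^ (p0 - p) * D `^ p.
    by rewrite -powRD ?subrK//; apply/implyP => _; rewrite (gt_eqF D0).
  rewrite ler_wpM2r ?powR_ge0// ge0_ler_powR ?subr_ge0// nnegrE ?(ltW D0)//.
  exact: le_trans (ltW D0) DB.
have : D <= - lambda * B `^ (p0 - p) * del `^ (p - 1) * D.
  apply: le_trans DE _; apply: le_trans (ler_wpM2l (powR_ge0 _ _) ED) _.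
  have -> : M `^ (1 - p) = D `^ (1 - p) * del `^ (p - 1).
    rewrite /M powRM ?invr_ge0 ?(ltW del0) ?(ltW D0)//; congr (_ * _).
    rewrite -powR_inv1 ?(ltW del0)// -powRrM; congr (_ `^ _); ring.
  have DD : D `^ (1 - p) * D `^ p = D.
    by rewrite -powRD ?subrK ?powRr1 ?(ltW D0)//; apply/implyP => _; rewrite (gt_eqF D0).
  rewrite le_eqVlt; apply/orP; left; apply/eqP.
  by rewrite -[in RHS]DD; ring.
by rewrite leNgt gtr_pMl// small.
Qed.

(** The length [B] of the curve up to [t] bounds all distances involved, so one time step [del] is
    admissible throughout and finitely many steps reach [t]. *)
Lemma steepest_stationary p a u g s t : 1 < p -> p <= p0 ->
  steepest f p a u0 u g -> 0 <= s -> s <= t -> ray a t ->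
  local_slope f (u s) = 0%E -> u t = u s.
Proof.
move=> p1 pp0 st_u s0 st at_ slope0.
have [[mg g0 ig dg _] _ _ _] := st_u.
pose B := \int[mu]_(r in `[0, t]) g r.
have DB x y : 0 <= x -> x <= y -> y <= t -> mdist (u x) (u y) <= B.
  move=> x0 xy yt; apply: le_trans (dg _ _ x0 xy (ray_le (le_trans x0 xy) yt at_)) _.
  exact: Rintegral_itv_le (ig _ at_) _ _.
pose K := - lambda * B `^ (p0 - p).
have K0 : 0 <= K by rewrite mulr_ge0 ?powR_ge0// oppr_ge0 ltW.
have K1 : 0 < K + 1 by rewrite ltr_wpDl.
(* Then [K * del ^ (p - 1) = K / (K + 1) < 1]. *)
pose del := (K + 1)^-1 `^ (p - 1)^-1.
have p10 : 0 < p - 1 by rewrite subr_gt0.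
have del0 : 0 < del by rewrite powR_gt0// invr_gt0.
have delE : del `^ (p - 1) = (K + 1)^-1.
  by rewrite -powRrM mulVf ?gt_eqF// powRr1// invr_ge0 ltW.
have step n : forall y, s <= y -> y <= t -> y <= s + n%:R * del -> u y = u s.
  elim: n => [|n IH] y sy yt; first by rewrite mul0r addr0 => ys; congr u; apply: le_anti; rewrite ys.
  move=> yn; pose x := Num.min y (s + n%:R * del).
  have sx : s <= x by rewrite le_min sy lerDl mulr_ge0// ltW.
  have xy : x <= y by rewrite ge_min lexx.
  have ux : u x = u s.
    by apply: IH => //; [exact: le_trans yt|rewrite ge_min lexx orbT].
  rewrite -ux; have x0 := le_trans s0 sx.
  apply: (@steepest_stationary_step p a u g x y B) => //.
  - exact: ray_le (le_trans x0 xy) yt at_.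
  - by rewrite ux.
  - exact: DB.
  - apply: (@le_lt_trans _ _ (K * del `^ (p - 1))).
      have yx : y - x <= del.
        rewrite lerBlDl /x; case: (leP y (s + n%:R * del)) => _.
          by rewrite lerDl ltW.
        by apply: le_trans yn _; rewrite -natr1 mulrDl mul1r addrA.
      by rewrite ler_wpM2l// ge0_ler_powR// ?nnegrE ?subr_ge0// ltW.
    by rewrite delE ltr_pdivrMr// mul1r ltrDl.
apply: (step (Num.trunc ((t - s) / del)).+1) => //.
by rewrite -lerBlDl -ler_pdivrMr// ltW// truncnS_gt.
Qed.

End dynamics.

(** * Reparametrization *)

Section stop.
Context {R : realType} {S : completeMetricType R}.
Local Notation mu := (@lebesgue_measure R).
Variables (f : S -> \bar R) (p0 lambda : R) (u0 : S).
Hypotheses (f_gtNy : forall v, f v != -oo%E) (f_lsc : lower_semicontinuous f).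
Hypotheses (u0_dom : dom f u0) (lambda_lt0 : lambda < 0) (p0_gt1 : 1 < p0).
Hypothesis f_convex : plambda_convex f p0 lambda.

(** [stop_time] for functions on the whole line: [stop_time f u] is convertible to
    [slope_stop f a (valL u)]. *)
Definition slope_stop (a : \bar R) (u : R -> S) : \bar R :=
  ereal_sup (0%E |` [set t%:E | t in
    [set t | ray a t /\ (0 < local_slope f (u t))%E]]).

Section fixed_curve.
Variables (a : \bar R) (u : R -> S) (g : R -> R) (p : R).
Hypotheses (a_gt0 : (0 < a)%E) (p_gt1 : 1 < p) (p_le : p <= p0).
Hypothesis st_u : steepest f p a u0 u g.
Local Notation T := (slope_stop a u).

Lemma slope_stop_ge0 : (0 <= T)%E.
Proof. by apply: ereal_sup_ubound; left. Qed.

Lemma slope_stop_le : (T <= a)%E.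
Proof.
by apply: ge_ereal_sup => _ [->|[t [[_ ta] _] <-]]; exact: ltW.
Qed.

Lemma ray_slope_stop : ray T `<=` ray a.
Proof. by move=> t [t0 tT]; split => //; exact: lt_le_trans slope_stop_le. Qed.

(** A supremum only provides some later time of positive slope; a curve that had met a zero slope
    before would have stayed there. *)
Lemma slope_gt0 t : ray T t -> (0 < local_slope f (u t))%E.
Proof.
move=> Tt; have [t0 /ereal_sup_gt[_ [->|[t' [at' slope']] <-]]] := Tt.
  by rewrite lte_fin ltNge t0.
rewrite lte_fin => tt'; rewrite lt_neqAle local_slope_ge0 andbT.
apply: contraTneq slope' => /esym slope0.
have := steepest_stationary f_gtNy u0_dom lambda_lt0 p0_gt1 f_convex p_gt1 p_le
  st_u t0 (ltW tt') at' slope0.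
by move=> ->; rewrite slope0 ltxx.
Qed.

(** By lower semicontinuity a positive slope at [r] would persist for a while after [r], hence
    beyond [T]. The case that matters is [r = T]. *)
Lemma slope_eq0 r : ray a r -> (T <= r%:E)%E -> local_slope f (u r) = 0%E.
Proof.
move=> ar Tr; apply/eqP; rewrite eq_le local_slope_ge0 andbT leNgt; apply/negP => sr.
have [ug u00 fu _] := st_u.
have dr := curve_dom u0_dom u00 fu ar.
have /nbhs_ballP[e /= e0 eV] :=
  local_slope_lsc f_gtNy lambda_lt0 p0_gt1 f_convex f_lsc dr (lexx 0) sr.
have [d d0 dE] := speed_continuous ug ar e0.
have [n [rn an]] := ray_rat_seq ar.
pose s := Num.min (r + d / 2) (rat_seq n).
have rs : r < s by rewrite lt_min rn ltrDl divr_gt0.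
have r0 : 0 <= r by case: ar.
have as_ : ray a s.
  by apply: ray_le an; [exact: le_trans (ltW rs)|rewrite ge_min lexx orbT].
have : (s%:E <= T)%E.
  apply: ereal_sup_ubound; right; exists s => //; split => //.
  apply: eV; rewrite ballEmdist/=; apply: dE => //.
  rewrite gtr0_norm ?subr_gt0// ltrBlDl (@le_lt_trans _ _ (r + d / 2))//.
    by rewrite ge_min lexx.
  by rewrite ltrD2l gtr_pMr// invf_lt1// ltr1n.
by move=> /le_trans/(_ Tr); rewrite lee_fin leNgt rs.
Qed.

(** Positivity and lower semicontinuity give local bounds, made uniform by compactness of
    [[0, t]]. *)
Lemma slope_lower_bound t : ray T t ->
  exists2 c : R, 0 < c & forall s, 0 <= s -> s <= t -> (c%:E < local_slope f (u s))%E.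
Proof.
move=> Tt; have [ug u00 fu _] := st_u.
have /compact_near_coveringP cov := @segment_compact R 0 t.
have {cov} := cov R (0^'+) (fun c s => 0 <= s -> s <= t -> (c%:E < local_slope f (u s))%E).
have step x : `[0, t]%classic x -> \forall x' \near x & c \near 0^'+,
    0 <= x' -> x' <= t -> (c%:E < local_slope f (u x'))%E.
  rewrite /= in_itv/= => /andP[x0 xt].
  have Tx := ray_le x0 xt Tt; have ax := ray_slope_stop Tx.
  have dx := curve_dom u0_dom u00 fu ax.
  have [c c0 cx] : exists2 c : R, 0 < c & (c%:E < local_slope f (u x))%E.
    move: (slope_gt0 Tx); case: (local_slope f (u x)) => [s| |//]; last first.
      by exists 1; rewrite ?ltry.
    by rewrite lte_fin => s0; exists (s / 2); rewrite ?lte_fin; lra.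
  have /nbhs_ballP[e /= e0 eV] :=
    local_slope_lsc f_gtNy lambda_lt0 p0_gt1 f_convex f_lsc dx (ltW c0) cx.
  have [d d0 dE] := speed_continuous ug ax e0.
  exists (ball x d, [set c' : R | c' < c]) => /=.
    by split; [exact: nbhsx_ballx|exact: nbhs_right_lt].
  move=> [x' c'] /= [xx' c'c] x'0 x't.
  apply: (@lt_trans _ _ c%:E); rewrite ?lte_fin//.
  apply: eV; rewrite ballEmdist/=; apply: dE; last by rewrite distrC.
  exact: ray_slope_stop (ray_le x'0 x't Tt).
move=> /(_ _ step) cov.
near (0 : R)^'+ => c.
exists c => // s s0 st.
have cov_c : `[0, t]%classic `<=` (fun s => 0 <= s -> s <= t -> (c%:E < local_slope f (u s))%E).
  by near: c; exact: cov.
by apply: cov_c => //=; rewrite in_itv/= s0.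
Unshelve. all: by end_near. Qed.

Lemma slope_stop_steepest_gt0 : {ae mu, forall t, ray T t -> 0 < g t}.
Proof.
have [[_ g0 _ _ _] _ _ fu'] := st_u.
apply: ae_mono fu' => t fut Tt; have [slopeE _] := fut (ray_slope_stop Tt).
have := slope_gt0 Tt; rewrite slopeE lte_fin; apply: gt0_powR => //.
by rewrite subr_gt0.
Qed.

Variable p' : R.
Hypothesis p'_gt1 : 1 < p'.
Local Notation al := (alpha p p').

Lemma alpha_lt1 : al < 1.
Proof.
by rewrite alphaE// ltrBlDr ltrDl divr_gt0// subr_gt0.
Qed.

(** A real power suffices: [epowR] differs from it only at speed 0, which before the stopping time
    is met on a null set. *)
Definition clock_density (r : R) := g r `^ al.

Lemma measurable_clock_density : measurable_fun [set: R] clock_density.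
Proof.
have [[mg _ _ _ _] _ _ _] := st_u.
exact: (measurableT_comp (measurable_powR al)).
Qed.

Lemma clock_density_ge0 r : 0 <= clock_density r.
Proof. exact: powR_ge0. Qed.

Lemma clock_density_gt0 : {ae mu, forall t, ray T t -> 0 < clock_density t}.
Proof.
by apply: ae_mono slope_stop_steepest_gt0 => t gt Tt; rewrite powR_gt0// gt.
Qed.

(* If [alpha p p' < 0], the density is bounded because the slope, hence the speed,
   is bounded away from 0 on [0, t]. *)
Lemma clock_density_integrable t : ray T t ->
  mu.-integrable `[0, t] (EFin \o clock_density).
Proof.
move=> Tt; have at_ := ray_slope_stop Tt.
have [[mg g0 ig _ _] u00 fu fu'] := st_u.
have mk : measurable_fun `[0, t] clock_density.
  exact: measurable_funTS measurable_clock_density.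
have bound (h : R -> R) : mu.-integrable `[0, t] (EFin \o h) ->
    {ae mu, forall s, `[0, t]%classic s -> clock_density s <= h s} ->
    mu.-integrable `[0, t] (EFin \o clock_density).
  move=> /integrableP[mh ih] kh; apply/integrableP; split; first exact/measurable_EFinP.
  apply: le_lt_trans ih; apply: ae_ge0_le_integral => //.
  - by apply: measurableT_comp => //; exact/measurable_EFinP.
  - exact: measurableT_comp.
  - apply: ae_mono kh => s khs ts; rewrite /= lee_fin ger0_norm ?clock_density_ge0//.
    by rewrite (le_trans (khs ts))// ler_norm.
(* For [0 <= al < 1] the power [x ^ al] is at most [1 + x]. *)
have [al0|al0] := leP 0 al.
  apply: (bound (fun s => 1 + g s)).
    have := @integrableD _ _ R mu `[0, t]%classic (measurable_itv _) _ _
      (integrable_itv_cst 1 0 t) (ig t at_).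
    by apply: eq_integrable.
  apply: aeW => s _; rewrite /clock_density.
  have [g1|g1] := leP 1 (g s).
    by rewrite (le_trans (ler1_powR g1 (ltW alpha_lt1)))// lerDr.
  rewrite (@le_trans _ _ 1)// ?lerDl//.
  have [->|gn0] := eqVneq (g s) 0; first by rewrite /powR eqxx; case: eqP.
  have gs01 : 0 < g s <= 1 by rewrite (ltW g1) andbT lt_neqAle eq_sym gn0 g0.
  by rewrite -(powRr0 (g s)) ger_powR.
have [c c0 cP] := slope_lower_bound Tt.
pose m := c `^ (p - 1)^-1.
have m0 : 0 < m by rewrite powR_gt0.
apply: (bound (cst (m `^ al))); first exact: integrable_itv_cst.
apply: ae_mono fu' => s fus; rewrite /= in_itv/= => /andP[s0 st].
have [slopeE _] := fus (ray_le s0 st at_).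
have := cP s s0 st; rewrite slopeE lte_fin => cg.
have mg_le : m <= g s.
  rewrite /m; have -> : g s = (g s `^ (p - 1)) `^ (p - 1)^-1.
    by rewrite -powRrM mulfV ?powRr1// subr_eq0 gt_eqF.
  apply: ge0_ler_powR; rewrite ?nnegrE ?powR_ge0 ?(ltW c0) ?(ltW cg)//.
  by rewrite invr_ge0 subr_ge0 ltW.
have gs0 : 0 < g s by exact: lt_le_trans mg_le.
have alE x : x `^ al = (x `^ (- al))^-1 by rewrite powRN invrK.
rewrite /clock_density !alE lef_pV2 ?posrE ?powR_gt0//.
by apply: ge0_ler_powR; rewrite ?oppr_ge0 ?nnegrE ?(ltW al0) ?(ltW m0) ?(ltW gs0).
Qed.

Local Notation sigma := (new_clock clock_density).
Local Notation b := (\int[mu]_(r in ray T) (clock_density r)%:E)%E.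

Variable tau : R -> R.
Hypothesis tauK : forall t, ray T t -> tau (sigma t) = t.
Hypothesis T_gt0 : (0 < T)%E.

Let mk := measurable_clock_density.
Let k0 := clock_density_ge0.
Let ik := clock_density_integrable.
Let kpos := clock_density_gt0.
Let T0 : ray T 0. Proof. by split. Qed.
Let surj := new_clock_surj mk k0 ik.
Let tau_ray := old_clock_ray mk k0 ik tauK.
Let sigmaK := old_clockK mk k0 ik tauK.
Let tau_le := old_clock_le mk k0 ik kpos tauK.

Let tau0 : tau 0 = 0.
Proof. by rewrite -{1}(new_clock0 clock_density) tauK. Qed.

Lemma new_horizon_gt0 : (0 < b)%E.
Proof.
have [] := new_clock_ray mk k0 ik kpos T0.
by rewrite new_clock0.
Qed.

(** The old speed times the derivative [g ^ (- al)] of [tau], cut off to [[0, b[] because [tau] is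
    controlled only there. *)
Definition new_speed (s : R) : R := ((fun s => g (tau s) `^ (1 - al)) \_ (ray b)) s.

Let measurable_tau : measurable_fun (ray b) tau.
Proof.
apply: measurable_fun_ray => s bs; have [t Tt <-] := surj bs.
have t0 : 0 <= t by case: Tt.
have := measurable_old_clock mk k0 ik kpos tauK (lexx 0) t0 Tt.
by rewrite new_clock0.
Qed.

Let al_gt0 : 0 < 1 - al. Proof. by rewrite subr_gt0 alpha_lt1. Qed.

Let speed_cancel r : g r `^ (1 - al) * clock_density r = g r.
Proof.
have [[_ g0 _ _ _] _ _ _] := st_u.
rewrite /clock_density; have [->|gr] := eqVneq (g r) 0.
  by rewrite powR0 ?mul0r// gt_eqF.
rewrite -powRD ?subrK ?powRr1//; apply/implyP => _; exact: gr.
Qed.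

Let new_speedE s : ray b s -> new_speed s = g (tau s) `^ (1 - al).
Proof. by move=> bs; rewrite /new_speed patchE mem_set. Qed.

Let integral_new_speed s1 s2 : 0 <= s1 -> s1 <= s2 -> ray b s2 ->
  (\int[mu]_(s in `[s1, s2]) (new_speed s)%:E =
   \int[mu]_(t in `[tau s1, tau s2]) (g t)%:E)%E.
Proof.
move=> s10 s12 bs2; have bs1 := ray_le s10 s12 bs2.
have [[mg g0 _ _ _] _ _ _] := st_u.
have mh : measurable_fun [set: R] (fun r => g r `^ (1 - al)).
  exact: (measurableT_comp (measurable_powR (1 - al))).
have := integral_old_clock mk k0 ik kpos tauK (tau_ray bs1).1
  (tau_le bs2 s10 s12) (tau_ray bs2) mh (fun r => powR_ge0 _ _).
rewrite !sigmaK// => h; transitivity (\int[mu]_(s in `[s1, s2]) (g (tau s) `^ (1 - al))%:E)%E.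
  apply: eq_integral => s /set_mem/=; rewrite in_itv/= => /andP[s1s ss2].
  by rewrite new_speedE//; exact: ray_le (le_trans s10 s1s) ss2 bs2.
by rewrite h; apply: eq_integral => t _; rewrite speed_cancel.
Qed.

Lemma reparam_has_speed : has_speed b (u \o tau) new_speed.
Proof.
have [[mg g0 ig dg du] _ _ _] := st_u.
have m_speed : measurable_fun [set: R] new_speed.
  apply/(measurable_restrictT _ _).1; first exact: measurable_ray.
  have mgt : measurable_fun (ray b) (g \o tau) by exact: measurableT_comp.
  exact: (measurableT_comp (measurable_powR (1 - al)) mgt).
have speed0 r : 0 <= new_speed r.
  by rewrite /new_speed patchE; case: ifP => // _; exact: powR_ge0.
have int_speed s : ray b s -> mu.-integrable `[0, s] (EFin \o new_speed).
  move=> bs; have Tt := tau_ray bs.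
  apply/integrableP; split; first by apply/measurable_EFinP; exact: measurable_funTS.
  under eq_integral do rewrite gee0_abs ?lee_fin//.
  rewrite integral_new_speed//; last by case: bs.
  have /integrableP[_] : mu.-integrable `[tau 0, tau s] (EFin \o g).
    by rewrite tau0; exact: ig (ray_slope_stop Tt).
  by under eq_integral do rewrite gee0_abs ?lee_fin//.
split => //.
- move=> s1 s2 s10 s12 bs2; have bs1 := ray_le s10 s12 bs2.
  have at2 := ray_slope_stop (tau_ray bs2).
  have tle := tau_le bs2 s10 s12.
  apply: le_trans (dg _ _ (tau_ray bs1).1 tle at2) _.
  rewrite -lee_fin !EFin_Rintegral//.
  + by rewrite integral_new_speed.
  + exact: integrable_subitv (int_speed _ bs2) _ _.
  + exact: integrable_subitv (ig _ at2) (tau_ray bs1).1 _.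
- have good : {ae mu, forall t, ray T t ->
      mdist (u t) (u s) / `|t - s| @[s --> t^'] --> g t}.
    by apply: ae_mono du => t dut Tt; exact/dut/ray_slope_stop.
  apply: ae_mono2 (ae_old_clock mk k0 ik kpos tauK good)
    (ae_is_derive_old_clock mk k0 ik kpos tauK) => s goods dtau bs.
  have [kt /is_derive_quotientP/cvg_norm dt tau_nbhs] := dtau bs.
  have := cvg_comp _ _ tau_nbhs (goods bs) => dut.
  (* The metric quotient in new time is the one in old time multiplied by the quotient of [tau]; the
     factorization needs [tau x != tau s] near [s]. *)
  have lim : mdist (u (tau s)) (u (tau x)) / `|tau s - tau x| *
      `|(tau x - tau s) / (x - s)| @[x --> s^'] --> new_speed s.
    have -> : new_speed s = g (tau s) * `|(clock_density (tau s))^-1|.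
      rewrite ger0_norm ?invr_ge0 ?(ltW kt)// new_speedE//.
      by rewrite -{2}(speed_cancel (tau s)) mulfK// gt_eqF.
    exact: cvgM dut dt.
  apply: cvg_trans lim; apply: near_eq_cvg; near=> x => /=.
  have tx : tau x != tau s.
    by near: x; exact: (tau_nbhs _ (nbhs_dnbhs_neq (tau s))).
  rewrite normrM normfV (distrC (tau s)) (distrC s) mulrA mulfVK//.
  by rewrite normr_eq0 subr_eq0.
Unshelve. all: by end_near. Qed.

(** Two identities of exponents: [p - 1 = (1 - al) * (p' - 1)] for the slope, and
    [p - al = (1 - al) * p'] for the energy, whose derivative the chain rule multiplies by
    [g ^ (- al)]. *)
Lemma steepest_reparam : steepest f p' b u0 (u \o tau) new_speed.
Proof.
have [[mg g0 ig dg du] u00 fu fu'] := st_u.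
split; first exact: reparam_has_speed.
- by rewrite /= tau0.
- move=> s t bs bt st; apply: fu; [exact/ray_slope_stop/tau_ray..|].
  by apply: tau_le => //; case: bs.
- have good : {ae mu, forall t, ray T t -> local_slope f (u t) = (g t `^ (p - 1))%:E /\
      is_derive t (1 : R) (fine \o f \o u) (- g t `^ p)}.
    by apply: ae_mono fu' => t fut Tt; exact/fut/ray_slope_stop.
  apply: ae_mono2 (ae_old_clock mk k0 ik kpos tauK good)
    (ae_is_derive_old_clock mk k0 ik kpos tauK) => s goods dtau bs.
  have [kt dt _] := dtau bs; have [slopeE dF] := goods bs.
  have gt0 : 0 < g (tau s).
    rewrite lt_neqAle eq_sym g0 andbT.
    have := slope_gt0 (tau_ray bs); rewrite slopeE lte_fin => h; apply/eqP => g_0.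
    by move: h; rewrite g_0 powR0 ?ltxx// subr_eq0 gt_eqF.
  have p'1 : p' - 1 != 0 by rewrite subr_eq0 gt_eqF.
  rewrite new_speedE// -!powRrM; split.
    rewrite slopeE; congr (_ `^ _)%:E; rewrite alphaE//.
    by field.
  have := is_derive1_comp dF dt; rewrite (_ : - _ * _ = - g (tau s) `^ ((1 - al) * p'))//.
  rewrite mulNr /clock_density -powRN -powRD; last first.
    by apply/implyP => _; rewrite gt_eqF.
  by congr (- (_ `^ _)); rewrite alphaE//; field.
Qed.

(** [(1 - alpha p p') * alpha p' p = - alpha p p'], so substitution turns the integrand into
    [g ^ (- al) * g ^ al = 1]. Thus [tau] is determined by the new speed alone. *)
Lemma reparam_old_clock s : ray b s ->
  (\int[mu]_(r in `[0%R, s]) (new_speed r `^ alpha p' p)%:E = (tau s)%:E)%E.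
Proof.
move=> bs; have Tt := tau_ray bs; have s0 : 0 <= s by case: bs.
have [[mg g0 _ _ _] _ _ _] := st_u.
have mh : measurable_fun [set: R] (fun r => g r `^ (- al)).
  exact: (measurableT_comp (measurable_powR (- al))).
have := integral_old_clock mk k0 ik kpos tauK (lexx 0) Tt.1 Tt mh (fun r => powR_ge0 _ _).
rewrite new_clock0 sigmaK// => h.
transitivity (\int[mu]_(r in `[0%R, s]) (g (tau r) `^ (- al))%:E)%E.
  apply: eq_integral => r /set_mem/=; rewrite in_itv/= => /andP[r0 rs].
  rewrite new_speedE; last exact: ray_le rs bs.
  rewrite -powRrM; congr (_ `^ _)%:E; rewrite !alphaE//; field.
  by rewrite !subr_eq0 !gt_eqF.
rewrite h; transitivity (\int[mu]_(t in `[0%R, tau s]) cst 1%E t)%E.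
  apply: ge0_ae_eq_integral => //.
  - have mprod : measurable_fun [set: R] (fun t => g t `^ (- al) * clock_density t).
      by apply: measurable_funM => //; exact: measurable_clock_density.
    by apply/measurable_EFinP; exact: (measurable_funTS mprod).
  - by move=> x _; rewrite lee_fin mulr_ge0 ?powR_ge0// clock_density_ge0.
  - apply: ae_mono kpos => t kt tt; rewrite powRN mulVf// gt_eqF// kt//.
    by move: tt; rewrite /= in_itv/= => /andP[t0 tt]; exact: ray_le tt Tt.
rewrite integral_cst//= mul1e lebesgue_measure_itv/= lte_fin.
case: ltP => [_|t0]; first by rewrite oppr0 adde0.
by congr EFin; apply/eqP; rewrite eq_le; case: Tt => -> _; rewrite t0.
Qed.

End fixed_curve.
End stop.

(** * Prolongation and uniqueness *)

Section restriction_and_limits.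
Context {R : realType} {S : completeMetricType R}.
Local Notation mu := (@lebesgue_measure R).
Variables (f : S -> \bar R) (p0 lambda : R) (u0 : S).
Hypotheses (f_gtNy : forall v, f v != -oo%E) (f_lsc : lower_semicontinuous f).
Hypotheses (u0_dom : dom f u0) (lambda_lt0 : lambda < 0) (p0_gt1 : 1 < p0).
Hypothesis f_convex : plambda_convex f p0 lambda.
Implicit Types (a : \bar R) (u v : R -> S) (g : R -> R) (p : R).

Lemma ray_sub a a' : (a' <= a)%E -> ray a' `<=` ray a.
Proof. by move=> a'a t [t0 ta']; split => //; exact: lt_le_trans a'a. Qed.

Lemma steepest_restrict p a a' u g : (a' <= a)%E ->
  steepest f p a u0 u g -> steepest f p a' u0 u g.
Proof.
move=> /ray_sub a'a [[mg g0 ig dg du] u00 fu fu'].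
split; first split => //.
- by move=> t /a'a; exact: ig.
- by move=> s t s0 st /a'a; exact: dg.
- by apply: ae_mono du => t dut /a'a.
- by [].
- by move=> s t /a'a as_ /a'a; exact: fu.
- by apply: ae_mono fu' => t fut /a'a.
Qed.

Lemma steepest_eq_ray p a u v g : (0 < a)%E -> (forall t, ray a t -> u t = v t) ->
  steepest f p a u0 u g -> steepest f p a u0 v g.
Proof.
move=> a0 uv [[mg g0 ig dg du] u00 fu fu'].
have near_eq t : ray a t -> t != 0 -> \forall s \near t, u s = v s.
  move=> at_ t0; have {}t0 : 0 < t by rewrite lt_neqAle eq_sym t0; case: at_.
  by have := ray_nbhs at_ t0; apply: filterS.
split; first split => //.
- move=> s t s0 st at_; have as_ := ray_le s0 st at_.
  by rewrite -!uv// dg.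
- apply: ae_mono2 (ae_neq 0) du => t t0 dut at_; have nuv := near_eq t at_ t0.
  apply: cvg_trans (dut at_); apply: near_eq_cvg; near=> s.
  have us : u s = v s by near: s; exact: nbhs_dnbhs.
  by rewrite us uv.
- by rewrite -u00 uv//; split.
- by move=> s t as_ at_; rewrite -!uv//; exact: fu.
- apply: ae_mono2 (ae_neq 0) fu' => t t0 fut at_; have nuv := near_eq t at_ t0.
  have [slopeE /is_derive_quotientP dF] := fut at_; rewrite -uv//; split => //.
  apply/is_derive_quotientP; apply: cvg_trans dF; apply: near_eq_cvg; near=> s.
  have us : u s = v s by near: s; exact: nbhs_dnbhs.
  by rewrite /= us uv.
Unshelve. all: by end_near. Qed.

Lemma steepest_const p a : 1 < p -> (0 < a)%E -> local_slope f u0 = 0%E ->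
  steepest f p a u0 (fun=> u0) (fun=> 0).
Proof.
move=> p1 a0 slope0; split; first split => //.
- by move=> b _; exact: integrable0.
- by move=> s t _ _ _; rewrite mdistxx Rintegral_ge0.
- apply: aeW => t at_; apply: cvg_near_cst; near=> s.
  by rewrite mdistxx mul0r.
- by [].
- by [].
- have pn0 : p != 0 by rewrite gt_eqF// (lt_trans _ p1).
  have pn1 : p - 1 != 0 by rewrite subr_eq0 gt_eqF.
  apply: aeW => t at_; rewrite !powR0// slope0 oppr0.
  by split => //; exact: is_derive_cst.
Unshelve. all: by end_near. Qed.

(** Stated for a filter to serve both limits at [+oo] and limits from the left at a finite time. A
    larger value at [z] would, by lower semicontinuity, contradict monotonicity. *)
Lemma steepest_limit_le [F : set_system R] {FF : ProperFilter F} p a u g z :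
  steepest f p a u0 u g -> (\forall x \near F, ray a x) ->
  (forall t, ray a t -> \forall x \near F, t <= x) -> u @ F --> z ->
  forall t, ray a t -> (f z <= f (u t))%E.
Proof.
move=> [_ u00 fu _] Fray Fle uz t at_; rewrite leNgt; apply/negP => ftz.
have dt := curve_dom u0_dom u00 fu at_.
have [V zV Vf] : exists2 V, nbhs z V & forall y, V y -> (f (u t) < f y)%E.
  have := ftz; rewrite (dom_fine f_gtNy dt) => /f_lsc[V zV Vf].
  by exists V.
have near_t := Fle t at_.
have near_V : \forall x \near F, V (u x) := uz V zV.
near F => x.
have : (f (u t) < f (u x))%E by apply: Vf; near: x.
by rewrite ltNge fu//; near: x.
Unshelve. all: by end_near. Qed.

(** A positive slope at [z] would, by lower semicontinuity, keep the speed above some [d > 0] at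
    late times; losing at least [d ^ p] per unit of time, the energy would fall below [f z]. *)
Lemma steepest_limit_slope p u g z : 1 < p -> p <= p0 ->
  steepest f p +oo u0 u g -> u @ +oo --> z -> local_slope f z = 0%E.
Proof.
move=> p1 pp0 st_u uz.
have rayy (t : R) : 0 <= t -> ray +oo t by move=> t0; split; rewrite ?ltry.
have [_ u00 fu fu'] := st_u.
have fz := steepest_limit_le (F := pinfty_nbhs R) st_u _ _ uz.
have {}fz t : 0 <= t -> (f z <= f (u t))%E.
  move=> t0; apply: fz => //; last exact: rayy.
    by near=> x; apply: rayy; near: x; apply: nbhs_pinfty_ge; exact: num_real.
  by move=> s _; apply: nbhs_pinfty_ge; exact: num_real.
have dz : dom f z.
  apply: le_lt_trans (fz 0 (lexx 0)) _; rewrite u00; exact: u0_dom.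
apply/eqP; rewrite eq_le local_slope_ge0 andbT leNgt; apply/negP => slope_z.
have [c c0 cz] : exists2 c : R, 0 < c & (c%:E < local_slope f z)%E.
  move: slope_z; case: (local_slope f z) => [s| |//]; last by exists 1; rewrite ?ltry.
  by rewrite lte_fin => s0; exists (s / 2); rewrite ?lte_fin; lra.
have := local_slope_lsc f_gtNy lambda_lt0 p0_gt1 f_convex f_lsc dz (ltW c0) cz.
move=> /uz [M0 [_ Mc]].
pose M := Num.max 1 (M0 + 1).
have M_ge t : M <= t -> (c%:E < local_slope f (u t))%E.
  move=> Mt; apply: Mc; apply: lt_le_trans Mt.
  by rewrite lt_max ltrDl ltr01 orbT.
have M1 : 0 <= M by rewrite le_max ler01.
pose d := c `^ (p - 1)^-1.
have d0 : 0 < d by rewrite powR_gt0.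
have g_ge : {ae mu, forall t, M <= t -> d `^ p <= g t `^ p}.
  apply: ae_mono fu' => t fut Mt.
  have [slopeE _] := fut (rayy t (le_trans M1 Mt)).
  have := M_ge t Mt; rewrite slopeE lte_fin => cg.
  have [[_ g0 _ _ _] _ _ _] := st_u.
  apply: ge0_ler_powR; rewrite ?nnegrE ?(ltW d0)//; first by rewrite ltW// (lt_trans _ p1).
  rewrite /d; have -> : g t = (g t `^ (p - 1)) `^ (p - 1)^-1.
    by rewrite -powRrM mulfV ?powRr1// subr_eq0 gt_eqF.
  apply: ge0_ler_powR; rewrite ?nnegrE ?powR_ge0 ?(ltW c0) ?(ltW cg)//.
  by rewrite invr_ge0 subr_ge0 ltW.
have drop t : M <= t -> d `^ p * (t - M) <= fine (f (u 0)) - fine (f z).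
  move=> Mt; have t0 := le_trans M1 Mt.
  have := steepest_energy f_gtNy u0_dom st_u M1 Mt (rayy t t0).
  have dM := curve_dom u0_dom u00 fu (rayy M M1).
  have dt := curve_dom u0_dom u00 fu (rayy t t0).
  have d00 := curve_dom u0_dom u00 fu (rayy 0 (lexx 0)).
  have h1 : fine (f (u M)) <= fine (f (u 0)).
    rewrite -lee_fin -(dom_fine f_gtNy dM) -(dom_fine f_gtNy d00).
    by apply: fu => //; exact: rayy.
  have h2 : fine (f z) <= fine (f (u t)).
    by rewrite -lee_fin -(dom_fine f_gtNy dz) -(dom_fine f_gtNy dt) fz.
  have h3 : ((d `^ p * (t - M))%:E <= \int[mu]_(r in `[M, t]) (g r `^ p)%:E)%E.
    have -> : ((d `^ p * (t - M))%:E = \int[mu]_(r in `[M, t]) cst (d `^ p)%:E r)%E.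
      rewrite integral_cst//= lebesgue_measure_itv/= lte_fin.
      case: ltP => [_|tM]; first by rewrite -EFinB EFinM.
      have -> : t = M by apply: le_anti; rewrite tM.
      by rewrite subrr mulr0 mule0.
    apply: ae_ge0_le_integral => //.
    - by move=> x _; rewrite /= lee_fin powR_ge0.
    - by move=> x _; rewrite lee_fin powR_ge0.
    - have [[mg _ _ _ _] _ _ _] := st_u.
      have mgp : measurable_fun [set: R] (fun r => g r `^ p).
        exact: (measurableT_comp (measurable_powR p)).
      by apply/measurable_EFinP; exact: (measurable_funTS mgp).
    - apply: ae_mono g_ge => r hr; rewrite /= in_itv/= => /andP[Mr _].
      by rewrite lee_fin hr.
  by move=> /(le_trans h3); rewrite lee_fin; lra.
have dp0 : 0 < d `^ p by rewrite powR_gt0.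
have C0 := drop M (lexx M); rewrite subrr mulr0 in C0.
move: drop C0; set C := fine (f (u 0)) - fine (f z) => drop C0.
have Cd : 0 <= (C + 1) / d `^ p by rewrite divr_ge0 ?(ltW dp0)// ltW// ltr_wpDl.
(* At this time the drop would be at least [C + 1], while [C] bounds it. *)
have := drop (M + (C + 1) / d `^ p); rewrite lerDl Cd => /(_ isT).
rewrite (addrC M) addrK mulrC divfK ?gt_eqF//.
by rewrite leNgt ltrDl ltr01.
Unshelve. all: by end_near. Qed.

End restriction_and_limits.

Section prolongation.
Context {R : realType} {S : completeMetricType R}.
Local Notation mu := (@lebesgue_measure R).
Variables (f : S -> \bar R) (u0 : S).
Hypotheses (f_gtNy : forall v, f v != -oo%E) (f_lsc : lower_semicontinuous f).
Hypothesis u0_dom : dom f u0.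

Section fixed_curve.
Variables (p : R) (beta : R) (w : R -> S) (g : R -> R) (z : S).
Hypotheses (p_gt1 : 1 < p) (beta_gt0 : 0 < beta).
Hypothesis st_w : steepest f p beta%:E u0 w g.
Hypotheses (wz : w @ beta^'- --> z) (slope_z : local_slope f z = 0%E).

Let near_ray : \forall x \near beta^'-, ray beta%:E x.
Proof.
near=> x; split.
  by near: x; exact: nbhs_left_ge.
by rewrite lte_fin; near: x; exact: nbhs_left_lt.
Unshelve. all: by end_near. Qed.

Let near_le t : ray beta%:E t -> \forall x \near beta^'-, t <= x.
Proof. by case=> _; rewrite lte_fin => tb; exact: nbhs_left_ge. Qed.

Let fz t : ray beta%:E t -> (f z <= f (w t))%E.
Proof.
move=> bt; exact: (steepest_limit_le f_gtNy f_lsc u0_dom st_w near_ray near_le wz bt).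
Qed.

Let z_dom : dom f z.
Proof.
have [_ u00 _ _] := st_w; apply: le_lt_trans (fz _) _.
  by split; [exact: lexx|rewrite lte_fin].
by rewrite u00.
Qed.

Let speed := g \_ (ray beta%:E).
Let curve s := if s < beta then w s else z.

Let measurable_speed : measurable_fun [set: R] speed.
Proof.
have [[mg _ _ _ _] _ _ _] := st_w.
by apply/(measurable_restrictT _ (measurable_ray _)); exact: measurable_funTS mg.
Qed.

Let speed_ge0 r : 0 <= speed r.
Proof. by have [[_ g0 _ _ _] _ _ _] := st_w; rewrite /speed patchE; case: ifP. Qed.

Let speedE r : ray beta%:E r -> speed r = g r.
Proof. by move=> br; rewrite /speed patchE mem_set. Qed.

(** From [x <= 1 + x ^ p] and the energy inequality, [f z] bounding the energy from below: the curve
    has finite length up to [beta], so its speed extended by 0 is integrable across [beta]. *)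
Let speed_bound t : ray beta%:E t ->
  (\int[mu]_(r in `[0%R, t]) (g r)%:E <= (beta + (fine (f u0) - fine (f z)))%:E)%E.
Proof.
move=> bt; have [[mg g0 ig _ _] u00 fu _] := st_w.
have [t0 tb] := bt; rewrite lte_fin in tb.
have dt := curve_dom u0_dom u00 fu bt.
have := steepest_energy f_gtNy u0_dom st_w (lexx 0) t0 bt; rewrite u00 => energy.
have mgp : measurable_fun [set: R] (fun r => g r `^ p).
  exact: (measurableT_comp (measurable_powR p)).
apply: (@le_trans _ _ (\int[mu]_(r in `[0%R, t]) ((cst 1 r)%:E + (g r `^ p)%:E))%E).
  apply: ge0_le_integral => //.
  - by move=> r _; rewrite lee_fin.
  - by apply/measurable_EFinP; exact: (measurable_funTS mg).
  - have mgp1 : measurable_fun [set: R] (fun r => cst 1 r + g r `^ p).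
      exact: measurable_funD.
    by apply/measurable_EFinP; exact: (measurable_funTS mgp1).
  - move=> r _; rewrite -EFinD lee_fin /=.
    have [g1|/ltW g1] := leP (g r) 1.
      by rewrite (le_trans g1)// lerDl powR_ge0.
    by rewrite ler_wpDl// le1r_powR// ltW.
rewrite ge0_integralD//; first last.
- by apply/measurable_EFinP; exact: (measurable_funTS mgp).
- by move=> r _; rewrite lee_fin powR_ge0.
- by apply/measurable_EFinP.
rewrite EFinD leeD//.
  have -> : (\int[mu]_(r in `[0%R, t]) (cst 1 r)%:E = \int[mu]_(r in `[0%R, t]) cst 1 r)%E.
    by [].
  rewrite integral_cst//= mul1e lebesgue_measure_itv/= lte_fin.
  by case: ifP => _; rewrite ?oppr0 ?adde0 lee_fin ltW.
apply: le_trans energy _; rewrite lee_fin lerD2l lerN2 -lee_fin.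
by rewrite -(dom_fine f_gtNy z_dom) -(dom_fine f_gtNy dt) fz.
Qed.

Let integrable_speed t : mu.-integrable `[0, t] (EFin \o speed).
Proof.
suff h : mu.-integrable [set: R] (EFin \o speed) by exact: integrableS h.
have -> : EFin \o speed = (EFin \o g) \_ (ray beta%:E).
  by apply/funext => r; rewrite /speed /= !patchE; case: ifP.
apply/(@integrable_mkcond _ (measurableTypeR R) R mu _ _ (measurable_ray _)).
have [[mg g0 _ _ _] u00 _ _] := st_w.
apply/integrableP; split.
  by apply/measurable_EFinP; exact: (measurable_funTS mg).
apply: (@le_lt_trans _ _ (beta + (fine (f u0) - fine (f z)))%:E); last exact: ltry.
under eq_integral do rewrite gee0_abs ?lee_fin//.
apply: integral_ray_le => //.
apply: addr_ge0; first exact: ltW.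
have b0 : ray beta%:E 0 by split; [exact: lexx|rewrite lte_fin].
by rewrite subr_ge0 -lee_fin -(dom_fine f_gtNy z_dom) -(dom_fine f_gtNy u0_dom) -u00 fz.
Qed.

Let speed_dist s t : 0 <= s -> s <= t -> t < beta ->
  mdist (w s) (w t) <= \int[mu]_(r in `[s, t]) speed r.
Proof.
have [[_ _ _ dg _] _ _ _] := st_w.
move=> s0 st tb; have bt : ray beta%:E t by split; [exact: le_trans st|].
have := dg _ _ s0 st bt; congr (_ <= _); apply: eq_Rintegral => r /set_mem/=.
rewrite in_itv/= => /andP[sr rt]; rewrite speedE//.
by apply: ray_le rt bt; exact: le_trans sr.
Qed.

Lemma steepest_prolong : exists u g', steepest f p +oo u0 u g' /\
  (forall s, u s = if s < beta then w s else z).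
Proof.
have [[mg g0 ig dg du] u00 fu fu'] := st_w.
exists curve, speed; split; last by [].
have curve_near t : t < beta -> \forall x \near t, curve x = w x.
  by move=> tb; near=> x; rewrite /curve ifT//; near: x; exact: lt_nbhsl.
have curve_near' t : beta < t -> \forall x \near t, curve x = z.
  move=> tb; near=> x; rewrite /curve ifF//; apply/negbTE; rewrite -leNgt ltW//.
  by near: x; exact: lt_nbhsr.
have curvel t : t < beta -> curve t = w t by rewrite /curve => ->.
have curver t : beta <= t -> curve t = z by rewrite /curve ltNge => ->.
have speedr t : beta <= t -> speed t = 0.
  rewrite /speed patchE => bt; rewrite ifF//; apply/negbTE/negP => /set_mem[_].
  by rewrite lte_fin ltNge bt.
have p0 : p != 0 by rewrite gt_eqF// (lt_trans _ p_gt1).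
have p1 : p - 1 != 0 by rewrite subr_eq0 gt_eqF.
split; first split => //.
- move=> s t s0 st _; have [tb|bt] := ltP t beta.
    by rewrite !curvel//; [exact: speed_dist|exact: le_lt_trans tb].
  rewrite (curver t)//; have [sb|bs] := ltP s beta; last first.
    by rewrite curver// mdistxx Rintegral_ge0.
  (* Across [beta] the distance to [z] is approximated by the distance to [w x] with [x] just before
     [beta]. *)
  rewrite curvel//; apply/ler_addgt0Pr => e e0.
  have near_z : \forall x \near beta^'-, mdist z (w x) < e := wz (mdist_cvg0 z e0).
  near beta^'- => x.
  have sx : s <= x by near: x; exact: nbhs_left_ge.
  have xb : x < beta by near: x; exact: nbhs_left_lt.
  have zx : mdist z (w x) < e by near: x.
  apply: le_trans (metric_triangle _ (w x) _) _; rewrite (metric_sym _ z).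
  apply: lerD (ltW zx); apply: le_trans (speed_dist s0 sx xb) _.
  apply: Rintegral_itv_le => //; last exact: le_trans (ltW xb) bt.
  exact: integrable_subitv (integrable_speed t) s0 (lexx _).
- apply: ae_mono2 (ae_neq beta) du => t tb dut [t0 _].
  have [{}tb|bt] := ltP t beta.
    have bt : ray beta%:E t by [].
    have nuv := curve_near t tb.
    rewrite speedE//; apply: cvg_trans (dut bt); apply: near_eq_cvg; near=> s.
    have us : curve s = w s by near: s; exact: nbhs_dnbhs.
    by rewrite us curvel.
  have {}tb : beta < t by rewrite lt_neqAle eq_sym tb.
  have nuv := curve_near' t tb.
  rewrite speedr//; apply: cvg_near_cst; near=> s.
  have us : curve s = z by near: s; exact: nbhs_dnbhs.
  by rewrite us curver// mdistxx mul0r.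
- by rewrite curvel.
- move=> s t [s0 _] [t0 _] st; have [tb|bt] := ltP t beta.
    have sb := le_lt_trans st tb.
    by rewrite !curvel//; apply: fu.
  rewrite (curver t)//; have [sb|bs] := ltP s beta; last by rewrite curver.
  by rewrite curvel//; apply: fz.
- apply: ae_mono2 (ae_neq beta) fu' => t tb fut [t0 _].
  have [{}tb|bt] := ltP t beta.
    have bt : ray beta%:E t by [].
    have nuv := curve_near t tb.
    have [slopeE /is_derive_quotientP dF] := fut bt.
    rewrite speedE// curvel//; split => //.
    apply/is_derive_quotientP; apply: cvg_trans dF; apply: near_eq_cvg; near=> s.
    have us : curve s = w s by near: s; exact: nbhs_dnbhs.
    by rewrite /= us curvel.
  have {}tb : beta < t by rewrite lt_neqAle eq_sym tb.
  have nuv := curve_near' t tb.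
  rewrite speedr// !powR0// curver// slope_z oppr0; split => //.
  apply/is_derive_quotientP; apply: cvg_near_cst; near=> s.
  have us : curve s = z by near: s; exact: nbhs_dnbhs.
  by rewrite /= us curver// subrr mul0r.
Unshelve. all: by end_near. Qed.

End fixed_curve.
End prolongation.

Section uniqueness.
Context {R : realType} {S : completeMetricType R}.
Local Notation mu := (@lebesgue_measure R).
Variables (f : S -> \bar R) (p0 lambda : R) (u0 : S).
Hypotheses (f_gtNy : forall v, f v != -oo%E) (f_lsc : lower_semicontinuous f).
Hypotheses (u0_dom : dom f u0) (lambda_lt0 : lambda < 0) (p0_gt1 : 1 < p0).
Hypothesis f_convex : plambda_convex f p0 lambda.

Lemma steepest_speed_unique p a u v g h : steepest f p a u0 u g ->
  steepest f p a u0 v h -> (forall t, ray a t -> u t = v t) ->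
  {ae mu, forall t, ray a t -> g t = h t}.
Proof.
move=> st_u st_v uv; have [[_ _ _ _ dv] _ _ _] := st_v.
have [a0|a0] := leP a 0%E.
  by apply: aeW => t [t0 /lt_le_trans/(_ a0)]; rewrite lte_fin ltNge t0.
have [[_ _ _ _ du] _ _ _] := steepest_eq_ray a0 uv st_u.
by apply: ae_mono2 du dv => t ut vt at_; exact: cvg_unique (ut at_) (vt at_).
Qed.

Section fixed_exponent.
Variables (a : \bar R) (p : R).
Hypotheses (a_gt0 : (0 < a)%E) (p_gt1 : 1 < p) (p_le : p <= p0).

Lemma new_clock_inj u g p' : 1 < p' -> steepest f p a u0 u g ->
  {in ray (slope_stop f a u) &, injective (new_clock (clock_density g p p'))}.
Proof.
move=> p'1 st_u s t /set_mem Ts /set_mem Tt.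
have ik := clock_density_integrable f_gtNy f_lsc u0_dom lambda_lt0 p0_gt1 f_convex
  a_gt0 p_gt1 p_le st_u p'1.
have kpos := clock_density_gt0 f_gtNy u0_dom lambda_lt0 p0_gt1 f_convex
  a_gt0 p_gt1 p_le st_u p'.
have k0 := clock_density_ge0 g p p'.
have [s0 _] := Ts; have [t0 _] := Tt; move=> e; apply/eqP.
have [st|ts|//] := ltgtP s t.
  by have := new_clock_lt k0 ik kpos s0 st Tt; rewrite e ltxx.
by have := new_clock_lt k0 ik kpos t0 ts Ts; rewrite e ltxx.
Qed.

(* Past its stopping time a curve is constant. *)
Lemma steepest_agree_after u v g h : steepest f p a u0 u g -> steepest f p a u0 v h ->
  (forall t, ray (slope_stop f a u) t -> u t = v t) ->
  forall t, ray a t -> u t = v t.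
Proof.
move=> st_u st_v uv t at_; have [tT|Tt] := ltP t%:E (slope_stop f a u).
  by apply: uv; split => //; case: at_.
have T0 := slope_stop_ge0 f a u.
have Ta := slope_stop_le f u a_gt0.
have [ug u00 _ _] := st_u; have [vh v00 _ _] := st_v.
move: uv Tt T0; case TE : (slope_stop f a u) => [r| |//] uv; last by rewrite leye_eq.
rewrite !lee_fin => rt r0; have ar := ray_le r0 rt at_.
have slope_u : local_slope f (u r) = 0%E.
  apply: (slope_eq0 f_gtNy f_lsc u0_dom lambda_lt0 p0_gt1 f_convex st_u ar).
  by rewrite TE.
have uvr : u r = v r.
  have [->|rn0] := eqVneq r 0; first by rewrite u00 v00.
  have {}rn0 : 0 < r by rewrite lt_neqAle eq_sym rn0.
  have ul := cvg_at_left_filter (speed_cvg ug ar rn0).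
  have vl := cvg_at_left_filter (speed_cvg vh ar rn0).
  apply: (cvg_unique (@metric_hausdorff R S) ul); apply: cvg_trans vl.
  apply: near_eq_cvg; near=> x; apply/esym/uv; split.
    by near: x; exact: nbhs_left_ge.
  by rewrite lte_fin; near: x; exact: nbhs_left_lt.
have stat := steepest_stationary f_gtNy u0_dom lambda_lt0 p0_gt1 f_convex p_gt1 p_le.
rewrite (stat _ _ _ _ _ st_u r0 rt at_ slope_u).
by rewrite (stat _ _ _ _ _ st_v r0 rt at_) -uvr.
Unshelve. all: by end_near. Qed.

Variable p' : R.
Hypotheses (p'_gt1 : 1 < p') (p'_le : p' <= p0).
Hypothesis p'_unique : forall b w1 w2 h1 h2, (0 < b)%E ->
  steepest f p' b u0 w1 h1 -> steepest f p' b u0 w2 h2 ->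
  forall t, ray b t -> w1 t = w2 t.

Let horizon u g := (\int[mu]_(r in ray (slope_stop f a u)) (clock_density g p p' r)%:E)%E.

(** Uniqueness is known for [p'] and wanted for [p]. The reparametrized curves agree on the shorter
    horizon, hence so do their speeds almost everywhere and, by [reparam_old_clock], their inverse
    clocks; undoing the clock gives [u = v] before the stopping time of [u]. *)
Let steepest_unique_le u v g h : steepest f p a u0 u g -> steepest f p a u0 v h ->
  (0 < slope_stop f a u)%E -> (0 < slope_stop f a v)%E ->
  (horizon u g <= horizon v h)%E ->
  forall t, ray a t -> u t = v t.
Proof.
move=> st_u st_v Tu Tv uv; apply: (steepest_agree_after st_u st_v) => t Tt.
pose tau w k := 'pinv_(fun=> 0) (ray (slope_stop f a w)) (new_clock (clock_density k p p')).
have tauK w k : steepest f p a u0 w k -> forall t, ray (slope_stop f a w) t ->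
    tau w k (new_clock (clock_density k p p') t) = t.
  by move=> st_w r Tr; apply: pinvKV (new_clock_inj p'_gt1 st_w) _ (mem_set Tr).
have st1 := steepest_reparam f_gtNy f_lsc u0_dom lambda_lt0 p0_gt1 f_convex
  a_gt0 p_gt1 p_le st_u p'_gt1 (tauK u g st_u) Tu.
have clock1 := reparam_old_clock f_gtNy f_lsc u0_dom lambda_lt0 p0_gt1 f_convex
  a_gt0 p_gt1 p_le st_u p'_gt1 (tauK u g st_u).
have st2 := steepest_reparam f_gtNy f_lsc u0_dom lambda_lt0 p0_gt1 f_convex
  a_gt0 p_gt1 p_le st_v p'_gt1 (tauK v h st_v) Tv.
have clock2 := reparam_old_clock f_gtNy f_lsc u0_dom lambda_lt0 p0_gt1 f_convex
  a_gt0 p_gt1 p_le st_v p'_gt1 (tauK v h st_v).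
have {}st2 := steepest_restrict uv st2.
have b0 := new_horizon_gt0 f_gtNy f_lsc u0_dom lambda_lt0 p0_gt1 f_convex
  a_gt0 p_gt1 p_le st_u p'_gt1 Tu.
have w12 := p'_unique b0 st1 st2.
have s12 := steepest_speed_unique st1 st2 w12.
have [[ms1 _ _ _ _] _ _ _] := st1; have [[ms2 _ _ _ _] _ _ _] := st2.
have tau12 s : ray (horizon u g) s -> tau u g s = tau v h s.
  move=> bs; have bs' := ray_sub uv bs.
  apply: EFin_inj; transitivity (\int[mu]_(r in `[0%R, s])
    (new_speed f a u g p p' (tau u g) r `^ alpha p' p)%:E)%E; first exact/esym/clock1.
  transitivity (\int[mu]_(r in `[0%R, s])
    (new_speed f a v h p p' (tau v h) r `^ alpha p' p)%:E)%E; last exact: clock2.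
  have mpow (k : R -> R) : measurable_fun [set: R] k ->
      measurable_fun `[0, s] (fun r => (k r `^ alpha p' p)%:E).
    move=> mk; have mkp : measurable_fun [set: R] (fun r => k r `^ alpha p' p).
      exact: (measurableT_comp (measurable_powR _)).
    by apply/measurable_EFinP; exact: (measurable_funTS mkp).
  apply: ge0_ae_eq_integral => //; [exact: mpow|exact: mpow|..].
  - by move=> r _; rewrite lee_fin powR_ge0.
  - by move=> r _; rewrite lee_fin powR_ge0.
  apply: ae_mono s12 => r r12; rewrite /= in_itv/= => /andP[r0 rs].
  by rewrite r12//; exact: ray_le rs bs.
have ik := clock_density_integrable f_gtNy f_lsc u0_dom lambda_lt0 p0_gt1 f_convex
  a_gt0 p_gt1 p_le st_u p'_gt1.
have kpos := clock_density_gt0 f_gtNy u0_dom lambda_lt0 p0_gt1 f_convex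
  a_gt0 p_gt1 p_le st_u p'.
have bt := new_clock_ray (measurable_clock_density st_u p') (clock_density_ge0 g p p')
  ik kpos Tt.
by have := w12 _ bt; rewrite /= -tau12// tauK.
Qed.

Lemma steepest_unique u v g h : steepest f p a u0 u g -> steepest f p a u0 v h ->
  forall t, ray a t -> u t = v t.
Proof.
move=> st_u st_v.
(* A stopping time 0 leaves no interval to reparametrize; being stationary from the start decides
   this case. *)
have stopped w1 w2 h1 h2 : steepest f p a u0 w1 h1 -> steepest f p a u0 w2 h2 ->
    (slope_stop f a w1 <= 0)%E -> forall t, ray a t -> w1 t = w2 t.
  move=> st1 st2 T0; apply: (steepest_agree_after st1 st2) => t [t0 tT].
  by have := lt_le_trans tT T0; rewrite lte_fin ltNge t0.
have [Tu|Tu] := leP (slope_stop f a u) 0%E; first exact: stopped st_u st_v Tu.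
have [Tv t at_|Tv] := leP (slope_stop f a v) 0%E.
  exact/esym/(stopped _ _ _ _ st_v st_u Tv t at_).
have /orP[uv|vu] := le_total (horizon u g) (horizon v h).
  exact: steepest_unique_le st_u st_v Tu Tv uv.
by move=> t at_; exact/esym/(steepest_unique_le st_v st_u Tv Tu vu at_).
Qed.

End fixed_exponent.
End uniqueness.

(** * Curves on rays, existence time and the image of the given curve *)

Section transform.
Context {R : realType} {S : completeMetricType R}.
Local Notation mu := (@lebesgue_measure R).
Variables (f : S -> \bar R) (p0 lambda : R) (u0 : S).
Hypotheses (f_gtNy : forall v, f v != -oo%E) (f_lsc : lower_semicontinuous f).
Hypotheses (u0_dom : dom f u0) (lambda_lt0 : lambda < 0) (p0_gt1 : 1 < p0).
Hypothesis f_convex : plambda_convex f p0 lambda.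

Lemma valL_sigL (A : set R) (v : R -> S) t : A t -> valL (sigL A v) t = v t.
Proof.
move=> At; transitivity ((valL_ point \o sigL A) v t) => //.
by rewrite sigLK patchE mem_set.
Qed.

Lemma valL_val (A : set R) (u : A -> S) (x : A) : valL u (val x) = u x.
Proof. by have := valLK point u; move/(congr1 (@^~ x)). Qed.

Lemma CMS_steepest p a u : 1 < p -> CMS f p a u0 u ->
  exists g, steepest f p a u0 (valL u) g.
Proof. by move=> p1 [_ cu]; exact: max_slope_curve_steepest cu. Qed.

Lemma steepest_CMS p a v g : 1 < p -> (0 < a)%E -> steepest f p a u0 v g ->
  CMS f p a u0 (sigL (ray a) v).
Proof.
move=> p1 a0 st_v; split => //; apply: (@steepest_max_slope_curve _ _ _ _ _ p1 _ _ g).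
by apply: steepest_eq_ray st_v => // t at_; rewrite valL_sigL.
Qed.

Lemma existence_time_ge p a v g : 1 < p -> (0 < a)%E -> steepest f p a u0 v g ->
  (a <= existence_time f p u0)%E.
Proof.
move=> p1 a0 st_v; apply: ereal_sup_ubound; right; split => //.
rewrite -(card_le_eql (card_set1 (x := sigL (ray a) v))).
by apply: subset_card_le => _ ->; exact: steepest_CMS st_v.
Qed.

Lemma existence_time_le p (b : \bar R) : (0 <= b)%E ->
  (forall a, (b < a)%E -> CMS f p a u0 = set0) -> (existence_time f p u0 <= b)%E.
Proof.
move=> b0 empty; apply: ge_ereal_sup => a [->//|[_ ca]].
rewrite leNgt; apply/negP => /empty a_empty; move: ca.
by rewrite a_empty card_le0 II1 => /eqP/seteqP[/(_ 0%N erefl)].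
Qed.

Section fixed_curve.
Variables (p p' : R) (u : ray (+oo%E : \bar R) -> S) (g : R -> R).
Hypotheses (p_gt1 : 1 < p) (p_le : p <= p0) (p'_gt1 : 1 < p').
Local Notation w := (valL u).
Hypothesis st_u : steepest f p +oo u0 w g.
Local Notation T := (stop_time f u).
Local Notation sigma := (new_clock (clock_density g p p')).
Local Notation b := (new_stop_time f p p' u).
Local Notation tau := (t_tilde f p p' u).

Let y_gt0 : (0 < +oo :> \bar R)%E. Proof. exact: ltry. Qed.

Let rayy (t : R) : 0 <= t -> ray +oo t.
Proof. by move=> t0; split; rewrite ?ltry. Qed.

Let epowR_ge0 x r : (0 <= epowR x r :> \bar R)%E.
Proof. by rewrite /epowR; case: ifP => //; rewrite lee_fin powR_ge0. Qed.

Let clock_densityE : {ae mu, forall t, ray T t ->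
  epowR (metric_derivative w t) (alpha p p') = (clock_density g p p' t)%:E}.
Proof.
have [[_ _ _ _ du] _ _ _] := st_u.
have gpos := slope_stop_steepest_gt0 f_gtNy u0_dom lambda_lt0 p0_gt1 f_convex
  y_gt0 p_gt1 p_le st_u.
apply: ae_mono2 du gpos => t dut gt0 Tt; have {}gt0 := gt0 Tt.
rewrite (_ : metric_derivative w t = g t); last first.
  apply: cvg_lim => //; apply: dut; by apply: rayy; case: Tt.
by rewrite /epowR gt_eqF.
Qed.

Let measurable_density (D : set R) : measurable_fun D (fun t => (clock_density g p p' t)%:E).
Proof.
by apply/measurable_EFinP; exact: (measurable_funTS (measurable_clock_density st_u p')).
Qed.

Let ik := clock_density_integrable f_gtNy f_lsc u0_dom lambda_lt0 p0_gt1 f_convex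
  y_gt0 p_gt1 p_le st_u p'_gt1.
Let kpos := clock_density_gt0 f_gtNy u0_dom lambda_lt0 p0_gt1 f_convex
  y_gt0 p_gt1 p_le st_u p'.
Let k0 := clock_density_ge0 g p p'.
Let mk := measurable_clock_density st_u p'.

Lemma new_timeE t : ray T t -> new_time p p' u t = (sigma t)%:E.
Proof.
move=> Tt; rewrite /new_clock EFin_Rintegral//; last exact: ik Tt.
apply: ge0_ae_eq_integral_nonmeasurable => //; first exact: measurable_density.
  by move=> r _; rewrite lee_fin k0.
apply: ae_mono clock_densityE => r rE; rewrite /= in_itv/= => /andP[r0 rt].
by apply: rE; exact: ray_le rt Tt.
Qed.

Lemma new_stop_timeE : b = (\int[mu]_(r in ray T) (clock_density g p p' r)%:E)%E.
Proof.
apply: ge0_ae_eq_integral_nonmeasurable => //; first exact: measurable_ray.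
  exact: measurable_density.
by move=> r _; rewrite lee_fin k0.
Qed.

Lemma t_tildeK t : ray T t -> tau (sigma t) = t.
Proof.
move=> Tt; rewrite /t_tilde -(new_timeE Tt).
have inj : {in ray T &, injective (new_time p p' u)}.
  move=> s r Ts Tr; rewrite (new_timeE (set_mem Ts)) (new_timeE (set_mem Tr)) => -[].
  exact: (new_clock_inj f_gtNy f_lsc u0_dom lambda_lt0 p0_gt1 f_convex
    y_gt0 p_gt1 p_le p'_gt1 st_u Ts Tr).
exact: pinvKV inj _ (mem_set Tt).
Qed.

Lemma t_tilde_ray s : ray b s -> ray T (tau s).
Proof. by rewrite new_stop_timeE; exact: (old_clock_ray mk k0 ik t_tildeK). Qed.

Lemma steepest_t_tilde : (0 < T)%E -> exists h, steepest f p' b u0 (w \o tau) h.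
Proof.
move=> T0; rewrite new_stop_timeE; exists (new_speed f +oo w g p p' tau).
exact: (steepest_reparam f_gtNy f_lsc u0_dom lambda_lt0 p0_gt1 f_convex
  y_gt0 p_gt1 p_le st_u p'_gt1 t_tildeK T0).
Qed.

Lemma new_stop_time_gt0 : (0 < T)%E -> (0 < b)%E.
Proof.
move=> T0; rewrite new_stop_timeE.
exact: (new_horizon_gt0 f_gtNy f_lsc u0_dom lambda_lt0 p0_gt1 f_convex
  y_gt0 p_gt1 p_le st_u p'_gt1 T0).
Qed.

(** Expresses that [tau s] tends to the stopping time at the finite horizon, in one form for finite
    and infinite [T]. *)
Lemma near_t_tilde beta t : b = beta%:E -> ray T t ->
  \forall s \near beta^'-, t < tau s /\ ray T (tau s).
Proof.
move=> bE Tt; have bt : ray b (sigma t).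
  by rewrite new_stop_timeE; exact: (new_clock_ray mk k0 ik kpos Tt).
have tb : sigma t < beta by have := bt.2; rewrite bE lte_fin.
near=> s.
have ts : sigma t < s by near: s; exact: nbhs_left_gt.
have bs : ray b s.
  split; first exact: le_trans bt.1 (ltW ts).
  by rewrite bE lte_fin; near: s; exact: nbhs_left_lt.
split; last exact: t_tilde_ray.
rewrite -[t in t < _](t_tildeK Tt).
apply: (old_clock_lt mk k0 ik kpos t_tildeK _ bt.1 ts).
by rewrite -new_stop_timeE.
Unshelve. all: by end_near. Qed.

Lemma case_ii_steepest : ~ case_i f p p' u ->
  exists h, steepest f p' +oo u0 (fun s => eval_ext u (t_ext f p p' u s)) h.
Proof.
move=> case_ii; have [[_ _ _ _ _] u00 _ _] := st_u.
(* The curve starts at a point of zero slope: the new horizon is 0 too, [t_ext] is constantly 0, and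
   the constant curve is wanted. *)
have [T0|T0] := leP T 0%E.
  have TE : T = 0%E by apply/eqP; rewrite eq_le T0 slope_stop_ge0.
  have slope0 : local_slope f u0 = 0%E.
    rewrite -u00; apply: (slope_eq0 f_gtNy f_lsc u0_dom lambda_lt0 p0_gt1 f_convex st_u) => //.
  exists (fun=> 0); apply: (steepest_eq_ray y_gt0) (steepest_const p'_gt1 y_gt0 slope0).
  move=> s [s0 _]; rewrite /t_ext ifF; first by rewrite TE; exact/esym.
  apply/negbTE; rewrite -leNgt /new_stop_time TE (_ : ray 0 = set0) ?integral_set0//.
  by apply/seteqP; split => // r [r0]; rewrite lte_fin ltNge r0.
have [h st_h] := steepest_t_tilde T0; have b0 := new_stop_time_gt0 T0.
case bE : b => [beta| |]; last by rewrite bE in b0.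
  rewrite bE lte_fin in b0.
  have [z [wz slope_z zE]] : exists z, [/\ (w \o tau) @ beta^'- --> z,
      local_slope f z = 0%E & eval_ext u T = z].
    (* For a finite stopping time the limit is the value of the curve there, where the slope
       vanishes. *)
    case TE : T => [r| |]; last by rewrite TE in T0.
      rewrite TE lte_fin in T0; exists (w r); split => //.
        apply: cvg_comp (_ : tau s @[s --> beta^'-] --> r) _; last first.
          have [wg _ _ _] := st_u; apply: (speed_cvg wg) => //.
          by apply: rayy; exact: ltW.
        apply/cvgrPdist_lt => e e0.
        have Tr : ray T (Num.max 0 (r - e / 2)).
          split; first by rewrite le_max lexx.
          by rewrite TE lte_fin gt_max T0/= ltrBlDr ltrDl divr_gt0.
        have := near_t_tilde bE Tr; apply: filterS => s [].
        rewrite gt_max TE => /andP[_ rs] [_]; rewrite lte_fin => sr.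
        by rewrite gtr0_norm ?subr_gt0//; lra.
      apply: (slope_eq0 f_gtNy f_lsc u0_dom lambda_lt0 p0_gt1 f_convex st_u) => //.
        by apply: rayy; exact: ltW.
      by rewrite -TE.
    (* With a finite horizon and an infinite stopping time, divergence would be exactly [case_i]. *)
    have wcvg : cvg (w t @[t --> +oo%R]).
      by apply: contrapT => wdiv; apply: case_ii; split; rewrite ?bE ?ltry.
    exists (lim (w t @[t --> +oo%R])); split => //.
      apply: cvg_comp (_ : tau s @[s --> beta^'-] --> +oo%R) wcvg.
      apply/cvgryPge => M.
      have TM : ray T (Num.max 0 M) by split; rewrite ?TE ?ltry// le_max lexx.
      have := near_t_tilde bE TM; apply: filterS => s [].
      by rewrite gt_max => /andP[_ /ltW].
    exact: (steepest_limit_slope f_gtNy f_lsc u0_dom lambda_lt0 p0_gt1 f_convex p_gt1 p_le st_u).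
  rewrite bE in st_h.
  have [v [h' [st_v vE]]] :=
    steepest_prolong f_gtNy f_lsc u0_dom p'_gt1 b0 st_h wz slope_z.
  exists h'; apply: (steepest_eq_ray y_gt0) st_v => s _.
  by rewrite vE /t_ext bE lte_fin; case: ifP.
exists h; rewrite bE in st_h; apply: (steepest_eq_ray y_gt0) st_h => s _.
by rewrite /t_ext bE ltry.
Qed.

(** Read backwards, [w t = v (sigma t)], and [sigma t] tends to the finite horizon, an interior time
    of [v]. *)
Lemma case_i_maximal v h (a : \bar R) : case_i f p p' u -> (b < a)%E ->
  steepest f p' a u0 v h -> ~ (forall s, ray b s -> v s = w (tau s)).
Proof.
move=> [by_ Ty wdiv] ba st_v vE; apply: wdiv.
have T0 : (0 < T)%E by rewrite Ty ltry.
have b0 := new_stop_time_gt0 T0.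
case bE : b => [beta| |]; [|by move: by_; rewrite bE|by move: b0; rewrite bE].
rewrite bE in ba; have beta0 : 0 < beta by rewrite -lte_fin -bE.
have Tt t : 0 <= t -> ray T t by split; rewrite ?Ty ?ltry.
have ab : ray a beta by split; first exact: ltW.
have [vh _ _ _] := st_v.
apply/cvg_ex; exists (v beta).
have sigma_cvg : sigma t @[t --> +oo%R] --> beta.
  apply/cvgrPdist_lt => e e0.
  have bs : ray b (Num.max 0 (beta - e / 2)).
    by split; rewrite ?le_max ?lexx// bE lte_fin gt_max beta0/= ltrBlDr ltrDl divr_gt0.
  have [t0 Tt0 t0E] : exists2 t, ray T t & sigma t = Num.max 0 (beta - e / 2).
    by apply: (new_clock_surj mk k0 ik); rewrite -new_stop_timeE.
  near=> t; have tt : t0 <= t by near: t; apply: nbhs_pinfty_ge; exact: num_real.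
  have t_ge0 : 0 <= t by apply: le_trans tt; case: Tt0.
  have := new_clock_le k0 ik kpos (Tt0.1) tt (Tt _ t_ge0).
  have := new_clock_ray mk k0 ik kpos (Tt _ t_ge0).
  rewrite -new_stop_timeE bE t0E ge_max => -[_]; rewrite lte_fin => tb /andP[_ bt].
  by rewrite gtr0_norm ?subr_gt0//; lra.
apply: cvg_trans (cvg_comp _ _ sigma_cvg (speed_cvg vh ab beta0)).
apply: near_eq_cvg; near=> t => /=.
have t0 : 0 <= t by near: t; apply: nbhs_pinfty_ge; exact: num_real.
rewrite vE ?t_tildeK//; first exact: Tt.
by rewrite new_stop_timeE; apply: (new_clock_ray mk k0 ik kpos); exact: Tt.
Unshelve. all: by end_near. Qed.

End fixed_curve.
End transform.

Unset Implicit Arguments.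

Theorem corollary1p6 (R : realType) (S : completeMetricType R)
    (f : S -> \bar R) (u0 : S) (p0 lambda : R) (p : R) (u : ray +oo -> S)
    (p' : R)
    (f_gtNy : forall v, f v != -oo%E)
    (f_proper : dom f !=set0)
    (f_lsc : lower_semicontinuous f)
    (u0_dom : dom f u0)
    (lambda_lt0 : lambda < 0)
    (p0_ge2 : 2 <= p0)
    (f_convex : plambda_convex f p0 lambda)
    (p_gt1 : 1 < p) (p_le : p <= p0)
    (CMS_uniq : forall a : \bar R, (0 < a)%E -> (CMS f p a u0 #= `I_1)%card)
    (u_CMS : CMS f p +oo u0 u)
    (p'_gt1 : 1 < p') (p'_le : p' <= p0) :
  let Sstar := existence_time f p' u0 in
  [/\ case_i f p p' u -> Sstar = new_stop_time f p p' u,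
      ~ case_i f p p' u -> Sstar = +oo%E &
      set_bij (CMS f p +oo u0) (CMS f p' Sstar u0) (@Lambda R S f p p' Sstar)].
Proof.
have p0_gt1 : 1 < p0 by rewrite (lt_le_trans _ p0_ge2)// ltr1n.
have y_gt0 : (0 < +oo :> \bar R)%E by exact: ltry.
have CMS_eq a (v w : ray a -> S) : CMS f p a u0 v -> CMS f p a u0 w -> v = w.
  move=> vC; have a0 : (0 < a)%E by case: vC.
  move: vC; have /eq_cardSP[x _] := CMS_uniq a a0; rewrite II0 card_eq0 => /eqP x_only.
  have onlyx y : CMS f p a u0 y -> y = x.
    move=> yC; apply: contrapT => yx; suff : (CMS f p a u0 `\ x) y by rewrite x_only.
    by split.
  by move=> /onlyx -> /onlyx ->.
have p_unique a v w g h : (0 < a)%E -> steepest f p a u0 v g -> steepest f p a u0 w h ->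
    forall t, ray a t -> v t = w t.
  move=> a0 st_v st_w t at_.
  have := CMS_eq _ _ _ (steepest_CMS p_gt1 a0 st_v) (steepest_CMS p_gt1 a0 st_w).
  by move=> /(congr1 (fun c => valL c t)); rewrite !valL_sigL.
have [g st_u] := CMS_steepest f_gtNy u0_dom p_gt1 u_CMS.
(* [steepest_unique] is used with the two exponents exchanged. *)
have unique_p' a (v w : R -> S) hv hw (a0 : (0 < a)%E) :
    steepest f p' a u0 v hv -> steepest f p' a u0 w hw -> forall t, ray a t -> v t = w t.
  exact: (steepest_unique f_gtNy f_lsc u0_dom lambda_lt0 p0_gt1 f_convex
    a0 p'_gt1 p'_le p_gt1 p_unique).
move=> Sstar.
have Sstar_ii : ~ case_i f p p' u -> Sstar = +oo%E.
  move=> ci; have [h st_h] := case_ii_steepest f_gtNy f_lsc u0_dom lambda_lt0 p0_gt1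
    f_convex p_gt1 p_le p'_gt1 st_u ci.
  by apply/eqP; rewrite -leye_eq; exact: existence_time_ge p'_gt1 y_gt0 st_h.
have curve_i : case_i f p p' u ->
    (0 < new_stop_time f p p' u)%E /\
    exists h, steepest f p' (new_stop_time f p p' u) u0 (valL u \o t_tilde f p p' u) h.
  move=> [_ Ty _]; have T0 : (0 < stop_time f u)%E by rewrite Ty.
  split; last exact: (steepest_t_tilde f_gtNy f_lsc u0_dom lambda_lt0 p0_gt1
    f_convex p_gt1 p_le p'_gt1 st_u T0).
  exact: (new_stop_time_gt0 f_gtNy f_lsc u0_dom lambda_lt0 p0_gt1
    f_convex p_gt1 p_le p'_gt1 st_u T0).
have Sstar_i : case_i f p p' u -> Sstar = new_stop_time f p p' u.
  move=> ci; have [b0 [h st_h]] := curve_i ci.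
  apply/eqP; rewrite eq_le (existence_time_ge p'_gt1 b0 st_h) andbT.
  apply: existence_time_le; first exact: ltW.
  move=> a ba; apply/seteqP; split => // v /(CMS_steepest f_gtNy u0_dom p'_gt1)[k st_v].
  apply: (case_i_maximal f_gtNy f_lsc u0_dom lambda_lt0 p0_gt1
    f_convex p_gt1 p_le p'_gt1 st_u ci ba st_v).
  exact: unique_p' b0 (steepest_restrict (ltW ba) st_v) st_h.
(* Both cases yield one curve on [[0, Sstar[], so the bijection is proved only once: source and
   target have at most one element, and this curve lies in the target. *)
have Lambda_steepest : exists v h, [/\ (0 < Sstar)%E, steepest f p' Sstar u0 v h &
    Lambda f p p' (b := Sstar) u = sigL (ray Sstar) v].
  have [ci|ci] := pselect (case_i f p p' u).
    have [b0 [h st_h]] := curve_i ci.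
    exists (valL u \o t_tilde f p p' u), h; rewrite Sstar_i//; split => //.
    by apply/funext => s; rewrite /Lambda asboolT.
  have [h st_h] := case_ii_steepest f_gtNy f_lsc u0_dom lambda_lt0 p0_gt1
    f_convex p_gt1 p_le p'_gt1 st_u ci.
  exists (fun s => eval_ext u (t_ext f p p' u s)), h; rewrite Sstar_ii//; split => //.
  by apply/funext => s; rewrite /Lambda asboolF.
have [v [h [S0 st_v LambdaE]]] := Lambda_steepest.
split; [exact: Sstar_i|exact: Sstar_ii|split].
- by move=> w wC; rewrite (CMS_eq _ _ _ wC u_CMS) LambdaE; exact: steepest_CMS st_v.
- by move=> w1 w2 /set_mem w1C /set_mem w2C _; exact: CMS_eq.
- move=> w wC; exists u => //; rewrite LambdaE.
  have [k st_w] := CMS_steepest f_gtNy u0_dom p'_gt1 wC.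
  apply/funext => x; rewrite -(valL_val w x) /=.
  exact: (unique_p' _ _ _ _ _ S0 st_v st_w (val x) (set_valP x)).
Qed.
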